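(* Let $d\ge3$ and consider the billiard inside the ellipsoid $\mathcal C_0$ of the confocal family $\mathcal C_\lambda:\ \frac{x_1^2}{b_1-\lambda}+\dots+\frac{x_d^2}{b_d-\lambda}=1$, $0<b_1<\dots<b_d$, together with $d-1$ caustics $\mathcal C_{\alpha_1},\dots,\mathcal C_{\alpha_{d-1}}$ ($\alpha_1<\dots<\alpha_{d-1}$) from the same confocal family which are tangent to an $n$-periodic trajectory with winding numbers $(m_0=n,m_1,\dots,m_{d-1})$. If the semi-axes of the boundary ellipsoid vary and the caustics are deformed so that the generated trajectories remain $n$-periodic with the same winding numbers, then the caustics $\mathcal C_{\alpha_j}$ deform in such a way that the reciprocals $u_j=1/\alpha_j$, $j=1,\dots,d-1$, of their confocal parameters obey the Chebyshev dynamics as dependent variables (dependent endpoints of intervals), while the reciprocals of the squares of the semi-axes $x_j=1/b_j$, $j=1,\dots,d-1$, are the independent variables (independently varying endpoints of intervals); here the $d$ intervals are $[0,1/b_d]$, which plays the role of the fixed interval, and the $d-1$ intervals with endpoints $1/b_j$ and $1/\alpha_j$, $j=1,\dots,d-1$.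
   Context: Jacobi coordinates of a point of $\mathbb R^d$ are the parameters $\lambda_1<\dots<\lambda_d$ of the $d$ quadrics $\mathcal C_\lambda$ through it. Along a billiard trajectory each Jacobi coordinate moves monotonically in a certain segment between its endpoints, reversing direction at the endpoints, which correspond to reflection off the boundary ($\lambda=0$), touching a caustic ($\lambda=\alpha_k$) or crossing a coordinate hyperplane ($\lambda=b_j$). For a trajectory of period $n$, the winding numbers $m_0=n,m_1,\dots,m_{d-1}$ are the numbers of turns the Jacobi coordinates $\lambda_1,\lambda_2,\dots,\lambda_d$ respectively make in their segments during one period. The numbers $b_1,\dots,b_d,\alpha_1,\dots,\alpha_{d-1}$ are assumed distinct; write $\{e_1<\dots<e_{2d-1}\}=\{b_1,\dots,b_d,\alpha_1,\dots,\alpha_{d-1}\}$, $c_{2d}=0$, $c_j=1/e_j$. It is known that $\alpha_j\in\{e_{2j-1},e_{2j}\}$, so $e_{2d-1}=b_d$, $[c_{2d},c_{2d-1}]=[0,1/b_d]$, and $[c_{2j},c_{2j-1}]$ has endpoints $1/b_j$ and $1/\alpha_j$ for $1\le j\le d-1$. Chebyshev polynomials: a union of $d$ intervals $\bigcup_{j=1}^d[c_{2j},c_{2j-1}]$ supports a Chebyshev polynomial of degree $n$ if there are real polynomials $\mathcal P_n,\mathcal Q_{n-d}$ of degrees $n$, $n-d$ with $\mathcal P_n^2-\Delta_{2d}\mathcal Q_{n-d}^2=1$, $\Delta_{2d}(s)=\prod_{j=1}^{2d}(s-c_j)$. Its signature is $(\tau_1,\dots,\tau_d)$, $\tau_j$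 being the number of zeros of $\mathcal Q_{n-d}$ in $(c_{2j},c_{2j-1})$. Chebyshev dynamics: starting from $d$ intervals supporting a Chebyshev polynomial, keep one interval fixed and vary one endpoint of each of the remaining $d-1$ intervals (independent endpoints); the remaining $d-1$ endpoints (dependent endpoints) vary as functions of the independent ones so that the Pell equation remains solvable during the entire process with the same degree of the Chebyshev polynomial and the same signature. *)

(* Defs.v *)
From HB Require Import structures.
From mathcomp Require Import all_boot all_order all_algebra.
From mathcomp Require Import polyrcf.
From mathcomp Require Import all_classical all_reals all_analysis.

Set Implicit Arguments.
Unset Strict Implicit.
Unset Printing Implicit Defensive.

Import Order.TTheory GRing.Theory Num.Theory.
Import numFieldNormedType.Exports.

Local Open Scope ring_scope.

(* The dimension is d = N + 1 throughout, so that the d - 1 caustics are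
   indexed by 'I_N.  Indices start from 0: [b (lift ord_max j)] and [a j] are
   b_{j+1} and alpha_{j+1}, and [b ord_max] is b_d. *)

Section Billiard.
Variables (R : realType) (N : nat).
Implicit Types (b : 'I_N.+1 -> R) (a : 'I_N -> R).
Implicit Types (x y v : 'rV[R]_N.+1) (p : nat -> 'rV[R]_N.+1).

Definition confocal_form b (l : R) x y : R :=
  \sum_i x 0 i * y 0 i / (b i - l).

Definition on_quadric b (l : R) x : Prop := confocal_form b l x x = 1.

Definition dotv x y : R := \sum_i x 0 i * y 0 i.

Definition mirror (nu v : 'rV[R]_N.+1) : 'rV[R]_N.+1 :=
  v - (2 * dotv v nu / dotv nu nu) *: nu.

(* Half the gradient of the equation of the boundary ellipsoid. *)
Definition normal b x : 'rV[R]_N.+1 := \row_i (x 0 i / b i).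

Definition billiard_trajectory b p : Prop :=
  [/\ forall k, on_quadric b 0 (p k),
      forall k, p k.+1 != p k &
      forall k, exists2 r : R, 0 < r &
        p k.+2 - p k.+1 = r *: mirror (normal b (p k.+1)) (p k.+1 - p k)].

(* The contact point, written [s x + t v : s] in homogeneous coordinates, may
   lie at infinity (a line may be asymptotic to a hyperboloid).  The two
   equations say that its polar hyperplane with respect to C_l contains x and
   the direction v; together they imply that it lies on C_l. *)
Definition tangent_line b (l : R) x v : Prop :=
  exists s t : R, [/\ (s, t) != (0, 0),
    s * (confocal_form b l x x - 1) + t * confocal_form b l x v = 0 &
    s * confocal_form b l x v + t * confocal_form b l v v = 0].

Definition caustic b (l : R) p : Prop :=
  forall k, tangent_line b l (p k) (p k.+1 - p k).

(* The equation of C_l multiplied by the product of the b_i - l, as a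
   polynomial in l.  A point on the hyperplane x_i = 0 gets the root b_i. *)
Definition confocal_poly b x : {poly R} :=
  \prod_i ((b i)%:P - 'X)
  - \sum_i (x 0 i ^+ 2) *: \prod_(j | j != i) ((b j)%:P - 'X).

Definition jacobi_coordinates b x (l : 'I_N.+1 -> R) : Prop :=
  (forall i j : 'I_N.+1, (i < j)%N -> l i < l j) /\
  (forall i, root (confocal_poly b x) (l i)).

(* The trajectory as a polygonal curve, the k-th chord being run over the time
   interval [k, k + 1]; only times s >= 0 are meaningful. *)
Definition trajectory_point p (s : R) : 'rV[R]_N.+1 :=
  let k := Num.truncn s in p k + (s - k%:R) *: (p k.+1 - p k).

(* 0, e_1, ..., e_{2d-1}, where e_1 < ... < e_{2d-1} are the b_i and alpha_j. *)
Definition segment_ends b a : seq R :=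
  0 :: sort <=%O ([seq b i | i : 'I_N.+1] ++ [seq a j | j : 'I_N]).

(* Over a time span n, starting at some visit of lo, f makes m times the way
   monotonically from lo to hi and monotonically back to lo. *)
Definition makes_turns (f : R -> R) (lo hi : R) (n m : nat) : Prop :=
  exists s : nat -> R,
  [/\ 0 <= s 0%N,
      forall i, (i < m.*2)%N -> s i < s i.+1,
      s m.*2 = s 0%N + n%:R &
      f (s 0%N) = lo /\
      forall i, (i < m)%N ->
        [/\ f (s i.*2.+1) = hi, f (s i.*2.+2) = lo,
            {in `[s i.*2, s i.*2.+1] &, {homo f : u v / u <= v}} &
            {in `[s i.*2.+1, s i.*2.+2] &, {homo f : u v /~ u <= v}}]].

(* m i is the number of turns of the coordinate lambda_{i+1}, whose segment is
   [0, e_1] for i = 0 and [e_{2i}, e_{2i+1}] for i > 0. *)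
Definition winding_numbers b a p (n : nat) (m : 'I_N.+1 -> nat) : Prop :=
  exists l : 'I_N.+1 -> R -> R,
    (forall s, 0 <= s ->
       jacobi_coordinates b (trajectory_point p s) (fun i => l i s)) /\
    (forall i, makes_turns (l i) (nth 0 (segment_ends b a) i.*2)
                 (nth 0 (segment_ends b a) i.*2.+1) n (m i)).

Definition periodic_trajectory b a p (n : nat) (m : 'I_N.+1 -> nat) : Prop :=
  [/\ billiard_trajectory b p,
      forall j, caustic b (a j) p,
      (0 < n)%N /\ forall k, p (k + n)%N = p k &
      winding_numbers b a p n m].

Definition generic_parameters b a : Prop :=
  [/\ forall i, 0 < b i,
      forall i j : 'I_N.+1, (i < j)%N -> b i < b j,
      forall i j : 'I_N, (i < j)%N -> a i < a j &
      forall i j, b i != a j].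

End Billiard.

Section Chebyshev.
Variable R : realType.

(* The intervals [lo j, hi j] are numbered from right to left. *)
Definition interval_system (d : nat) (lo hi : 'I_d -> R) : Prop :=
  (forall j, lo j < hi j) /\
  (forall i j : 'I_d, (i < j)%N -> hi j < lo i).

Definition Delta (d : nat) (lo hi : 'I_d -> R) : {poly R} :=
  \prod_j (('X - (lo j)%:P) * ('X - (hi j)%:P)).

Definition supports_chebyshev (d : nat) (lo hi : 'I_d -> R) (n : nat)
    (tau : 'I_d -> nat) : Prop :=
  [/\ interval_system lo hi, (d <= n)%N &
      exists P Q : {poly R},
        [/\ size P = n.+1, size Q = (n - d).+1,
            P ^+ 2 - Delta lo hi * Q ^+ 2 = 1 &
            forall j, size (roots Q (lo j) (hi j)) = tau j]].

Definition fill (A : Type) (N : nat) (j0 : 'I_N.+1) (f : A) (g : 'I_N -> A)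
    (j : 'I_N.+1) : A :=
  if unlift j0 j is Some i then g i else f.

(* The j0-th interval is the fixed one, [f0, f1]; the others have the
   independent endpoints x and the dependent endpoints u, in either order.
   The process is parametrized by t, and F expresses the dependent endpoints
   as functions of the independent ones. *)
Definition chebyshev_dynamics (N : nat) (T : topologicalType) (n : nat)
    (tau : 'I_N.+1 -> nat) (j0 : 'I_N.+1) (f0 f1 : R)
    (x u : T -> 'I_N -> R) : Prop :=
  [/\ forall j, continuous (fun t => x t j),
      forall j, continuous (fun t => u t j),
      exists F : ('I_N -> R) -> 'I_N -> R, forall t j, u t j = F (x t) j &
      forall t, supports_chebyshev
        (fill j0 f0 (fun j => Num.min (x t j) (u t j)))
        (fill j0 f1 (fun j => Num.max (x t j) (u t j))) n tau].

End Chebyshev.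

(* Main.v *)
Require Import Defs.
From mathcomp Require Import all_boot all_order all_algebra.
From mathcomp Require Import separable.
From mathcomp Require Import polyrcf qe_rcf_th zify ring lra.
From mathcomp Require Import all_classical all_reals all_analysis.

Set Implicit Arguments.
Unset Strict Implicit.
Unset Printing Implicit Defensive.

Import Order.TTheory GRing.Theory Num.Theory.
Import numFieldNormedType.Exports.

Local Open Scope ring_scope.

(** Write [s] for the reciprocal of the confocal parameter.  Along a chord the
    equation of the quadric of parameter [1/s] is a binary quadratic form in
    the two homogeneous parameters of the line; cleared of denominators, it has
    the entries [point_form], [mixed_form] and [dir_form], polynomials in [s].
    Running along a chord of length [t] acts on the form by the shear
    [y := y + t v]; a reflection acts by a shear [v := v - kappa s y].  These
    are the equations of motion of a massless string loaded with beads, a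
    spectral problem with parameter [s].  The discriminant of the form does not
    change along the trajectory.  It vanishes at [0], at the [1/b_i] and, by
    tangency, at the [1/alpha_j]; by its degree and its leading coefficient it
    is a positive multiple of [Delta].

    Pell's equation ([billiard_pell]).  Over a period the transfer matrix has
    determinant 1 and preserves the form, whose entries are coprime because
    [Delta] has simple roots.  So it is [P] times the identity plus [Q] times a
    matrix made of the entries, and its determinant is [P ^+ 2] minus the
    discriminant times [Q ^+ 2].  Every bead raises the degree by one, so the
    degree of [P] is the period.

    Signature ([trajectory_pell]).  At the reciprocal of an end [e] of a segment
    the form degenerates to the square, up to sign, of a solution of the string
    equation ([edge_solution]); this solution vanishes exactly when some Jacobi
    coordinate equals [e].  Thus its zeros over a period number the winding
    number of the coordinate, and the winding numbers at the two ends of the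
    [i]-th interval are [m i] and [m i.+1], to be read as 0 for the interval
    that ends at 0.  By Sturm oscillation
    ([dirichlet_roots_ge]) the position polynomial of the Dirichlet solution
    has at least [m i - m i.+1 - 1] roots in between, and these are roots of [Q].
    The sum of these numbers is the degree of [Q], so the signature is known: it
    depends on the winding numbers only.  That the intervals are those joining
    [1/b_j] and [1/alpha_j] follows from the interlacing of Jacobi coordinates
    with the [b_j] ([jacobi_le], [jacobi_ge]) and from the fact that each
    coordinate reaches both ends of its segment.

    Dependence ([pell_endpoints_unique]).  Take two solutions of Pell's equation
    with the same degree and signature, whose systems of intervals have one
    interval in common and in each other pair share one endpoint.  On an
    interval, [P ^+ 2] oscillates between 0 and 1 as often as the signature
    permits, so that the difference of the two squares, of degree at most
    [2 n], weakly alternates in sign more than [2 n] times and vanishes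
    ([alternates_eq0]).  The intervals are the set where the square is at most
    1, so they agree as well.  It remains to see that the dependent end of an
    interval is always the same one: [alpha_j] and [b_j] never coincide, so
    their order is constant on a connected parameter space. *)

(** * Weak alternation of signs *)

Section Alternation.
Variable R : rcfType.
Implicit Types (p q : {poly R}) (s : bool) (xs ys : seq R).

Fixpoint alternates p s xs : bool :=
  if xs is x :: xs' then (0 <= (-1) ^+ s * p.[x]) && alternates p (~~ s) xs'
  else true.

Lemma alternates_cat p s xs ys :
  alternates p s (xs ++ ys)
  = alternates p s xs && alternates p (s (+) odd (size xs)) ys.
Proof.
elim: xs s => [|x xs ih] s /=; first by rewrite addbF.
by rewrite ih andbA; case: s; rewrite //= ?negbK.
Qed.

Lemma alternates_mulr p q s xs : {in xs, forall x, 0 < q.[x]} ->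
  alternates (p * q) s xs = alternates p s xs.
Proof.
elim: xs s => [//|x xs ih] s hq /=; rewrite ih; last first.
  by move=> y hy; apply: hq; rewrite inE hy orbT.
by rewrite hornerM mulrA pmulr_lge0 // hq // mem_head.
Qed.

Lemma alternates_opp p s xs : alternates (- p) s xs = alternates p (~~ s) xs.
Proof.
elim: xs s => [//|x xs ih] s /=; rewrite ih hornerN.
by congr (_ && _); case: s; rewrite /= expr0 expr1 !mulN1r !mul1r ?opprK.
Qed.

(** Two neighbouring points enclose a root.  Dividing by its linear factor and
    forgetting one of the two points lowers both the degree and the number of
    points by one, and keeps the signs alternating. *)
Lemma alternates_eq0 p s xs : sorted <%R xs -> (size p < size xs)%N ->
  alternates p s xs -> p = 0.
Proof.
have [m] := ubnP (size xs); elim: m p s xs => [//|m ih] p s [//|x [|y t]] /=.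
  by move=> _ _; rewrite ltnS leqn0 size_poly_eq0 => /eqP.
rewrite ltnS => szt /andP[xy yt] szp /and3P[px py pt].
have {}yt : path <%R y t by [].
have gty : {in t, forall z, y < z}.
  by apply/allP; apply: order_path_min yt; apply: lt_trans.
apply/eqP; apply/negPn/negP => p0.
have szq r q : p = q * ('X - r%:P) -> (size q).+1 = size p.
  move=> pE; have q0 : q != 0 by apply: contraNneq p0 => q0; rewrite pE q0 mul0r.
  by rewrite pE size_Mmonic ?monicXsubC // size_XsubC addn2.
(* a root at [y] is removed with [y] itself, any other one with [x] *)
have [py0|py0] := eqVneq p.[y] 0.
  have /factor_theorem[q pE] : root p y by apply/rootP.
  have hsz := szq _ _ pE.
  suff q0 : q = 0 by move: p0; rewrite pE q0 mul0r eqxx.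
  apply: (ih q (~~ s) (x :: t)) => //=.
  - case: t yt gty {szt szp pt} => [//|z t] /= /andP[_ ->] gty.
    by rewrite (lt_trans xy) // gty // mem_head.
  - by move: szp; rewrite -hsz ltnS.
  apply/andP; split; last first.
    move: pt; rewrite pE negbK; rewrite alternates_mulr // => z zt.
    by rewrite !hornerE subr_gt0 gty.
  move: px; rewrite pE hornerM hornerXsubC mulrA.
  have hxy : x - y < 0 by rewrite subr_lt0.
  by rewrite nmulr_lge0 //; case: (s); rewrite /= expr0 expr1 ?mulN1r ?mul1r ?oppr_le0 ?oppr_ge0.
have hxy : p.[x] * p.[y] <= 0.
  move: px py; case: (s); rewrite /= expr0 expr1 ?mulN1r ?mul1r.
    by rewrite oppr_ge0; apply: mulr_le0_ge0.
  by rewrite oppr_ge0; apply: mulr_ge0_le0.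
have [r rxy rr] := polyrcf.poly_ivt (ltW xy) hxy.
have /factor_theorem[q pE] := rr.
have ry : r < y.
  rewrite lt_neqAle (itvP rxy) andbT.
  by apply: contraNneq py0 => <-; exact: rr.
suff q0 : q = 0 by move: p0; rewrite pE q0 mul0r eqxx.
have hsz := szq _ _ pE.
apply: (ih q (~~ s) (y :: t)) => //=.
  by move: szp; rewrite -hsz ltnS.
have h : alternates p (~~ s) (y :: t) by rewrite /= py pt.
move: h; rewrite pE alternates_mulr //= => z; rewrite inE => /orP[/eqP->|/gty yz].
  by rewrite !hornerE subr_gt0.
by rewrite !hornerE subr_gt0 (lt_trans ry).
Qed.

Definition weak_changes p (k : nat) (a b : R) : Prop :=
  exists s xs, [/\ size xs = k.+1, sorted <%R xs,
    {in xs, forall x, a <= x <= b} & alternates p s xs].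

Lemma weak_changes_eq0 p k a b :
  weak_changes p k a b -> (size p <= k)%N -> p = 0.
Proof.
case=> s [xs [sz srt _ alt]] szp.
by apply: (alternates_eq0 srt _ alt); rewrite sz.
Qed.

(** The two alternations may be out of step, so one point is lost where they
    join. *)
Lemma weak_changes_cat p k k' a b c d : b < c ->
  weak_changes p k a b -> weak_changes p k' c d ->
  weak_changes p (k + k') a d.
Proof.
move=> bc [s [xs [sz srt xin alt]]] [s' [ys [sz' srt' yin alt']]].
have sorted_cat zs : sorted <%R zs -> {subset zs <= ys} -> sorted <%R (xs ++ zs).
  move=> hz sub; rewrite lt_sorted_pairwise pairwise_cat -!lt_sorted_pairwise.
  rewrite srt hz !andbT; apply/allrelP => x z xx zz.
  by have /andP[_ ?] := xin _ xx; have /andP[? _] := yin _ (sub _ zz); lra.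
have in_cat zs : {subset zs <= ys} -> {in xs ++ zs, forall x, a <= x <= d}.
  have [x0 x0in] : exists x, x \in xs.
    by case: (xs) sz => [//|x ? _]; exists x; rewrite mem_head.
  have [y0 y0in] : exists x, x \in ys.
    by case: (ys) sz' => [//|x ? _]; exists x; rewrite mem_head.
  have /andP[? ?] := xin _ x0in; have /andP[? ?] := yin _ y0in.
  move=> sub z; rewrite mem_cat => /orP[/xin|/sub/yin] /andP[? ?]; apply/andP; split; lra.
have [s's|s's] := eqVneq s' (s (+) odd (size xs)).
  (* in step: all points alternate, and the last one is superfluous *)
  case/lastP: ys sz' srt' yin alt' sorted_cat in_cat => [//|ys y].
  rewrite size_rcons => -[sz'] srt' yin alt' sc ic; exists s, (xs ++ ys); split.
  - by rewrite size_cat sz sz' addSn.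
  - apply: sc; last by move=> z; rewrite mem_rcons inE => ->; rewrite orbT.
    by move: srt'; rewrite -cats1 lt_sorted_pairwise pairwise_cat -lt_sorted_pairwise => /and3P[].
  - by apply: ic => z; rewrite mem_rcons inE => ->; rewrite orbT.
  - rewrite alternates_cat alt -s's; move: alt'; rewrite -cats1 alternates_cat.
    by case/andP.
(* out of step: dropping the first point of [ys] restores the alternation *)
case: ys sz' srt' yin alt' sorted_cat in_cat => [//|y ys] /= [sz'] srt' yin /andP[_ alt'] sc ic.
exists s, (xs ++ ys); split.
- by rewrite size_cat sz sz' addSn.
- apply: sc; last by move=> z zz; rewrite inE zz orbT.
  exact: path_sorted srt'.
- by apply: ic => z zz; rewrite inE zz orbT.
- rewrite alternates_cat alt; move: alt' s's.
  by case: s' => /=; case: (_ (+) _).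
Qed.

Lemma weak_changes_mulr p q k a b : (forall x, a <= x <= b -> 0 < q.[x]) ->
  weak_changes (p * q) k a b -> weak_changes p k a b.
Proof.
move=> q_gt0 [s [xs [sz srt xin alt]]]; exists s, xs; split => //.
by rewrite -(@alternates_mulr _ q) // => x /xin /q_gt0.
Qed.

Lemma weak_changes_opp p k a b : weak_changes (- p) k a b -> weak_changes p k a b.
Proof.
move=> [s [xs [sz srt xin alt]]]; exists (~~ s), xs; split => //.
by rewrite -alternates_opp.
Qed.

Lemma weak_changes_sum p (A B : nat -> R) (k : nat -> nat) M :
  (forall j, (j <= M)%N -> weak_changes p (k j) (A j) (B j)) ->
  (forall i j, (i < j)%N -> (j <= M)%N -> B j < A i) ->
  weak_changes p (\sum_(j < M.+1) k j) (A M) (B 0%N).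
Proof.
elim: M => [|M ih] wk lt; first by rewrite big_ord1; apply: wk.
rewrite big_ord_recr /= addnC.
apply: (weak_changes_cat (lt M M.+1 _ _)) => //; first exact: wk.
by apply: ih => [j jM|i j ij jM]; [apply: wk|apply: lt] => //; apply: leqW.
Qed.

End Alternation.

(** * Solutions of Pell's equation on a system of intervals *)

Section Pell.
Variables (R : realType) (M : nat).
Implicit Types (lo hi : 'I_M.+1 -> R) (tau : 'I_M.+1 -> nat) (P Q : {poly R}).

(** The last condition says that the intervals contain all the roots of [Q]. *)
Definition pell_solution lo hi n tau P Q : Prop :=
  [/\ interval_system lo hi,
      size P = n.+1 /\ size Q = (n - M.+1).+1,
      P ^+ 2 - Delta lo hi * Q ^+ 2 = 1,
      forall j, size (roots Q (lo j) (hi j)) = tau j &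
      (\sum_j (tau j).+1 = n)%N].

Definition outside lo hi (x : R) := forall i, x < lo i \/ hi i < x.

Lemma outside_beyond lo hi (i : 'I_M.+1) x : interval_system lo hi ->
  (forall k : 'I_M.+1, (k < i)%N -> x < lo k) -> hi i < x -> outside lo hi x.
Proof.
move=> [lt_lh lt_hl] xlo hix k; have [ki|ik|/val_inj->] := ssrnat.ltngtP k i.
- by left; apply: xlo.
- by right; have := lt_lh i; have := lt_hl _ _ ik; lra.
- by right.
Qed.

Lemma outside_before lo hi (i : 'I_M.+1) x : interval_system lo hi ->
  (forall k : 'I_M.+1, (i < k)%N -> hi k < x) -> x < lo i -> outside lo hi x.
Proof.
move=> [lt_lh lt_hl] xhi xlo k; have [ki|ik|/val_inj->] := ssrnat.ltngtP k i.
- by left; have := lt_lh i; have := lt_hl _ _ ki; lra.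
- by right; apply: xhi.
- by left.
Qed.

Lemma Delta_horner lo hi x :
  (Delta lo hi).[x] = \prod_j ((x - lo j) * (x - hi j)).
Proof. by rewrite horner_prod; apply: eq_bigr => j _; rewrite !hornerE. Qed.

Lemma Delta_gt0 lo hi x : interval_system lo hi -> outside lo hi x ->
  0 < (Delta lo hi).[x].
Proof.
move=> [lt_lh _] out; rewrite Delta_horner; apply: prodr_gt0 => j _.
have := lt_lh j; case: (out j) => h1 h2; first by rewrite nmulr_rgt0 ?subr_lt0 //; lra.
by rewrite pmulr_rgt0 ?subr_gt0 //; lra.
Qed.

Lemma Delta_rest_gt0 lo hi j x : interval_system lo hi -> lo j <= x <= hi j ->
  0 < \prod_(i | i != j) ((x - lo i) * (x - hi i)).
Proof.
move=> [lt_lh lt_hl] /andP[jx xj]; apply: prodr_gt0 => i ij.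
have := lt_lh i; have [h|h|h] := ssrnat.ltngtP i j.
- by have := lt_hl _ _ h => ? ?; rewrite nmulr_rgt0 ?subr_lt0 //; lra.
- by have := lt_hl _ _ h => ? ?; rewrite pmulr_rgt0 ?subr_gt0 //; lra.
- by move: ij; rewrite (val_inj h) eqxx.
Qed.

Lemma Delta_le0 lo hi j x : interval_system lo hi -> lo j <= x <= hi j ->
  (Delta lo hi).[x] <= 0.
Proof.
move=> ivs hx; have pos := Delta_rest_gt0 ivs hx.
rewrite Delta_horner (bigD1 j) //= pmulr_lle0 //.
by case/andP: hx => jx xj; apply: mulr_ge0_le0; lra.
Qed.

Lemma Delta_lt0 lo hi j x : interval_system lo hi -> lo j < x < hi j ->
  (Delta lo hi).[x] < 0.
Proof.
move=> ivs /andP[jx xj].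
have hx : lo j <= x <= hi j by rewrite !ltW.
have pos := Delta_rest_gt0 ivs hx.
by rewrite Delta_horner (bigD1 j) //= pmulr_llt0 // pmulr_rlt0 ?subr_gt0 ?subr_lt0.
Qed.

Lemma Delta_lo lo hi j : (Delta lo hi).[lo j] = 0.
Proof. by rewrite Delta_horner (bigD1 j) //= subrr !mul0r. Qed.

Lemma Delta_hi lo hi j : (Delta lo hi).[hi j] = 0.
Proof. by rewrite Delta_horner (bigD1 j) //= subrr mulr0 !mul0r. Qed.

Lemma interval_disjoint lo hi (i j : 'I_M.+1) x : interval_system lo hi ->
  lo i <= x <= hi i -> lo j <= x <= hi j -> i = j.
Proof.
move=> [_ lt_hl] /andP[h1 h2] /andP[h3 h4].
have [ij|ij|/val_inj //] := ssrnat.ltngtP i j.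
  by exfalso; have := lt_hl _ _ ij; lra.
by exfalso; have := lt_hl _ _ ij; lra.
Qed.

Definition interval_roots lo hi Q : seq R :=
  [seq y | j <- enum 'I_M.+1, y <- roots Q (lo j) (hi j)].

Lemma uniq_interval_roots lo hi Q : interval_system lo hi ->
  uniq (interval_roots lo hi Q).
Proof.
move=> ivs; apply: allpairs_uniq_dep; first exact: enum_uniq.
  by move=> j _; apply: uniq_roots.
move=> p q /allpairsPdep[i [x [_ hx ->]]] /allpairsPdep[j [y [_ hy ->]]] /= xy.
rewrite -xy in hy *; suff -> : i = j by [].
move: (roots_in hx) (roots_in hy); rewrite !in_itv /= => /andP[? ?] /andP[? ?].
by apply: (@interval_disjoint _ _ _ _ x ivs); rewrite !ltW.
Qed.

Lemma size_interval_roots lo hi Q :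
  size (interval_roots lo hi Q) = (\sum_j size (roots Q (lo j) (hi j)))%N.
Proof. by rewrite size_allpairs_dep sumnE big_map big_enum. Qed.

Section OneSolution.
Variables (lo hi : 'I_M.+1 -> R) (n : nat) (tau : 'I_M.+1 -> nat).
Variables (P Q : {poly R}).
Hypothesis pell : pell_solution lo hi n tau P Q.

Let ivs : interval_system lo hi. Proof. by case: pell. Qed.
Let lt_lh j : lo j < hi j. Proof. by case: ivs => + _; apply. Qed.
Let lt_hl (i j : 'I_M.+1) : (i < j)%N -> hi j < lo i.
Proof. by case: ivs => _; apply. Qed.
Let size_Q : size Q = (n - M.+1).+1. Proof. by case: pell => _ []. Qed.
Let Q_neq0 : Q != 0. Proof. by rewrite -size_poly_gt0 size_Q. Qed.

Lemma pell_horner x : P.[x] ^+ 2 = 1 + (Delta lo hi).[x] * Q.[x] ^+ 2.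
Proof.
have [_ _ E _ _] := pell; have := congr1 (horner^~ x) E.
by rewrite /= !hornerE => E'; rewrite -E'; ring.
Qed.

Lemma pell_le1 j x : lo j <= x <= hi j -> P.[x] ^+ 2 <= 1.
Proof.
move=> hx; rewrite pell_horner gerDl; have := Delta_le0 ivs hx.
by move=> h; apply: mulr_le0_ge0 => //; apply: sqr_ge0.
Qed.

Let size_rootsQ : size (interval_roots lo hi Q) = (n - M.+1)%N.
Proof.
have [_ _ _ tauE sum_tau] := pell.
rewrite size_interval_roots (eq_bigr tau) => [|j _]; last exact: tauE.
have : (\sum_j (tau j).+1 = \sum_j tau j + M.+1)%N.
  under eq_bigr do rewrite -addn1; by rewrite big_split /= sum1_card card_ord.
by rewrite sum_tau => ->; rewrite addnK.
Qed.

(** The intervals already contain as many roots of [Q] as its degree allows. *)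
Lemma pell_root_inside x : Q.[x] = 0 -> exists j, lo j < x < hi j.
Proof.
move=> Qx; have [/allpairsPdep[j [y [_ hy ->]]]|xnin] := boolP (x \in interval_roots lo hi Q).
  by exists j; have := roots_in hy; rewrite in_itv.
suff : (size (x :: interval_roots lo hi Q) < size Q)%N by rewrite /= size_rootsQ size_Q ltnn.
apply: max_poly_roots => //=; last by rewrite xnin uniq_interval_roots.
apply/andP; split; first by apply/rootP.
by apply/allP => y /allpairsPdep[j [z [_ hz ->]]]; apply: root_roots hz.
Qed.

(** Together with [pell_le1], this recovers the intervals from [P ^+ 2]. *)
Lemma pell_gt1 x : outside lo hi x -> 1 < P.[x] ^+ 2.
Proof.
move=> out; rewrite pell_horner ltrDl mulr_gt0 ?Delta_gt0 // lt_neqAle sqr_ge0 andbT.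
rewrite eq_sym sqrf_eq0; apply/eqP => /pell_root_inside[j /andP[h1 h2]].
by case: (out j) => h; lra.
Qed.

Let degree_ge : (M.+1 <= n)%N.
Proof.
have [_ _ _ _ <-] := pell; rewrite -[leqLHS]card_ord -sum1_card.
by apply: leq_sum.
Qed.

(** Differentiating the equation shows that [Q], which is prime to [P],
    divides [P^`()]; the cofactor has degree at most [M]. *)
Lemma deriv_pell :
  exists W : {poly R}, [/\ P^`() = Q * W, W != 0 & (size W <= M.+1)%N].
Proof.
have [_ [szP _] E _ sum_tau] := pell.
have dE : 2%:P * P * P^`()
    = Q * ((Delta lo hi)^`() * Q + 2%:P * Delta lo hi * Q^`()).
  have := congr1 (@deriv R) E; rewrite derivB !expr2 !derivM derivC => E'.
  rewrite polyC_natr; apply/eqP; rewrite -subr_eq0 -E'; apply/eqP; ring.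
have cop : coprimep Q (2%:P * P).
  rewrite mul_polyC coprimepZr ?pnatr_eq0 //.
  apply/Bezout_eq1_coprimepP; exists (- Delta lo hi * Q, P) => /=.
  by rewrite -E; ring.
have : Q %| 2%:P * P * P^`() by rewrite dE dvdp_mulr.
rewrite Gauss_dvdpr // => /dvdpP[W WE]; exists W.
have P0 : P != 0 by rewrite -size_poly_gt0 szP.
have P'0 : P^`() != 0.
  apply/eqP => /(congr1 (fun p : {poly R} => p`_n.-1)).
  have n0 : (0 < n)%N by apply: leq_trans degree_ge.
  rewrite coef0 coef_deriv prednK // => /eqP; rewrite mulrn_eq0 -leqn0 leqNgt n0 /=.
  by have := lead_coef_eq0 P; rewrite /lead_coef szP /= => ->; apply/negP.
have W0 : W != 0 by apply: contraNneq P'0 => W0; rewrite WE W0 mul0r.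
split => //; first by rewrite mulrC.
have := lt_size_deriv P0; rewrite szP WE size_mul // size_Q addnS /= ltnS.
by move: degree_ge; move: (size W) => k; lia.
Qed.

(** At the two ends of a gap [P] is 1 or -1.  It cannot change sign in the gap,
    where its square exceeds 1, so Rolle's theorem applies. *)
Let gap_root (i : 'I_M) :
  exists x, hi (lift ord0 i) < x < lo (widen_ord (leqnSn M) i) /\ P^`().[x] = 0.
Proof.
set i1 := lift ord0 i; set i0 := widen_ord _ i.
have lt01 : hi i1 < lo i0 by apply: lt_hl; rewrite /= /bump.
have [PE|PN] := eqVneq P.[hi i1] P.[lo i0].
  by have [x hx Px] := poly_rolle lt01 PE; exists x; move: hx; rewrite in_itv.
have : P.[hi i1] * P.[lo i0] < 0.
  have h1 := pell_horner (hi i1); have h0 := pell_horner (lo i0).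
  move: h1 h0; rewrite Delta_hi Delta_lo !mul0r !addr0 => /eqP h1 /eqP h0.
  move: h1 h0 PN; rewrite !sqrf_eq1 => /orP[]/eqP-> /orP[]/eqP->; rewrite ?eqxx // => _; lra.
move=> /(polyrcf.poly_ivtoo (ltW lt01))[x]; rewrite in_itv /= => /andP[x1 x0] /rootP Px.
have /pell_gt1 : outside lo hi x.
  apply: (@outside_beyond _ _ i1) => // k /=; rewrite /bump /= add1n ltnS leq_eqVlt.
  case/orP => [/eqP ki|ki]; first by have -> : k = i0 by apply: val_inj.
  have : hi i0 < lo k by apply: lt_hl.
  by have := lt_lh i0; lra.
by rewrite Px expr0n ltr10.
Qed.

(** If [P] took the same value at [x] and [y], Rolle's theorem would give
    [P^`()] a root between them.  With one root in each gap these would be too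
    many roots for the cofactor of [Q] in [P^`()]. *)
Lemma pell_alternates j x y : lo j <= x -> x < y -> y <= hi j ->
  P.[x] ^+ 2 = 1 -> P.[y] ^+ 2 = 1 -> (forall z, x < z < y -> Q.[z] != 0) ->
  exists z, x < z < y /\ P.[z] = 0.
Proof.
move=> jx xy yj Px Py Qxy.
have [PE|PN] := eqVneq P.[x] P.[y]; last first.
  have : P.[x] * P.[y] < 0.
    move: Px Py PN => /eqP + /eqP; rewrite !sqrf_eq1.
    by move=> /orP[]/eqP-> /orP[]/eqP->; rewrite ?eqxx // => _; lra.
  move=> /(polyrcf.poly_ivtoo (ltW xy))[z]; rewrite in_itv /= => zxy /rootP Pz.
  by exists z.
have [z + Pz] := poly_rolle xy PE; rewrite in_itv /= => zxy.
have [W [P'E W0 szW]] := deriv_pell.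
have Wroot u : P^`().[u] = 0 -> Q.[u] != 0 -> root W u.
  move=> + Qu; rewrite P'E hornerM => /eqP; rewrite mulf_eq0 (negPf Qu) /=.
  by move/eqP/rootP.
have [g gP] := choice gap_root.
have g_inj : injective g.
  move=> i k gE; apply/val_inj.
  have lt_g (u v : 'I_M) : (u < v)%N -> g v < g u.
    move=> uv; have [/andP[+ _] _] := gP u; have [/andP[_ +] _] := gP v.
    set v0 := widen_ord _ v; set u1 := lift (ord0 : 'I_M.+1) u.
    have : lo v0 <= hi u1; last by lra.
    have : (u1 <= v0)%N by rewrite /= /bump.
    rewrite leq_eqVlt => /orP[/eqP/val_inj->|h]; first exact: ltW.
    by have := lt_hl h; have := lt_lh v0; have := lt_lh u1; lra.
  by have [/lt_g|/lt_g|//] := ssrnat.ltngtP i k; rewrite gE ltxx.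
have g_out i k : ~ (lo k <= g i <= hi k).
  move=> /andP[h1 h2]; have [/andP[h3 h4] _] := gP i.
  have [ki|ki] := leqP k i.
    have : lo (widen_ord (leqnSn M) i) <= lo k; last by lra.
    move: ki; rewrite leq_eqVlt => /orP[/eqP ki|ki].
      by have -> : k = widen_ord (leqnSn M) i by apply: val_inj.
    have : hi (widen_ord (leqnSn M) i) < lo k by apply: lt_hl.
    by have := lt_lh (widen_ord (leqnSn M) i); lra.
  have : hi k <= hi (lift ord0 i); last by lra.
  have : (lift ord0 i <= k)%N by rewrite /= /bump.
  rewrite leq_eqVlt => /orP[/eqP/val_inj->//|h].
  by have := lt_hl h; have := lt_lh (lift ord0 i); lra.
exfalso; suff : (size (z :: [seq g i | i : 'I_M]) < size W)%N.
  by rewrite /= size_image card_ord ltnNge szW.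
apply: max_poly_roots => //=.
  rewrite Wroot ?Qxy //=; apply/allP => u /mapP[i _ ->].
  have [_ g0] := gP i; apply: Wroot => //; apply/eqP => /pell_root_inside[k hk].
  by apply: (g_out i k); rewrite !ltW //; case/andP: hk.
rewrite map_inj_uniq ?enum_uniq // andbT; apply/negP => /mapP[i _ zE].
by apply: (g_out i j); rewrite -zE; move: zxy => /andP[? ?]; apply/andP; split; lra.
Qed.
End OneSolution.
End Pell.

(** * Uniqueness of the dependent endpoints *)

Section Touching.
Variable R : realType.
Implicit Types (P : {poly R}) (xs : seq R).

(** The points at which a Chebyshev polynomial attains, in turn, the bounds 1
    and 0 of its square: its square minus another one bounded by 1 has
    alternating signs there. *)
Fixpoint touches P s xs : bool :=
  if xs is x :: xs' then (P.[x] ^+ 2 == (~~ s)%:R) && touches P (~~ s) xs'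
  else true.

Lemma touches_alternates P P' s xs : touches P s xs ->
  {in xs, forall x, P'.[x] ^+ 2 <= 1} -> alternates (P ^+ 2 - P' ^+ 2) s xs.
Proof.
elim: xs s => [//|x xs ih] s /= /andP[/eqP Px txs] le1.
rewrite ih // => [|y yxs]; last by apply: le1; rewrite inE yxs orbT.
rewrite andbT !hornerE Px; have := le1 x (mem_head _ _).
have := sqr_ge0 P'.[x].
by case: s {txs Px}; rewrite /= ?expr0 ?expr1 ?mulN1r ?mul1r; lra.
Qed.

Lemma interleave_zeros P w ws : path <%R w ws ->
  {in ws, forall x, P.[x] ^+ 2 = 1} ->
  (forall i, (i < size ws)%N -> exists z,
     nth 0 (w :: ws) i < z < nth 0 (w :: ws) i.+1 /\ P.[z] = 0) ->
  exists xs, [/\ size xs = (size ws).*2, path <%R w xs, touches P true xs &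
    {in xs, forall x, x <= last w ws}].
Proof.
elim: ws w => [|w1 ws ih] w /=; first by exists [::].
move=> /andP[ww1 pth] Pws zs.
have [z [/andP[wz zw1] Pz]] := zs 0%N isT; rewrite /= in wz zw1.
have [|i iws|xs [szxs pxs txs lexs]] := ih w1 pth.
- by move=> x xws; apply: Pws; rewrite inE xws orbT.
- exact: (zs i.+1).
have le1 : w1 <= last w1 ws.
  move: (mem_last w1 ws); rewrite inE => /orP[/eqP->//|h].
  by apply/ltW; move: h; apply/allP; apply: order_path_min pth; apply: lt_trans.
exists [:: z, w1 & xs]; split => /=.
- by rewrite szxs doubleS.
- by rewrite wz zw1 pxs.
- by rewrite Pz (Pws w1) ?mem_head // expr0n ?eqxx txs.
- move=> x; rewrite !inE => /or3P[/eqP->|/eqP->//|/lexs//].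
  by apply: le_trans le1; apply: ltW.
Qed.

End Touching.

Section Uniqueness.
Variables (R : realType) (M : nat).
Implicit Types (lo hi : 'I_M.+1 -> R) (tau : 'I_M.+1 -> nat) (P Q : {poly R}).

(** The points are the two endpoints, the roots of [Q], and a zero of [P]
    between any two neighbours among these. *)
Lemma pell_points lo hi n tau P Q j : pell_solution lo hi n tau P Q ->
  exists xs, [/\ size xs = (tau j).+1.*2, path <%R (lo j) xs,
    touches P false (lo j :: xs) &
    {in lo j :: xs, forall x, lo j <= x <= hi j}].
Proof.
move=> pell; have [[lt_lh lt_hl] [_ szQ] _ tauE _] := pell.
have Q0 : Q != 0 by rewrite -size_poly_gt0 szQ.
have P1 x : (Delta lo hi).[x] * Q.[x] ^+ 2 = 0 -> P.[x] ^+ 2 = 1.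
  by move=> h; rewrite (pell_horner pell) h addr0.
set rs := roots Q (lo j) (hi j).
have lt_rs x : x \in rs -> lo j < x < hi j by move/roots_in; rewrite in_itv.
have sorted_ws : path <%R (lo j) (rcons rs (hi j)).
  rewrite rcons_path path_roots /=.
  by have := mem_last (lo j) rs; rewrite inE => /orP[/eqP->//|/lt_rs/andP[]].
have P1ws : {in lo j :: rcons rs (hi j), forall x, P.[x] ^+ 2 = 1}.
  move=> x; rewrite inE mem_rcons inE => /or3P[/eqP->|/eqP->|/root_roots/rootP Qx].
  - by apply: P1; rewrite Delta_lo mul0r.
  - by apply: P1; rewrite Delta_hi mul0r.
  - by apply: P1; rewrite Qx expr0n mulr0.
have in_ws x : x \in lo j :: rcons rs (hi j) -> lo j <= x <= hi j.
  rewrite inE mem_rcons inE => /or3P[/eqP->|/eqP->|/lt_rs/andP[? ?]].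
  - by rewrite lexx ltW.
  - by rewrite lexx ltW.
  - by rewrite !ltW.
have [|i isz|xs [szxs pxs txs lexs]] := interleave_zeros (P := P) sorted_ws.
- by move=> x xin; apply: P1ws; rewrite inE xin orbT.
- set x := nth _ _ i; set y := nth _ _ i.+1.
  have xin : x \in lo j :: rcons rs (hi j) by apply: mem_nth; apply: ltnW.
  have yin : y \in lo j :: rcons rs (hi j) by apply: mem_nth.
  have mono := @lt_sorted_ltn_nth _ _ 0 (lo j :: rcons rs (hi j)) sorted_ws.
  have xy : x < y by rewrite mono // inE //; apply: ltnW.
  apply: (pell_alternates pell (j := j)) => //; try exact: P1ws.
  + by case/andP: (in_ws _ xin).
  + by case/andP: (in_ws _ yin).
  move=> z /andP[xz zy]; apply/eqP => Qz.
  have zin : z \in lo j :: rcons rs (hi j).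
    rewrite inE mem_rcons inE root_in_roots ?orbT //; last by apply/rootP.
    rewrite in_itv /=; case/andP: (in_ws _ xin) => ? ?; case/andP: (in_ws _ yin) => ? ?.
    by apply/andP; split; lra.
  move: xz zy; rewrite -(nth_index 0 zin) !mono ?inE ?index_mem //; last exact: ltnW.
  by rewrite ltnS => h1 h2; move: (leq_trans h1 h2); rewrite ltnn.
exists xs; split => //.
- by rewrite szxs size_rcons tauE.
- by rewrite /= txs (P1ws (lo j)) ?mem_head ?eqxx.
move=> x; rewrite inE => /orP[/eqP->|xxs]; first by rewrite lexx ltW.
rewrite (le_trans (lexs x xxs)) ?last_rcons // andbT ltW //.
by move: x xxs; apply/allP; apply: order_path_min pxs; apply: lt_trans.
Qed.

(** The smaller interval yields the alternation, since on it the squares of both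
    solutions are bounded by 1. *)
Lemma nested_changes lo hi lo' hi' n tau P Q P' Q' j :
  pell_solution lo hi n tau P Q -> pell_solution lo' hi' n tau P' Q' ->
  lo' j <= lo j -> hi j <= hi' j ->
  weak_changes (P ^+ 2 - P' ^+ 2) (tau j).+1.*2 (lo j) (hi j).
Proof.
move=> pell pell' lej hej.
have [xs [sz pth txs xin]] := pell_points j pell.
exists false, (lo j :: xs); split => //; first by rewrite /= sz.
apply: touches_alternates => // x /xin/andP[h1 h2].
by apply: (pell_le1 pell' (j := j)); apply/andP; split; lra.
Qed.

(** The common interval contributes one sign change more than the others, and
    this one decides the count.  It is gained by comparing the first zeros of
    [P] and [P'] after the left endpoint, where the difference vanishes.  If the
    two zeros differ, both can be used; if they coincide, the difference has a
    double root there, which is divided out. *)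
Lemma fixed_changes lo hi lo' hi' n tau P Q P' Q' j :
  pell_solution lo hi n tau P Q -> pell_solution lo' hi' n tau P' Q' ->
  lo' j = lo j -> hi' j = hi j ->
  weak_changes (P ^+ 2 - P' ^+ 2) (tau j).+1.*2.+1 (lo j) (hi j) \/
  exists z g, [/\ lo j < z <= hi j, P ^+ 2 - P' ^+ 2 = g * ('X - z%:P) ^+ 2 &
    weak_changes g (tau j).*2.+1 (lo j) (hi j)].
Proof.
move=> pell pell' loE hiE.
have [xs [sz pth txs xin]] := pell_points j pell.
have [xs' [sz' pth' txs' xin']] := pell_points j pell'.
rewrite loE hiE in pth' txs' xin'.
have alt : alternates (P ^+ 2 - P' ^+ 2) false (lo j :: xs).
  apply: touches_alternates => // x /xin/andP[h1 h2].
  by apply: (pell_le1 pell' (j := j)); apply/andP; split; lra.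
have alt' : alternates (P' ^+ 2 - P ^+ 2) false (lo j :: xs').
  by apply: touches_alternates => // x /xin' h; apply: (pell_le1 pell (j := j)).
rewrite -opprB alternates_opp in alt'.
case: xs sz pth txs xin alt => [//|z xs] sz pth txs xin alt.
case: xs' sz' pth' txs' xin' alt' => [//|z' xs'] sz' pth' txs' xin' alt'.
rewrite doubleS in sz sz'; move: sz sz' => [sz] [sz'].
have P2lo : P.[lo j] ^+ 2 = 1 by case/andP: txs => /eqP.
have P2lo' : P'.[lo j] ^+ 2 = 1 by case/andP: txs' => /eqP.
have f_lo : (P ^+ 2 - P' ^+ 2).[lo j] = 0 by rewrite !hornerE P2lo P2lo' subrr.
have [zz'|z'z|zz'] := ltgtP z z'.
- left; exists false, [:: lo j, z, z' & xs']; split => //=.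
  + by rewrite sz'.
  + by case/andP: pth => -> _; rewrite zz' /=; case/andP: pth'.
  + move=> x; rewrite inE => /orP[/eqP->|]; first by apply: xin; rewrite mem_head.
    rewrite inE => /orP[/eqP->|h]; first by apply: xin; rewrite inE mem_head orbT.
    by apply: xin'; rewrite inE h orbT.
  + move: alt alt' => /= /and3P[-> -> _] /and3P[_ + +] /=.
    by move=> -> ->.
- left; exists true, [:: lo j, z', z & xs]; split => //=.
  + by rewrite sz.
  + by case/andP: pth' => -> _; rewrite z'z /=; case/andP: pth.
  + move=> x; rewrite inE => /orP[/eqP->|]; first by apply: xin; rewrite mem_head.
    rewrite inE => /orP[/eqP->|h]; first by apply: xin'; rewrite inE mem_head orbT.
    by apply: xin; rewrite inE h orbT.
  + move: alt alt' => /= /and3P[_ + +] /and3P[-> -> _] /=.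
    by move=> -> ->.
right; rewrite -zz' in txs'; move: txs txs' => /and3P[_ Pz _] /and3P[_ P'z _].
have rootz p : p.[z] ^+ 2 == (~~ true)%:R :> R -> exists q, p = q * ('X - z%:P).
  by rewrite /= sqrf_eq0 => pz; apply/factor_theorem.
have [p pE] := rootz _ Pz; have [p' p'E] := rootz _ P'z.
have loz : lo j < z by case/andP: pth.
exists z, (p ^+ 2 - p' ^+ 2); split.
- by rewrite loz; have := xin z; rewrite !inE eqxx orbT => /(_ isT)/andP[].
- by rewrite pE p'E; ring.
exists true, (lo j :: xs); split.
- by rewrite /= sz.
- by move: pth => /=; case: (xs) => [//|x xs1] /= /and3P[_ h1 ->]; rewrite (lt_trans loz).
- move=> x; rewrite inE => /orP[/eqP->|h]; first by apply: xin; rewrite mem_head.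
  by apply: xin; rewrite !inE h !orbT.
have fE : P ^+ 2 - P' ^+ 2 = (p ^+ 2 - p' ^+ 2) * ('X - z%:P) ^+ 2.
  by rewrite pE p'E; ring.
have g_lo : (p ^+ 2 - p' ^+ 2).[lo j] = 0.
  move: f_lo; rewrite fE hornerM => /eqP; rewrite mulf_eq0 => /orP[/eqP//|].
  by rewrite horner_exp hornerXsubC sqrf_eq0 subr_eq0 lt_eqF.
rewrite /= g_lo mulr0 lexx /=; move: alt => /and3P[_ _ alt].
rewrite -(@alternates_mulr _ _ (('X - z%:P) ^+ 2)) -?fE // => x xxs.
rewrite horner_exp hornerXsubC exprn_even_gt0 //= subr_eq0 gt_eqF //.
move: pth => /= /andP[_]; move/(order_path_min lt_trans)/allP; exact.
Qed.

(** In each pair one of the two intervals contains the other.  The smaller one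
    carries [2 (tau j + 1)] sign changes of the difference of squares, whose sum
    is [2 n]; the common interval provides one more, which exceeds the degree. *)
Lemma pell_sqr_unique lo hi lo' hi' n tau P Q P' Q' :
  pell_solution lo hi n tau P Q -> pell_solution lo' hi' n tau P' Q' ->
  lo' ord_max = lo ord_max -> hi' ord_max = hi ord_max ->
  (forall j, lo' j = lo j \/ hi' j = hi j) ->
  P ^+ 2 = P' ^+ 2.
Proof.
move=> pell pell' loE hiE shared.
have [[lt_lh lt_hl] [szP _] _ _ sum_tau] := pell.
have [[lt_lh' lt_hl'] [szP' _] _ _ _] := pell'.
pose f := P ^+ 2 - P' ^+ 2.
pose A j := Num.max (lo j) (lo' j); pose B j := Num.min (hi j) (hi' j).
have moving j : weak_changes f (tau j).+1.*2 (A j) (B j).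
  have nested : lo' j <= lo j -> hi j <= hi' j ->
      weak_changes f (tau j).+1.*2 (A j) (B j).
    move=> h1 h2; rewrite /A /B (max_idPl h1) (min_idPl h2).
    exact: nested_changes pell pell' h1 h2.
  have nested' : lo j <= lo' j -> hi' j <= hi j ->
      weak_changes f (tau j).+1.*2 (A j) (B j).
    move=> h1 h2; rewrite /A /B (max_idPr h1) (min_idPr h2).
    by apply: weak_changes_opp; rewrite opprB; apply: nested_changes pell' pell h1 h2.
  case: (shared j) => h.
    have [?|?] := leP (hi j) (hi' j); first by apply: nested; rewrite ?h.
    by apply: nested'; [rewrite h|apply: ltW].
  have [?|?] := leP (lo' j) (lo j); first by apply: nested; rewrite ?h.
  by apply: nested'; [apply: ltW|rewrite h].
have lt_BA (i j : 'I_M.+1) : (i < j)%N -> B j < A i.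
  move=> ij; apply: le_lt_trans (_ : hi j < _); first by rewrite ge_min lexx.
  by rewrite lt_max lt_hl.
have sum_k (k : 'I_M.+1 -> nat) e : (forall j, j != ord_max -> k j = (tau j).+1.*2) ->
    (e + (tau ord_max).+1.*2 = (k ord_max).+1)%N -> (\sum_j k j + 1 = e + n.*2)%N.
  move=> kE kmax; rewrite -sum_tau -muln2 big_distrl /=.
  rewrite (bigD1 ord_max) // [in RHS](bigD1 ord_max) //= (eq_bigr _ kE).
  under eq_bigr do rewrite -muln2.
  by move: kmax; rewrite -muln2; set S := (\sum_(_ | _) _)%N; move: S (k _) (tau _) => S u v; lia.
have concat g (k : 'I_M.+1 -> nat) :
    (forall j, weak_changes g (k j) (A j) (B j)) ->
    weak_changes g (\sum_j k j) (A ord_max) (B ord0).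
  move=> wk; have := @weak_changes_sum _ g (A \o inord) (B \o inord) (k \o inord) M.
  rewrite /= (_ : inord M = ord_max); last by apply: val_inj; rewrite /= inordK.
  rewrite (_ : inord 0 = ord0); last by apply: val_inj; rewrite /= inordK.
  under eq_bigr do rewrite inord_val.
  by apply => [j _|i j ij jM] //; apply: lt_BA; rewrite !inordK // ltnS (leq_trans (ltnW ij)).
have size_f : (size f <= n.*2.+1)%N.
  have sz2 (p : {poly R}) : size p = n.+1 -> (size (p ^+ 2) <= n.*2.+1)%N.
    by move=> sz; apply: leq_trans (size_exp_leq _ _) _; rewrite sz /= -muln2 mulnC.
  apply: leq_trans (size_polyD _ _) _; rewrite geq_max size_polyN.
  by rewrite !sz2.
suff f0 : f = 0 by apply/eqP; rewrite -subr_eq0 -/f f0.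
have Amax : A ord_max = lo ord_max by rewrite /A loE maxxx.
have Bmax : B ord_max = hi ord_max by rewrite /B hiE minxx.
have [wk|[z [g [/andP[loz zhi] fE wk]]]] := fixed_changes pell pell' loE hiE.
  pose k j := if j == ord_max then (tau j).+1.*2.+1 else (tau j).+1.*2.
  apply: (weak_changes_eq0 (k := \sum_j k j) (a := A ord_max) (b := B ord0)).
    apply: concat => j; rewrite /k; case: eqP => [->|_]; last exact: moving.
    by rewrite Amax Bmax.
  have := @sum_k k 2 _ _; rewrite addn1 => h; apply: leq_trans size_f _.
  by rewrite -ltnS h // /k ?eqxx // => j /negPf->.
rewrite -/f in fE.
pose k j := if j == ord_max then (tau j).*2.+1 else (tau j).+1.*2.
suff g0 : g = 0 by rewrite fE g0 mul0r.
apply: (weak_changes_eq0 (k := \sum_j k j) (a := A ord_max) (b := B ord0)).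
  apply: concat => j; rewrite /k; case: eqP => [->|/eqP jmax].
    by rewrite Amax Bmax.
  apply: (@weak_changes_mulr _ _ (('X - z%:P) ^+ 2)); last by rewrite -fE; apply: moving.
  move=> x /andP[Ax _]; rewrite horner_exp hornerXsubC exprn_even_gt0 //= subr_eq0 gt_eqF //.
  apply: lt_le_trans Ax; rewrite /A lt_max; apply/orP; left.
  apply: le_lt_trans zhi _; apply: lt_hl.
  by rewrite ltn_neqAle -ltnS ltn_ord andbT.
have [->|g0] := eqVneq g 0; first by rewrite size_poly0.
have := @sum_k k 0 _ _; rewrite addn1 => h.
rewrite -ltnS h // /k ?eqxx //; last by move=> j /negPf->.
move: size_f; rewrite fE size_Mmonic ?monic_exp ?monicXsubC //.
by rewrite size_exp_XsubC addn3 /= => h'; rewrite -ltnS.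
Qed.

(** A point shortly after [hi j] lies outside all the first intervals, so the
    square exceeds 1 there; if [hi' j] were greater than [hi j], the point could
    be taken inside a second interval, where the square is at most 1. *)
Lemma hi_le_of_sqr lo hi lo' hi' n tau P Q P' Q' j :
  pell_solution lo hi n tau P Q -> pell_solution lo' hi' n tau P' Q' ->
  P ^+ 2 = P' ^+ 2 -> lo' j <= hi j -> hi' j <= hi j.
Proof.
move=> pell pell' sqrE lo'hi; have [[lt_lh lt_hl] _ _ _ _] := pell.
rewrite leNgt; apply/negP => lt_hi.
pose e := \big[Num.min/hi' j]_(k : 'I_M.+1 | (k < j)%N) lo k.
have hi_e : hi j < e by apply: lt_bigmin => // k; apply: lt_hl.
have e_hi : e <= hi' j by apply: bigmin_le_id.
have out : outside lo hi ((hi j + e) / 2).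
  apply: (outside_beyond (i := j)) => [|k kj|]; [by case: pell| |by clearbody e; lra].
  have : e <= lo k by apply: bigmin_le_cond.
  by move: hi_e; clearbody e; lra.
clearbody e; have := pell_gt1 pell out; have := @pell_le1 _ _ _ _ _ _ _ _ pell' j ((hi j + e) / 2).
have := congr1 (horner^~ ((hi j + e) / 2)) sqrE; rewrite /= !horner_exp => ->.
by move=> h1; apply/negP; rewrite -leNgt; apply: h1; apply/andP; split; lra.
Qed.

Lemma lo_ge_of_sqr lo hi lo' hi' n tau P Q P' Q' j :
  pell_solution lo hi n tau P Q -> pell_solution lo' hi' n tau P' Q' ->
  P ^+ 2 = P' ^+ 2 -> lo j <= hi' j -> lo j <= lo' j.
Proof.
move=> pell pell' sqrE lo'hi; have [[lt_lh lt_hl] _ _ _ _] := pell.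
rewrite leNgt; apply/negP => lt_lo.
pose e := \big[Num.max/lo' j]_(k : 'I_M.+1 | (j < k)%N) hi k.
have e_lo : e < lo j by apply: bigmax_lt => // k; apply: lt_hl.
have lo_e : lo' j <= e by apply: bigmax_ge_id.
have out : outside lo hi ((lo j + e) / 2).
  apply: (outside_before (i := j)) => [|k kj|]; [by case: pell| |by clearbody e; lra].
  have : hi k <= e by apply: le_bigmax_cond.
  by move: e_lo; clearbody e; lra.
clearbody e; have := pell_gt1 pell out; have := @pell_le1 _ _ _ _ _ _ _ _ pell' j ((lo j + e) / 2).
have := congr1 (horner^~ ((lo j + e) / 2)) sqrE; rewrite /= !horner_exp => ->.
by move=> h1; apply/negP; rewrite -leNgt; apply: h1; apply/andP; split; lra.
Qed.

Theorem pell_endpoints_unique lo hi lo' hi' n tau P Q P' Q' :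
  pell_solution lo hi n tau P Q -> pell_solution lo' hi' n tau P' Q' ->
  lo' ord_max = lo ord_max -> hi' ord_max = hi ord_max ->
  (forall j, lo' j = lo j \/ hi' j = hi j) ->
  forall j, lo' j = lo j /\ hi' j = hi j.
Proof.
move=> pell pell' loE hiE shared j.
have sqrE := pell_sqr_unique pell pell' loE hiE shared.
have [[lt_lh _] _ _ _ _] := pell; have [[lt_lh' _] _ _ _ _] := pell'.
have hj := lt_lh j; have hj' := lt_lh' j.
have le_hi := hi_le_of_sqr pell pell' sqrE; have le_hi' := hi_le_of_sqr pell' pell (esym sqrE).
have ge_lo := lo_ge_of_sqr pell pell' sqrE; have ge_lo' := lo_ge_of_sqr pell' pell (esym sqrE).
case: (shared j) => h; split => //; apply: le_anti; apply/andP; split.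
- by apply: le_hi; rewrite h ltW.
- by apply: le_hi'; rewrite -h ltW.
- by apply: ge_lo'; rewrite -h ltW.
- by apply: ge_lo; rewrite h ltW.
Qed.

End Uniqueness.

(** * Motions of a loaded string and their zeros *)

Section String.
Variable A : pzRingType.
Implicit Types (t k : nat -> A) (u : A * A).

(** A state consists of the position [y] and the slope [v] of a loaded string:
    [t n] is the length of its [n]-th straight piece and [k n] the strength of
    the bead at the end of the previous one. *)
Fixpoint string t k u n : A * A :=
  if n is n'.+1 then
    let v := string t k u n' in
    let y := v.1 + t n' * v.2 in (y, v.2 - k n'.+1 * y)
  else u.

End String.

Section Crossings.
Variable R : realFieldType.
Implicit Types (x y : R) (f g : nat -> R).

(** A zero of the straight piece from [x] to [y].  A zero at the end counts and
    a zero at the beginning does not, so that [crossings] counts each once. *)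
Definition crossing x y : bool := (y == 0) || (x * y < 0).

Definition crossings f n : nat := (\sum_(k < n) crossing (f k) (f k.+1))%N.

(** When the vector [(x, y)] turns counterclockwise, its components vanish in
    turn; here the second one is next. *)
Definition turned x y : bool := ((x <= 0) && (0 < y)) || ((0 <= x) && (y < 0)).

Lemma crossingsS f n :
  crossings f n.+1 = (crossings f n + crossing (f n) (f n.+1))%N.
Proof. by rewrite /crossings big_ord_recr. Qed.

Lemma crossingE x y :
  crossing x y = [|| y == 0, (0 < x) && (y < 0) | (x < 0) && (0 < y)].
Proof.
rewrite /crossing; congr (_ || _).
case: (ltgtP x 0) => [hx|hx|->] /=; last by rewrite mul0r ltxx.
  by rewrite nmulr_rlt0.
by rewrite pmulr_rlt0 // orbF.
Qed.

Lemma turned_step x y x' y' : 0 < x * y' - x' * y ->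
  (crossing x x' + turned x y = crossing y y' + turned x' y')%N.
Proof.
move=> w; rewrite !crossingE /turned.
case: (ltgtP x 0) => hx; case: (ltgtP x' 0) => hx';
case: (ltgtP y 0) => hy; case: (ltgtP y' 0) => hy' //=; exfalso; nra.
Qed.

Lemma crossings_turned f g n :
  (forall k, 0 < f k * g k.+1 - f k.+1 * g k) ->
  (crossings f n + turned (f 0%N) (g 0%N) = crossings g n + turned (f n) (g n))%N.
Proof.
move=> w; elim: n => [|n ih]; first by rewrite /crossings !big_ord0.
by rewrite !crossingsS; have := turned_step (w n); lia.
Qed.

Lemma crossingsN f n : crossings (fun k => - f k) n = crossings f n.
Proof.
by apply: eq_bigr => k _; rewrite /crossing mulrNN oppr_eq0.
Qed.

Lemma crossings_scale c f n : c != 0 ->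
  crossings (fun k => c * f k) n = crossings f n.
Proof.
move=> c0; apply: eq_bigr => k _; rewrite /crossing mulf_eq0 (negPf c0) /=.
by rewrite mulrACA pmulr_rlt0 // -expr2 exprn_even_gt0.
Qed.

(** For [g] the values of a solution at a parameter close to that of [f].  An
    inner zero of [f] lies between values of opposite signs, so [g] changes sign
    once there whatever its sign at that place; only a zero at the end may be
    lost. *)
Lemma crossings_perturb f g n :
  f 0%N = 0 -> g 0%N = 0 -> 0 < f 1%N ->
  (forall k, (0 < k)%N -> f k = 0 -> f k.-1 * f k.+1 < 0) ->
  (forall k, (0 < k <= n)%N -> f k != 0 -> 0 < f k * g k) ->
  (forall k, (0 < k <= n)%N -> g k != 0) ->
  if (f n == 0) && (0 < n)%N
  then is_true (crossings g n <= crossings f n <= (crossings g n).+1)%N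
  else crossings g n = crossings f n.
Proof.
move=> f0 g0 f1 fz fg gn.
suff H k : (k <= n)%N -> if (f k == 0) && (0 < k)%N
    then is_true (crossings g k <= crossings f k <= (crossings g k).+1)%N
    else crossings g k = crossings f k by exact: H.
have [m] := ubnP k; elim: m k => [//|m ih] [|k] km kn.
  by rewrite /crossings !big_ord0 andbF.
have := ih k km (ltnW kn).
rewrite andbT !crossingsS; case: k km kn => [|k] km kn.
  move=> _; rewrite /crossings !big_ord0 !crossingE f0 g0 ltxx /=.
  by rewrite (gt_eqF f1) (negPf (gn _ _)).
rewrite andbT; case: (eqVneq (f k.+1) 0) => [fk1|fk1 E]; last first.
  have := fg k.+1 _ fk1; rewrite /= (ltnW kn) => /(_ isT) s1.
  rewrite E; case: (eqVneq (f k.+2) 0) => [fk2|fk2].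
    by rewrite {2}/crossing fk2 eqxx /=; case: crossing; lia.
  have := fg k.+2 _ fk2; rewrite /= kn => /(_ isT) s2.
  have g2 := gn k.+2; congr (_ + nat_of_bool _)%N.
  rewrite /crossing (negPf fk2) (negPf (g2 _)) //=.
  by apply/idP/idP => ?; rewrite ltNge; apply/negP => ?; nra.
move=> _; have hz := fz k.+1 isT fk1; rewrite /= in hz.
have fk0 : f k != 0 by apply: contraTneq hz => ->; rewrite mul0r ltxx.
have fk2 : f k.+2 != 0 by apply: contraTneq hz => ->; rewrite mulr0 ltxx.
have k0 : (0 < k)%N by case: (k) fk0 => //; rewrite f0 eqxx.
have := ih k (ltnW km) (ltnW (ltnW kn)); rewrite (negPf fk0) /= => E.
rewrite !crossingsS (negPf fk2) E -!addnA; congr (_ + _)%N.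
have := fg k _ fk0; rewrite k0 (ltnW (ltnW kn)) => /(_ isT) s0.
have := fg k.+2 _ fk2; rewrite /= kn => /(_ isT) s2.
have gk1 := gn k.+1; rewrite /= (ltnW kn) in gk1; have {}gk1 := gk1 isT.
have gk2 := gn k.+2; rewrite /= kn in gk2; have {}gk2 := gk2 isT.
rewrite !crossingE fk1 eqxx ltxx (negPf gk1) (negPf gk2) (negPf fk2) /=.
have g02 : g k * g k.+2 < 0 by nra.
case: (ltgtP (g k) 0) => h0; case: (ltgtP (g k.+1) 0) => h1;
case: (ltgtP (g k.+2) 0) => h2 //=; exfalso; nra.
Qed.

End Crossings.

(** * Sturm oscillation for the string *)

Section Cindex.
Variable R : rcfType.
Implicit Types (p q r : {poly R}) (a b : R).

Lemma cindex_modp a b p q : cindex a b p q = cindex a b (p %% q) q.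
Proof.
rewrite cindex_mod modpE cindex_mulCp; congr (_ * _).
by rewrite -sgzX; case: (sgzP (_ ^+ _)) => h; rewrite ?h ?invr0 ?sgz0 //;
  [apply/esym/gtr0_sgz; rewrite invr_gt0 | apply/esym/ltr0_sgz; rewrite invr_lt0].
Qed.

Lemma cindex_eqmod a b p r q : q %| p - r -> cindex a b p q = cindex a b r q.
Proof.
move=> /modp_eq0P h; rewrite cindex_modp [RHS]cindex_modp.
by rewrite -[p](subrK r) modpD h add0r.
Qed.

Lemma abs_cindex_le a b p q : `|cindex a b p q| <= (size (roots q a b))%:Z.
Proof.
rewrite /cindex; elim: (roots q a b) => [|x s ih]; first by rewrite big_nil.
rewrite big_cons /= -add1n PoszD; apply: le_trans (ler_normD _ _) _.
apply: lerD ih; rewrite /jump normrMn normrX normrN1 expr1n.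
by case: (_ && _).
Qed.

Lemma cross_negatives p a b : p.[a] != 0 -> p.[b] != 0 ->
  cross p a b = (p.[a] < 0)%R%:Z - (p.[b] < 0)%R%:Z.
Proof.
move=> pa pb; rewrite /cross /qe_rcf_th.variation.
case: (ltgtP p.[a] 0) pa => [ha|ha|//] _; case: (ltgtP p.[b] 0) pb => [hb|hb|//] _.
- by rewrite nmulr_rlt0 // ltNge (ltW hb) mulr0.
- by rewrite nmulr_rlt0 // hb gtr0_sgz.
- by rewrite pmulr_rlt0 // hb ltr0_sgz.
- by rewrite pmulr_rlt0 // ltNge (ltW hb) mulr0.
Qed.

(** Sturm's theorem needs points at which no polynomial of the sequence
    vanishes; moving slightly away from [x] provides one without changing the
    signs at [x]. *)
Lemma nearby_right (ps : seq {poly R}) x c : x < c -> {in ps, forall p, p != 0} ->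
  exists y, x < y < c /\ {in ps, forall p, p.[y] != 0 /\ (p.[x] != 0 -> 0 < p.[x] * p.[y])}.
Proof.
move=> xc ps0; have P0 : \prod_(p <- ps) p != 0.
  by rewrite prodf_seq_neq0; apply/allP => p /ps0.
have [y yP] := neighpr_wit xc P0; exists y; split.
  have := next_root_in (\prod_(p <- ps) p) x c.
  move: yP; rewrite /neighpr !in_itv /= => /andP[-> h1] /andP[_].
  by rewrite (max_idPl (ltW xc)); apply: lt_le_trans.
move=> p pin; have : y \in neighpr p x c.
  by move: yP; rewrite (big_rem p pin) /= neighpr_mul inE => /andP[].
move=> yp; split; first exact: neighpr_root yp.
move=> px; rewrite -sgr_gt0 sgrM (sgr_neighprN _ yp) //.
by rewrite -sgrM sgr_gt0 -expr2 exprn_even_gt0.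
Qed.

Lemma nearby_left (ps : seq {poly R}) x c : c < x -> {in ps, forall p, p != 0} ->
  exists y, c < y < x /\ {in ps, forall p, p.[y] != 0 /\ (p.[x] != 0 -> 0 < p.[x] * p.[y])}.
Proof.
move=> xc ps0; have P0 : \prod_(p <- ps) p != 0.
  by rewrite prodf_seq_neq0; apply/allP => p /ps0.
have [y yP] := neighpl_wit xc P0; exists y; split.
  have := prev_root_in (\prod_(p <- ps) p) c x.
  move: yP; rewrite /neighpl !in_itv /= => /andP[h1 ->] /andP[+ _].
  by rewrite (min_idPl (ltW xc)) andbT => h2; apply: le_lt_trans h1.
move=> p pin; have : y \in neighpl p c x.
  by move: yP; rewrite (big_rem p pin) /= neighpl_mul inE => /andP[].
move=> yp; split; first exact: neighpl_root yp.
move=> px; rewrite -sgr_gt0 sgrM (sgr_neighplN _ yp) //.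
by rewrite -sgrM sgr_gt0 -expr2 exprn_even_gt0.
Qed.

End Cindex.

Section Sturm.
Variables (R : rcfType) (tau kappa : nat -> R).
Hypothesis tau_gt0 : forall k, 0 < tau k.
Implicit Types (s : R) (u v : R * R).

Definition motion s u n : R * R := string tau (fun k => kappa k * s) u n.

Definition motion_poly u n : {poly R} * {poly R} :=
  string (fun k => (tau k)%:P) (fun k => kappa k *: 'X) (u.1%:P, u.2%:P) n.

Lemma motionS s u n : motion s u n.+1
  = ((motion s u n).1 + tau n * (motion s u n).2,
     (motion s u n).2 - kappa n.+1 * s
        * ((motion s u n).1 + tau n * (motion s u n).2)).
Proof. by []. Qed.

Lemma motion_polyE s u n :
  motion s u n = ((motion_poly u n).1.[s], (motion_poly u n).2.[s]).
Proof.
elim: n => [|n]; first by rewrite /motion /motion_poly /= !hornerC; case: u.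
by rewrite /motion /motion_poly /= => ->; rewrite /= !hornerE.
Qed.

Lemma motion_wronskian s u v n :
  (motion s u n).1 * (motion s v n).2 - (motion s u n).2 * (motion s v n).1
  = u.1 * v.2 - u.2 * v.1.
Proof.
elim: n => [//|n <-]; rewrite /motion /=.
by case: (string _ _ u n) => a b; case: (string _ _ v n) => c d /=; ring.
Qed.

Lemma motion_scale s c u n :
  motion s (c * u.1, c * u.2) n = (c * (motion s u n).1, c * (motion s u n).2).
Proof.
elim: n => [//|n]; rewrite /motion /= => -> /=.
by congr (_, _); ring.
Qed.

Lemma motion_neq0 s u n : u != (0, 0) -> motion s u n != (0, 0).
Proof.
apply: contra => /eqP h.
have h1 := motion_wronskian s u (0, 1) n; have h2 := motion_wronskian s u (1, 0) n.
move: h1 h2; rewrite h /= !mul0r mulr1 !mulr0 !subr0 sub0r mulr1 => /esym h1 /esym /eqP.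
by rewrite oppr_eq0 => /eqP h2; case: (u) h1 h2 => a b /= -> ->.
Qed.

(** The position polynomials of the Dirichlet solution, which starts at 0. *)
Let y k := (motion_poly (0, 1) k).1.

Lemma motion_fst_neq0 n : (0 < n)%N -> (motion_poly (0, 1) n).1 != 0.
Proof.
move=> n0; suff : 0 < (motion 0 (0, 1) n).1.
  by rewrite motion_polyE /= => h; apply: contraTneq h => ->; rewrite horner0 ltxx.
have h k : (motion 0 (0, 1) k).2 = 1.
  by elim: k => [//|k ih]; rewrite motionS /= ih mulr0 mul0r subr0.
elim: n n0 => [//|[|n] ih] _.
  by rewrite /motion /= add0r mulr1.
by rewrite motionS h mulr1 /= addr_gt0 // ih.
Qed.

(** At a zero the bead has no effect, so the string passes straight through. *)
Lemma motion_flip s u k : u != (0, 0) -> (motion s u k.+1).1 = 0 ->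
  (motion s u k).1 * (motion s u k.+2).1 < 0.
Proof.
move=> /(motion_neq0 s k); rewrite /motion /=; case: (string _ _ u k) => a b /= ab h.
rewrite h mulr0 subr0 add0r.
have a0 : a != 0.
  apply: contraNneq ab => a0; move: h; rewrite a0 add0r => /eqP.
  by rewrite mulf_eq0 (gt_eqF (tau_gt0 k)) /= => /eqP->.
have -> : a = - (tau k * b) by move/eqP: h; rewrite addr_eq0 => /eqP.
have b0 : b != 0 by apply: contraNneq a0 => b0; move: h; rewrite b0 mulr0 addr0 => ->.
rewrite mulNr oppr_lt0 mulrACA -expr2 pmulr_rgt0 ?exprn_even_gt0 //.
exact: mulr_gt0.
Qed.

(** The positions satisfy a three-term recurrence and so form a Sturm sequence:
    the Cauchy index of two consecutive ones is the difference of the numbers of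
    sign changes at [a] and [b], and it is bounded by the number of roots. *)
Lemma roots_ge_crossings a b n : a < b ->
  (forall k, (0 < k <= n.+1)%N -> (y k).[a] != 0) ->
  (forall k, (0 < k <= n.+1)%N -> (y k).[b] != 0) ->
  (crossings (fun k => (motion b (0%R, 1%R) k).1) n.+1
   <= crossings (fun k => (motion a (0%R, 1%R) k).1) n.+1 + size (roots (y n.+1) a b))%N.
Proof.
move=> ab ya yb.
have E k : (k <= n)%N -> cindex a b (y k) (y k.+1)
    = (crossings (fun k => (motion a (0, 1) k).1)%R k.+1)%:Z
      - (crossings (fun k => (motion b (0, 1) k).1)%R k.+1)%:Z.
  elim: k => [|k ih] kn.
    rewrite /y /= cindex0p /crossings !big_ord1 /crossing /motion /=.
    by rewrite !add0r !mul0r !mulr1 ltxx (gt_eqF (tau_gt0 0)).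
  rewrite !(crossingsS _ k.+1) !PoszD.
  have := cindex_inv ab (p := y k.+2) (q := y k.+1).
  have nz x : (forall k, (0 < k <= n.+1)%N -> (y k).[x] != 0) ->
      ~~ root (y k.+2 * y k.+1) x.
    move=> h; rewrite /root hornerM mulf_neq0 //.
      by rewrite h.
    by rewrite h //= ltnS; apply: ltnW.
  move=> /(_ (nz _ ya) (nz _ yb)).
  have -> : cindex a b (y k.+2) (y k.+1) = - cindex a b (y k) (y k.+1).
    rewrite (@cindex_eqmod _ _ _ _ (- (tau k.+1 / tau k) *: y k)).
      by rewrite cindex_mulCp sgzN gtr0_sgz ?divr_gt0 // mulN1r.
    apply/dvdpP; exists (1 + (tau k.+1 / tau k)%:P - (tau k.+1)%:P * (kappa k.+1 *: 'X)).
    rewrite /y /motion_poly /=; set st := string _ _ _ k.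
    rewrite scaleNr opprK -!mul_polyC.
    have -> : (tau k.+1 / tau k)%:P = (tau k.+1)%:P * (tau k)^-1%:P :> {poly R}.
      by rewrite -polyCM.
    have tV : (tau k)%:P * (tau k)^-1%:P = 1 :> {poly R}.
      by rewrite -polyCM divff ?gt_eqF.
    by ring: tV.
  rewrite ih; last exact: ltnW.
  rewrite cross_negatives.
  - have crossN x : (forall k, (0 < k <= n.+1)%N -> (y k).[x] != 0) ->
      crossing (motion x (0, 1) k.+1).1 (motion x (0, 1) k.+2).1
      = ((y k.+2 * y k.+1).[x] < 0).
      move=> h; rewrite /crossing !motion_polyE /= -/(y k.+1) -/(y k.+2).
      by rewrite (negPf (h k.+2 _)) //= hornerM mulrC.
    by rewrite !crossN //; lia.
  - by have := nz _ ya.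
  - by have := nz _ yb.
have := abs_cindex_le a b (y n) (y n.+1); rewrite E //.
by move: (crossings _ _) (crossings _ _) (size _) => A B C; lia.
Qed.

(** Solutions at the same [s] turn in the same direction around the origin,
    so their zeros separate each other. *)
Lemma crossings_dirichlet s v n : v != (0, 0) ->
  let f k := (motion s (0, 1) k).1 in
  let g k := (motion s v k).1 in
  (crossings f n <= crossings g n)%N /\
  (crossings g n <= crossings f n + (f n != 0%R))%N.
Proof.
move=> v0 f g.
wlog: v v0 @g / v.1 <= 0 => [wl|v1].
  have [|h] := leP v.1 0; first exact: wl.
  have <- : crossings (fun k => (motion s (-1 * v.1, -1 * v.2) k).1) n = crossings g n.
    rewrite -(crossingsN g); apply: eq_bigr => k _.
    by rewrite !motion_scale /= !mulN1r.
  apply: wl; last by rewrite mulN1r oppr_le0 ltW.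
  by apply: contraNneq v0 => -[]; rewrite !mulN1r => /eqP; rewrite oppr_eq0 gt_eqF.
move: v1; rewrite le_eqVlt => /orP[/eqP v1|v1].
  have -> : crossings g n = crossings f n.
    have v2 : v.2 != 0 by apply: contraNneq v0 => v2; apply/eqP; case: (v) v1 v2 => a b /= -> ->.
    rewrite -(crossings_scale f n v2); apply: eq_bigr => k _.
    have gE j : g j = v.2 * f j.
      have := motion_scale s v.2 (0, 1) j; rewrite /= mulr0 mulr1 => h.
      by rewrite /g /f; case: (v) v1 h => a b /= -> ->.
    by rewrite !gE.
  by split => //; rewrite leq_addr.
have w k : 0 < f k * g k.+1 - f k.+1 * g k.
  have := motion_wronskian s (0, 1) v k; rewrite /= mul0r mul1r sub0r.
  rewrite /f /g !motionS; case: (motion s (0, 1) k) => a b.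
  case: (motion s v k) => c d /= h.
  have -> : a * (c + tau k * d) - (a + tau k * b) * c = tau k * (a * d - b * c) by ring.
  by rewrite h mulr_gt0 // oppr_gt0.
have := crossings_turned n w.
have -> : turned (f 0%N) (g 0%N) = true by rewrite /turned /f /g /= lexx v1 orbT.
rewrite addn1 => E; split; first by move: E; case: turned; lia.
move: E; case: eqP => fn /=; last by case: turned; lia.
have -> : turned (f n) (g n) = true.
  have : g n != 0 by apply: contraTneq (w n) => ->; rewrite fn mul0r mulr0 subr0 ltxx.
  by rewrite /turned fn lexx /= orbC -neq_lt.
lia.
Qed.

(** The Dirichlet solution has no more zeros than another one at [s1], and at
    most one less at [s2].  Sturm's theorem applies to the Dirichlet solution
    after moving [s1] and [s2] slightly inwards, which cannot increase the
    number of zeros at the former and loses at most one at the latter; this one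
    is a zero at the end, where the two solutions at [s2] agree in number. *)
Theorem dirichlet_roots_ge s1 s2 v1 v2 n : s1 < s2 ->
  v1 != (0, 0) -> v2 != (0, 0) ->
  (crossings (fun k => (motion s2 v2 k).1) n.+1
   <= crossings (fun k => (motion s1 v1 k).1) n.+1
      + (size (roots (motion_poly (0%R, 1%R) n.+1).1 s1 s2)).+1)%N.
Proof.
move=> s12 hv1 hv2.
pose ps := [seq y k.+1 | k <- iota 0 n.+1].
have ps0 : {in ps, forall p, p != 0}.
  by move=> p /mapP[k _ ->]; apply: motion_fst_neq0.
have in_ps k : (0 < k <= n.+1)%N -> y k \in ps.
  case: k => [//|k] /= kn; apply/mapP; exists k => //.
  by rewrite mem_iota add0n.
pose mid := (s1 + s2) / 2.
have s1mid : s1 < mid by rewrite /mid; lra.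
have mids2 : mid < s2 by rewrite /mid; lra.
have [a [/andP[s1a am] aP]] := nearby_right s1mid ps0.
have [b [/andP[mb bs2] bP]] := nearby_left mids2 ps0.
have ab : a < b by apply: lt_trans mb.
pose F s k := (motion s (0, 1) k).1.
have FE s k : F s k = (y k).[s] by rewrite /F motion_polyE.
have perturb s x : {in ps, forall p, p.[x] != 0 /\ (p.[s] != 0 -> 0 < p.[s] * p.[x])} ->
    if (F s n.+1 == 0) && (0 < n.+1)%N
    then is_true (crossings (F x) n.+1 <= crossings (F s) n.+1 <= (crossings (F x) n.+1).+1)%N
    else crossings (F x) n.+1 = crossings (F s) n.+1.
  move=> xP; apply: crossings_perturb => //.
  - by rewrite /F /motion /= add0r mulr1.
  - case=> [//|k] _; apply: motion_flip.
    by rewrite xpair_eqE eqxx oner_eq0.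
  - by move=> k /in_ps/xP[_]; rewrite !FE.
  - by move=> k /in_ps/xP[+ _]; rewrite FE.
have := perturb _ _ aP; have := perturb _ _ bP; rewrite !andbT => pb pa.
have [d1 _] := crossings_dirichlet s1 n.+1 hv1.
have [_ d2] := crossings_dirichlet s2 n.+1 hv2.
rewrite -/(F s1) in d1; rewrite -/(F s2) -/(F s2 n.+1) in d2.
have st := @roots_ge_crossings a b n ab (fun k h => (aP _ (in_ps k h)).1)
  (fun k h => (bP _ (in_ps k h)).1); rewrite -/(F a) -/(F b) in st.
have le_roots : (size (roots (y n.+1) a b) <= size (roots (y n.+1) s1 s2))%N.
  apply: uniq_leq_size; first exact: uniq_roots.
  move=> x xin; apply: root_in_roots; first exact: motion_fst_neq0.
    have := roots_in xin; rewrite !in_itv /= => /andP[? ?].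
    by apply/andP; split; lra.
  exact: root_roots xin.
rewrite -/(y n.+1).
move: d1 d2 st le_roots pa pb.
move: (crossings (F a) _) (crossings (F b) _) (crossings (F s1) _) (crossings (F s2) _).
move: (crossings _ _) (crossings _ _) (size _) (size _) (F s1 _ == 0) (F s2 _ == 0).
by clear; move=> ? ? ? ? [] [] ? ? ? ? /=; lia.
Qed.

End Sturm.

(** * Confocal quadratic forms as polynomials *)

Section ConfocalForm.
Variables (R : realType) (N : nat) (b : 'I_N.+1 -> R).
Hypothesis b_gt0 : forall i, 0 < b i.
Hypothesis b_inj : injective b.
Implicit Types (x y v : 'rV[R]_N.+1) (l s : R).

Definition pole_poly : {poly R} := \prod_i ((b i)%:P * 'X - 1).

Definition pole_cofactor i : {poly R} := \prod_(j | j != i) ((b j)%:P * 'X - 1).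

(** The confocal form of parameter [1/s], multiplied by [pole_poly]; its
    coefficients are [1 / (b i - 1/s)], that is [s / (b i * s - 1)]. *)
Definition form_poly x y : {poly R} :=
  \sum_i (x 0 i * y 0 i) *: ('X * pole_cofactor i).

Lemma pole_polyE i : pole_poly = ((b i)%:P * 'X - 1) * pole_cofactor i.
Proof. by rewrite /pole_poly (bigD1 i). Qed.

Lemma form_polyC x y : form_poly x y = form_poly y x.
Proof. by apply: eq_bigr => i _; rewrite mulrC. Qed.

Lemma form_polyDl x x' y : form_poly (x + x') y = form_poly x y + form_poly x' y.
Proof.
by rewrite /form_poly -big_split; apply: eq_bigr => i _; rewrite mxE mulrDl scalerDl.
Qed.

Lemma form_polyZl c x y : form_poly (c *: x) y = c%:P * form_poly x y.
Proof.
rewrite /form_poly big_distrr; apply: eq_bigr => i _ /=.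
by rewrite mxE -mulrA -scalerA -mul_polyC.
Qed.

Lemma form_polyDr x y y' : form_poly x (y + y') = form_poly x y + form_poly x y'.
Proof. by rewrite form_polyC form_polyDl !(form_polyC x). Qed.

Lemma form_polyZr c x y : form_poly x (c *: y) = c%:P * form_poly x y.
Proof. by rewrite form_polyC form_polyZl (form_polyC x). Qed.

(** What remains after removal of the leading term, which is given by the form
    with parameter 0 as [s] tends to infinity. *)
Definition low_form_poly x y : {poly R} :=
  \sum_i (x 0 i * y 0 i / b i) *: pole_cofactor i.

Lemma form_poly_low x y :
  form_poly x y = (confocal_form b 0 x y)%:P * pole_poly + low_form_poly x y.
Proof.
rewrite /confocal_form rmorph_sum big_distrl /= -big_split; apply: eq_bigr => i _ /=.
rewrite (pole_polyE i) subr0 -!mul_polyC.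
have E : (x 0 i * y 0 i)%:P = (x 0 i * y 0 i / b i)%:P * (b i)%:P.
  by rewrite -polyCM divfK // gt_eqF.
by rewrite E; ring.
Qed.

(** Up to a multiple of [pole_poly], replacing a point by the normal amounts to
    a multiplication by [s]; hence a reflection acts as a shear. *)
Lemma form_poly_normal x y : form_poly (normal b x) y
  = 'X * (form_poly x y - (confocal_form b 0 x y)%:P * pole_poly).
Proof.
rewrite [form_poly x y]form_poly_low addrAC subrr add0r /low_form_poly big_distrr.
by apply: eq_bigr => i _ /=; rewrite mxE -scalerAr mulrAC.
Qed.

Lemma pole_poly_prod :
  pole_poly = (\prod_i b i) *: \prod_(z <- [seq (b i)^-1 | i : 'I_N.+1]) ('X - z%:P).
Proof.
rewrite big_image -scaler_prod; apply: eq_bigr => i _ /=.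
by rewrite -mul_polyC mulrBr -polyCM divff ?gt_eqF.
Qed.

Lemma prod_b_gt0 : 0 < \prod_i b i.
Proof. exact: prodr_gt0. Qed.

Lemma size_pole_poly : size pole_poly = N.+2.
Proof.
rewrite pole_poly_prod size_scale ?gt_eqF ?prod_b_gt0 //.
by rewrite size_prod_XsubC size_image card_ord.
Qed.

Lemma lead_pole_poly : lead_coef pole_poly = \prod_i b i.
Proof.
by rewrite pole_poly_prod lead_coefZ (monicP (monic_prod_XsubC _ _ _)) mulr1.
Qed.

Lemma size_pole_cofactor i : size (pole_cofactor i) = N.+1.
Proof.
have sz : size ((b i)%:P * 'X - 1) = 2%N.
  by rewrite -polyCN size_MXaddC polyC_eq0 gt_eqF //= size_polyC gt_eqF.
have := size_pole_poly; rewrite (pole_polyE i) size_mul.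
- by rewrite sz => -[].
- by rewrite -size_poly_gt0 sz.
- apply/eqP => c0; have := size_pole_poly.
  by rewrite (pole_polyE i) c0 mulr0 size_poly0.
Qed.

Lemma size_low_form_poly x y : (size (low_form_poly x y) <= N.+1)%N.
Proof.
apply: leq_trans (size_sum _ _ _) _; apply/bigmax_leqP => i _.
by apply: leq_trans (size_scale_leq _ _) _; rewrite size_pole_cofactor.
Qed.

Lemma form_poly_horner0 x y : (form_poly x y).[0] = 0.
Proof.
by rewrite horner_sum big1 // => i _; rewrite hornerZ hornerM hornerX mul0r mulr0.
Qed.

Lemma pole_horner i : pole_poly.[(b i)^-1] = 0.
Proof. by rewrite (pole_polyE i) !hornerE divff ?gt_eqF // subrr mul0r. Qed.

Lemma form_poly_horner_pole i : exists2 c, c != 0 &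
  forall x y, (form_poly x y).[(b i)^-1] = x 0 i * y 0 i * c.
Proof.
exists ((b i)^-1 * (pole_cofactor i).[(b i)^-1]).
  apply: mulf_neq0; first by rewrite invr_eq0 gt_eqF.
  rewrite /pole_cofactor horner_prod; apply/prodf_neq0 => j ji.
  rewrite !hornerE subr_eq0.
  apply: contra_neq ji => h; apply/esym/b_inj.
  by have := congr1 ( *%R^~ (b i)) h; rewrite /= mulfVK ?gt_eqF // mul1r.
move=> x y; rewrite horner_sum (bigD1 i) //= big1 ?addr0 => [|j ji].
  by rewrite hornerZ hornerM hornerX.
rewrite hornerZ hornerM hornerX /pole_cofactor horner_prod (bigD1 i) //=; last by rewrite eq_sym.
by rewrite hornerD hornerN hornerM !hornerC hornerX divff ?gt_eqF // subrr !(mul0r, mulr0).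
Qed.

Lemma form_poly_horner l x y : l != 0 -> (forall i, b i != l) ->
  (form_poly x y).[l^-1] = pole_poly.[l^-1] * confocal_form b l x y.
Proof.
move=> l0 bl; rewrite horner_sum /confocal_form big_distrr; apply: eq_bigr => i _ /=.
rewrite (pole_polyE i) hornerZ !hornerM hornerX hornerD hornerN hornerM !hornerC hornerX.
have := bl i; rewrite -subr_eq0 => bl0.
by field; rewrite l0 bl0.
Qed.

Lemma confocal_poly_horner s x : s != 0 ->
  (form_poly x x - pole_poly).[s] = - s ^+ N.+1 * (confocal_poly b x).[s^-1].
Proof.
move=> s0.
have hD : pole_poly.[s] = s ^+ N.+1 * (\prod_i ((b i)%:P - 'X)).[s^-1].
  have -> : s ^+ N.+1 = \prod_(i < N.+1) s by rewrite prodr_const card_ord.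
  rewrite !horner_prod -big_split /=.
  by apply: eq_bigr => i _; rewrite !hornerE; field.
have hF : (form_poly x x).[s] = s ^+ N.+1
    * (\sum_i (x 0 i ^+ 2) *: \prod_(j | j != i) ((b j)%:P - 'X)).[s^-1].
  rewrite !horner_sum big_distrr; apply: eq_bigr => i _ /=.
  rewrite !hornerZ hornerM hornerX -expr2 [RHS]mulrCA [s ^+ N.+1]exprS -[s * _ * _]mulrA; congr (_ * (_ * _)).
    rewrite /pole_cofactor !horner_prod.
  have -> : s ^+ N = \prod_(j < N.+1 | j != i) s by rewrite prodr_const cardC1 card_ord.
  rewrite -big_split /=.
  by apply: eq_bigr => j _; rewrite !hornerE; field.
by rewrite /confocal_poly hornerD hornerN hD hF [in RHS]hornerD hornerN; ring.
Qed.

End ConfocalForm.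

(** * Billiard trajectories as motions of a string *)

Section Dotv.
Variables (R : realType) (N : nat).
Implicit Types (x y v nu : 'rV[R]_N.+1).

Lemma dotvC x y : dotv x y = dotv y x.
Proof. by apply: eq_bigr => i _; rewrite mulrC. Qed.

Lemma dotvDl x x' y : dotv (x + x') y = dotv x y + dotv x' y.
Proof. by rewrite /dotv -big_split; apply: eq_bigr => i _; rewrite mxE mulrDl. Qed.

Lemma dotvZl c x y : dotv (c *: x) y = c * dotv x y.
Proof. by rewrite /dotv big_distrr; apply: eq_bigr => i _ /=; rewrite mxE mulrA. Qed.

Lemma dotvDr x y y' : dotv x (y + y') = dotv x y + dotv x y'.
Proof. by rewrite dotvC dotvDl !(dotvC x). Qed.

Lemma dotvZr c x y : dotv x (c *: y) = c * dotv x y.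
Proof. by rewrite dotvC dotvZl (dotvC x). Qed.

Lemma dotv_gt0 x : x != 0 -> 0 < dotv x x.
Proof.
move=> x0; rewrite lt_neqAle sumr_ge0 ?andbT => [|i _]; last by rewrite -expr2 sqr_ge0.
rewrite eq_sym; apply: contra x0; rewrite psumr_eq0 => [/allP h|i _]; last first.
  by rewrite -expr2 sqr_ge0.
apply/eqP/rowP => i; have := h i (mem_index_enum _).
by rewrite mxE -expr2 sqrf_eq0 => /eqP.
Qed.

Lemma dotv_mirror nu v : dotv nu nu != 0 ->
  dotv (mirror nu v) (mirror nu v) = dotv v v.
Proof.
move=> nu0; rewrite /mirror -scaleNr !(dotvDl, dotvDr, dotvZl, dotvZr) (dotvC nu v).
by field.
Qed.

Lemma mirrorZ nu c v : mirror nu (c *: v) = c *: mirror nu v.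
Proof.
by rewrite /mirror dotvZl scalerBr scalerA; congr (_ - _ *: _); ring.
Qed.

End Dotv.

Section Trajectory.
Variables (R : realType) (N : nat) (b : 'I_N.+1 -> R).
Hypothesis b_gt0 : forall i, 0 < b i.
Variable p : nat -> 'rV[R]_N.+1.
Hypothesis traj : billiard_trajectory b p.

Definition chord k := p k.+1 - p k.
Definition len k : R := Num.sqrt (dotv (chord k) (chord k)).
Definition dir k := (len k)^-1 *: chord k.
Definition nor k := normal b (p k).
(** The coefficient of the normal in the reflection at the [k]-th vertex; it is
    the strength of the bead. *)
Definition kick k : R := 2 * dotv (dir k.-1) (nor k) / dotv (nor k) (nor k).

Lemma len_gt0 k : 0 < len k.
Proof.
by rewrite sqrtr_gt0 dotv_gt0 // subr_eq0; case: traj.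
Qed.

Lemma chordE k : chord k = len k *: dir k.
Proof. by rewrite scalerA mulfV ?gt_eqF ?len_gt0 // scale1r. Qed.

Lemma point_next k : p k.+1 = p k + len k *: dir k.
Proof. by rewrite -chordE addrC subrK. Qed.

Lemma on_boundary k : confocal_form b 0 (p k) (p k) = 1.
Proof. by case: traj => h _ _; apply: h. Qed.

Lemma dotv_normal x v : dotv (normal b x) v = confocal_form b 0 x v.
Proof. by apply: eq_bigr => i _; rewrite mxE subr0 mulrAC. Qed.

Lemma nor_neq0 k : dotv (nor k) (nor k) != 0.
Proof.
rewrite gt_eqF // dotv_gt0 //; apply/eqP => nor0.
have := on_boundary k; rewrite -dotv_normal -/(nor k) nor0 /dotv big1 => [/eqP|i _].
  by rewrite eq_sym oner_eq0.
by rewrite mxE mul0r.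
Qed.

Lemma dir_next k : dir k.+1 = dir k - kick k.+1 *: nor k.+1.
Proof.
have [_ _ /(_ k)[r r0 E]] := traj.
have lenE : len k.+1 = r * len k.
  rewrite /len /chord E dotvZl dotvZr mulrA -expr2 dotv_mirror ?nor_neq0 //.
  by rewrite sqrtrM ?sqr_ge0 // sqrtr_sqr gtr0_norm.
have -> : dir k - kick k.+1 *: nor k.+1 = mirror (nor k.+1) (dir k) by [].
rewrite {1}/dir lenE {1}/chord E scalerA -/(nor k.+1) -/(chord k) chordE mirrorZ scalerA.
have := len_gt0 k; move: (len k) => t t0.
have -> : (r * t)^-1 * r * t = 1 by field; rewrite !gt_eqF.
by rewrite scale1r.
Qed.

Local Notation X := ('X : {poly R}).

(** The coefficients, in [u] and [t], of the equation of the quadric at the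
    point with homogeneous coordinates [u p k + t dir k : u]. *)
Definition point_form k := form_poly b (p k) (p k) - pole_poly b.
Definition mixed_form k := form_poly b (p k) (dir k).
Definition dir_form k := form_poly b (dir k) (dir k).

Lemma point_form_next k : point_form k.+1 = point_form k
  + 2%:R * (len k)%:P * mixed_form k + (len k)%:P ^+ 2 * dir_form k.
Proof.
rewrite /point_form /mixed_form /dir_form point_next.
move: (p k) (dir k) (len k) => x v t.
rewrite !(form_polyDl, form_polyDr, form_polyZl, form_polyZr).
by rewrite (form_polyC _ v x); ring.
Qed.

Lemma form_next_dir k : form_poly b (p k.+1) (dir k)
  = mixed_form k + (len k)%:P * dir_form k.
Proof.
rewrite /mixed_form /dir_form point_next; move: (p k) (dir k) (len k) => x v t.
by rewrite form_polyDl form_polyZl.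
Qed.

Lemma form_nor_point k : form_poly b (nor k) (p k) = X * point_form k.
Proof. by rewrite form_poly_normal // on_boundary polyC1 mul1r. Qed.

Lemma mixed_form_next k : mixed_form k.+1 = mixed_form k
  + (len k)%:P * dir_form k - kick k.+1 *: X * point_form k.+1.
Proof.
rewrite {1}/mixed_form dir_next -scaleNr.
move: (form_next_dir k); move: (dir k) => v E.
rewrite form_polyDr form_polyZr E (form_polyC _ (p k.+1)) form_nor_point polyCN -mul_polyC.
by ring.
Qed.

(** The terms with [pole_poly] cancel by the choice of [kick], that is because
    the reflection preserves the length of the direction. *)
Lemma dir_form_next k : dir_form k.+1 = dir_form k
  - 2%:R * (kick k.+1 *: X) * (mixed_form k + (len k)%:P * dir_form k)
  + (kick k.+1 *: X) ^+ 2 * point_form k.+1.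
Proof.
have nor_dir : form_poly b (nor k.+1) (dir k)
    = X * (mixed_form k + (len k)%:P * dir_form k
           - (dotv (dir k) (nor k.+1))%:P * pole_poly b).
  by rewrite form_poly_normal // form_next_dir -dotv_normal dotvC.
have nor_nor : form_poly b (nor k.+1) (nor k.+1)
    = X * (X * point_form k.+1 - (dotv (nor k.+1) (nor k.+1))%:P * pole_poly b).
  rewrite form_poly_normal // -dotv_normal (form_polyC _ (p _)) form_nor_point.
  by rewrite dotvC.
have : form_poly b (dir k) (dir k) = dir_form k by [].
rewrite [dir_form k.+1]/dir_form dir_next -scaleNr; move: nor_dir nor_nor.
have : (kick k.+1)%:P * (dotv (nor k.+1) (nor k.+1))%:P
    = 2%:R * (dotv (dir k) (nor k.+1))%:P :> {poly R}.
  by rewrite -polyCM /kick divfK ?nor_neq0 // polyCM polyC_natr.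
move: (dotv (dir k) _) (dotv (nor _) _) => beta nu2 E; move: E.
move: (nor k.+1) (dir k) => nu v E nor_dir nor_nor dirE.
rewrite !(form_polyDl, form_polyDr, form_polyZl, form_polyZr) (form_polyC _ v nu).
rewrite nor_dir nor_nor dirE -mul_polyC polyCN; ring: E.
Qed.

End Trajectory.

(** * Pell's equation of a periodic trajectory *)

Section MotionPoly.
Variables (R : rcfType) (tau kappa : nat -> R).

Local Notation c k := (motion_poly tau kappa (1, 0) k).
Local Notation y k := (motion_poly tau kappa (0, 1) k).

Lemma motion_polyS u k : motion_poly tau kappa u k.+1
  = let v := motion_poly tau kappa u k in
    let z := v.1 + (tau k)%:P * v.2 in (z, v.2 - kappa k.+1 *: 'X * z).
Proof. by []. Qed.

Lemma motion_poly_det k : (c k).1 * (y k).2 - (y k).1 * (c k).2 = 1.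
Proof.
elim: k => [|k <-]; first by rewrite /motion_poly /= mulr1 mulr0 subr0.
by rewrite !motion_polyS /=; ring.
Qed.

Hypothesis tau_neq0 : forall k, tau k != 0.
Hypothesis kappa_neq0 : forall k, kappa k.+1 != 0.

Lemma size_motion_01 k :
  [/\ (size (y k).1 <= k)%N, (size (y k).2 <= k.+1)%N & (y k).2`_k != 0].
Proof.
elim: k => [|k [s1 s2 l2]].
  by rewrite /motion_poly /= size_poly0 size_poly1 coef1 oner_eq0.
rewrite motion_polyS /=; set z := _ + _.
have sz : (size z <= k.+1)%N.
  rewrite (leq_trans (size_polyD _ _)) // geq_max (leqW s1) /= mul_polyC.
  by rewrite (leq_trans (size_scale_leq _ _)).
have zk : z`_k != 0.
  by rewrite coefD nth_default // add0r mul_polyC coefZ mulf_neq0.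
have sXz : (size (kappa k.+1 *: 'X * z)%R <= k.+2)%N.
  rewrite -scalerAl (leq_trans (size_scale_leq _ _)) //.
  by rewrite (leq_trans (size_polyMleq _ _)) // size_polyX.
split => //.
  rewrite (leq_trans (size_polyD _ _)) // geq_max size_polyN sXz andbT.
  exact: leqW.
by rewrite coefB nth_default // sub0r oppr_eq0 -scalerAl coefZ coefXM mulf_neq0.
Qed.

Lemma size_motion_10 k :
  (size (c k.+1).1 <= k.+1)%N /\ (size (c k.+1).2 <= k.+2)%N.
Proof.
have next k' m : (size (c k').1 <= m)%N -> (size (c k').2 <= m)%N ->
    (size (c k'.+1).1 <= m)%N /\ (size (c k'.+1).2 <= m.+1)%N.
  move=> s1 s2; rewrite motion_polyS /=; set z := _ + _.
  have sz : (size z <= m)%N.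
    rewrite (leq_trans (size_polyD _ _)) // geq_max s1 /= mul_polyC.
    by rewrite (leq_trans (size_scale_leq _ _)).
  split => //; rewrite (leq_trans (size_polyD _ _)) // geq_max (leqW s2) /=.
  rewrite size_polyN -scalerAl (leq_trans (size_scale_leq _ _)) //.
  by rewrite (leq_trans (size_polyMleq _ _)) // size_polyX.
elim: k => [|k [s1 s2]].
  by apply: next; rewrite /motion_poly /= ?size_poly1 ?size_poly0.
by apply: next => //; apply: leqW.
Qed.

(** Every bead raises the degree by one, but of the two diagonal entries only
    [(y n.+1).2] feels the last one in the highest degree. *)
Lemma size_half_trace n :
  size (2^-1 *: ((c n.+1).1 + (y n.+1).2)) = n.+2.
Proof.
have [_ s2 l2] := size_motion_01 n.+1; have [s1 _] := size_motion_10 n.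
have {}s2 : size (y n.+1).2 = n.+2.
  apply/eqP; rewrite eqn_leq s2 ltnNge; apply: contra l2 => h.
  by rewrite nth_default.
by rewrite size_scale ?invr_neq0 ?pnatr_eq0 // addrC size_polyDl // s2.
Qed.

End MotionPoly.

Section PeriodicTrajectory.
Variables (R : realType) (N : nat) (b : 'I_N.+1 -> R) (a : 'I_N -> R).
Hypothesis gen : generic_parameters b a.
Variable p : nat -> 'rV[R]_N.+1.
Hypothesis traj : billiard_trajectory b p.
Hypothesis caust : forall j, caustic b (a j) p.
Variable n : nat.
Hypothesis periodic : forall k, p (k + n.+1)%N = p k.

Let b_gt0 i : 0 < b i. Proof. by case: gen. Qed.
Let b_inj : injective b.
Proof.
have [_ lt_b _ _] := gen; move=> i j E; apply/val_inj.
by have [/lt_b|/lt_b|//] := ssrnat.ltngtP i j; rewrite E ltxx.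
Qed.
Let a_inj : injective a.
Proof.
have [_ _ lt_a _] := gen; move=> i j E; apply/val_inj.
by have [/lt_a|/lt_a|//] := ssrnat.ltngtP i j; rewrite E ltxx.
Qed.
Let b_neq_a i j : b i != a j. Proof. by case: gen. Qed.

Local Notation conf := (confocal_form b 0).

Let confC x y : conf x y = conf y x.
Proof. by apply: eq_bigr => i _; rewrite [x 0 i * _]mulrC. Qed.
Let confDr x y z : conf x (y + z) = conf x y + conf x z.
Proof. by rewrite -!dotv_normal dotvDr. Qed.
Let confZr t x y : conf x (t *: y) = t * conf x y.
Proof. by rewrite -!dotv_normal dotvZr. Qed.

Lemma confocal_form_gt0 x : x != 0 -> 0 < conf x x.
Proof.
have ge0 (i : 'I_N.+1) : 0 <= x 0 i * x 0 i / (b i - 0).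
  by rewrite subr0 divr_ge0 ?(ltW (b_gt0 i)) // -expr2 sqr_ge0.
move=> x0; rewrite lt_neqAle sumr_ge0 ?andbT => [|i _]; last exact: ge0.
rewrite eq_sym; apply: contra x0; rewrite psumr_eq0 => [/allP h|i _]; last exact: ge0.
apply/eqP/rowP => i; have := h i (mem_index_enum _).
by rewrite mxE subr0 -expr2 mulf_eq0 invr_eq0 (gt_eqF (b_gt0 i)) orbF sqrf_eq0 => /eqP.
Qed.

Let dir_neq0 k : dir p k != 0.
Proof.
rewrite /dir scaler_eq0 invr_eq0 (gt_eqF (len_gt0 traj k)) /= subr_eq0.
by case: traj.
Qed.

Let conf_chord k : 2 * conf (p k) (dir p k) + len p k * conf (dir p k) (dir p k) = 0.
Proof.
have := on_boundary traj k.+1; rewrite (point_next traj k).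
have := on_boundary traj k; have := len_gt0 traj k.
move: (p k) (dir p k) (len p k) => x v t t0 xx.
rewrite confDr confZr confC confDr confZr (confC (x + _)) confDr confZr xx (confC v x) => E.
have : t * (2 * conf x v + t * conf v v) = 0.
  by apply: (addrI 1); rewrite addr0 -[RHS]E; ring.
by move/eqP; rewrite mulf_eq0 (gt_eqF t0) /= => /eqP.
Qed.

(** Both ends of the chord lie on the ellipsoid. *)
Lemma leaves_boundary k : conf (p k) (dir p k) < 0.
Proof.
have := conf_chord k; have := confocal_form_gt0 (dir_neq0 k); have := len_gt0 traj k.
by move=> t0 g0 E; have := mulr_gt0 t0 g0; lra.
Qed.

Lemma kick_neq0 k : kick b p k.+1 != 0.
Proof.
rewrite /kick /= mulf_neq0 ?invr_eq0 ?(nor_neq0 traj) // mulf_neq0 ?pnatr_eq0 //.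
rewrite dotvC dotv_normal confC (point_next traj) confDr confZr confC.
have := conf_chord k; have := confocal_form_gt0 (dir_neq0 k); have := len_gt0 traj k.
move=> t0 g0 E; rewrite gt_eqF //.
by have := mulr_gt0 t0 g0; lra.
Qed.

Local Notation A k := (point_form b p k).
Local Notation B k := (mixed_form b p k).
Local Notation C k := (dir_form b p k).
Local Notation D := (pole_poly b).

(** The branch points of the spectral curve, that is the roots of the
    discriminant. *)
Definition edges : seq R :=
  0 :: [seq (b i)^-1 | i : 'I_N.+1] ++ [seq (a j)^-1 | j : 'I_N].

Definition discriminant : {poly R} := B 0 ^+ 2 - A 0 * C 0.

(** A line that meets the interior of the boundary ellipsoid is not tangent to
    it. *)
Lemma caustic_neq0 j : a j != 0.
Proof.
apply/eqP => a0; have [s [t [st]]] := caust j 0%N.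
rewrite a0 on_boundary // subrr mulr0 add0r -/(chord p 0) (chordE traj) confZr.
have := leaves_boundary 0; have := len_gt0 traj 0%N => l0 h /eqP.
rewrite !mulf_eq0 (gt_eqF l0) (lt_eqF h) !orbF => /eqP t0 /eqP.
rewrite t0 mul0r addr0 !mulf_eq0 (gt_eqF l0) (lt_eqF h) !orbF => /eqP s0.
by move: st; rewrite s0 t0 eqxx.
Qed.

Lemma uniq_edges : uniq edges.
Proof.
rewrite /= mem_cat negb_or cat_uniq; apply/andP; split.
  apply/andP; split; apply/mapP => -[i _ /esym/eqP]; rewrite invr_eq0.
    by rewrite gt_eqF.
  by rewrite (negPf (caustic_neq0 i)).
apply/and3P; split.
- by rewrite map_inj_uniq ?enum_uniq // => i j /invr_inj/b_inj.
- apply/hasPn => x /mapP[j _ ->]; apply/mapP => -[i _ /invr_inj E].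
  by have := b_neq_a i j; rewrite E eqxx.
- by rewrite map_inj_uniq ?enum_uniq // => i j /invr_inj/a_inj.
Qed.

Lemma size_edges : size edges = N.*2.+2.
Proof. by rewrite /= size_cat !size_image !card_ord -addnn addSn. Qed.

(** The vertex lies on the boundary, so [A 0] loses its leading term, and the
    discriminant has the leading term of [B 0 ^+ 2]. *)
Lemma discriminant_lead : size discriminant = N.*2.+3 /\ 0 < lead_coef discriminant.
Proof.
have szD := size_pole_poly b_gt0; have leadD := lead_pole_poly b_gt0.
have AE : A 0 = low_form_poly b (p 0%N) (p 0%N).
  by rewrite /point_form form_poly_low // (on_boundary traj) mul1r addrC addKr.
pose lB := low_form_poly b (p 0%N) (dir p 0); pose lC := low_form_poly b (dir p 0) (dir p 0).
have BE : B 0 = (conf (p 0%N) (dir p 0))%:P * D + lB by rewrite /mixed_form form_poly_low.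
have CE : C 0 = (conf (dir p 0) (dir p 0))%:P * D + lC by rewrite /dir_form form_poly_low.
have b0 := leaves_boundary 0.
move: AE BE CE b0; move: (size_low_form_poly b_gt0 (p 0%N) (p 0%N)).
move: (size_low_form_poly b_gt0 (p 0%N) (dir p 0)) (size_low_form_poly b_gt0 (dir p 0) (dir p 0)).
rewrite -/lB -/lC; move: lB lC (low_form_poly b _ _) (conf (p _) _) (conf (dir _ _) _).
move=> lB lC lA be ga szB szC szA AE BE CE be0.
pose rest := (2 * be) *: D * lB + lB ^+ 2 - lA * (ga%:P * D + lC).
have FE : discriminant = (be ^+ 2) *: D ^+ 2 + rest.
  rewrite /discriminant AE BE CE /rest -!mul_polyC expr2 !polyCM polyC_natr.
  by ring.
have be2 : be ^+ 2 != 0 by rewrite sqrf_eq0 lt_eqF.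
have D0 : D != 0 by rewrite -size_poly_gt0 szD.
have szD2 : size ((be ^+ 2) *: D ^+ 2) = N.*2.+3.
  by rewrite size_scale // my_size_exp // szD /= muln2 doubleS.
have mulLe (q r : {poly R}) : (size q <= N.+2)%N -> (size r <= N.+1)%N -> (size (q * r)%R <= N.*2.+2)%N.
  move=> h1 h2; apply: leq_trans (size_polyMleq _ _) _.
  by move: h1 h2; rewrite -addnn; move: (size q) (size r) => u v; lia.
have szR : (size rest < N.*2.+3)%N.
  rewrite ltnS /rest (leq_trans (size_polyD _ _)) // geq_max size_polyN.
  rewrite [lA * _]mulrC mulLe ?andbT //; last first.
    rewrite (leq_trans (size_polyD _ _)) // geq_max mul_polyC.
    by rewrite (leq_trans (size_scale_leq _ _)) ?szD // (leqW szC).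
  rewrite (leq_trans (size_polyD _ _)) // geq_max expr2 !mulLe //.
    by rewrite (leq_trans (size_scale_leq _ _)) ?szD.
  exact: leqW.
rewrite FE; split; first by rewrite size_polyDl ?szD2.
rewrite lead_coefDl ?szD2 // lead_coefZ lead_coef_exp leadD.
have hb := prod_b_gt0 b_gt0.
rewrite pmulr_rgt0; first by rewrite exprn_even_gt0 //= gt_eqF.
by rewrite exprn_even_gt0 //= lt_eqF.
Qed.

(** At 0 all forms vanish; at [1 / b i] only the products of the [i]-th
    coordinates survive, a form of rank one; at [1 / a j] the discriminant
    vanishes by tangency. *)
Lemma discriminant_root z : z \in edges -> root discriminant z.
Proof.
rewrite /root /discriminant hornerD hornerN [(A 0 * _).[z]]hornerM horner_exp.
rewrite /mixed_form /dir_form /point_form hornerD hornerN.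
rewrite inE mem_cat => /or3P[/eqP->|/mapP[i _ ->]|/mapP[j _ ->]].
- by rewrite !form_poly_horner0 mulr0 expr0n subrr.
- have [c c0 E] := form_poly_horner_pole b_gt0 b_inj i.
  by rewrite !E pole_horner // subr0 expr2; apply/eqP; ring.
have aj0 := caustic_neq0 j; have := caust j 0%N; rewrite -/(chord p 0) (chordE traj).
move=> [s [t [st]]]; set l := len p 0.
have bl0 : l != 0 by apply: lt0r_neq0; apply: (len_gt0 traj).
rewrite !(form_poly_horner _ _ aj0 (fun i => b_neq_a i j)).
move: (pole_poly b).[_] => d.
have scr x y : confocal_form b (a j) x (l *: y) = l * confocal_form b (a j) x y.
  by rewrite /confocal_form big_distrr; apply: eq_bigr => i _ /=; rewrite mxE; ring.
have scl x y : confocal_form b (a j) (l *: x) y = l * confocal_form b (a j) x y.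
  by rewrite /confocal_form big_distrr; apply: eq_bigr => i _ /=; rewrite mxE; ring.
rewrite !(scr, scl) {scr scl}.
move: (confocal_form b (a j) (p _) (p _)) (confocal_form b (a j) (p _) (dir _ _)) => ca cb.
move: (confocal_form b (a j) (dir _ _) (dir _ _)) => cc h1 h2.
have h : (ca - 1) * cc = cb ^+ 2.
  have {}h1 : s * (ca - 1) + t * l * cb = 0 by rewrite -h1; ring.
  have {}h2 : s * cb + t * l * cc = 0.
    apply: (mulfI bl0); rewrite mulr0 -[RHS]h2; ring.
  have [s0|s0] := eqVneq s 0.
    have t0 : t * l != 0.
      by rewrite mulf_neq0 //; move: st; rewrite s0 xpair_eqE eqxx.
    move: h1 h2; rewrite s0 !mul0r !add0r => /eqP; rewrite mulf_eq0 (negPf t0) /= => /eqP->.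
    by move=> /eqP; rewrite mulf_eq0 (negPf t0) /= => /eqP->; rewrite mulr0 expr0n.
  apply: (mulfI s0); have -> : s * ((ca - 1) * cc) = s * (ca - 1) * cc by ring.
  have -> : s * (ca - 1) = - (t * l * cb) by apply/eqP; rewrite -addr_eq0 h1.
  have -> : s * cb ^+ 2 = cb * (s * cb) by ring.
  have -> : s * cb = - (t * l * cc) by apply/eqP; rewrite -addr_eq0 h2.
  by ring.
apply/eqP; have -> : (d * cb) ^+ 2 - (d * ca - d) * (d * cc)
  = d ^+ 2 * (cb ^+ 2 - (ca - 1) * cc) by ring.
by rewrite h subrr mulr0.
Qed.

Lemma discriminant_prod : exists2 c, 0 < c &
  discriminant = c *: \prod_(z <- edges) ('X - z%:P).
Proof.
have [sz lead] := discriminant_lead.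
exists (lead_coef discriminant) => //; apply: all_roots_prod_XsubC.
- by rewrite sz size_edges.
- by apply/allP => z; apply: discriminant_root.
- by rewrite uniq_rootsE uniq_edges.
Qed.

Lemma chord_periodic k : chord p (k + n.+1) = chord p k.
Proof. by rewrite /chord -addSn !periodic. Qed.

Lemma len_periodic k : len p (k + n.+1) = len p k.
Proof. by rewrite /len chord_periodic. Qed.

Lemma dir_periodic k : dir p (k + n.+1) = dir p k.
Proof. by rewrite /dir len_periodic chord_periodic. Qed.

(** A common divisor would divide the discriminant twice, but its roots are
    simple. *)
Lemma forms_coprime : exists u v w : {poly R}, u * A 0 + v * B 0 + w * C 0 = 1.
Proof.
have [c c0 discE] := discriminant_prod.
pose g := gcdp (B 0) (C 0).
have cop : coprimep (A 0) g.
  rewrite coprimep_def; apply/negPn/negP => szg.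
  have sep : separable_poly (\prod_(z <- edges) ('X - z%:P)).
    by rewrite separable_prod_XsubC uniq_edges.
  have := separable_nosquare sep (isT : (1 < 2)%N) szg.
  rewrite -(@dvdpZr _ c) ?gt_eqF // -discE /discriminant.
  have gA : gcdp (A 0) g %| A 0 by apply: dvdp_gcdl.
  have gB : gcdp (A 0) g %| B 0 by apply: dvdp_trans (dvdp_gcdr _ _) (dvdp_gcdl _ _).
  have gC : gcdp (A 0) g %| C 0 by apply: dvdp_trans (dvdp_gcdr _ _) (dvdp_gcdr _ _).
  by rewrite dvdp_sub ?dvdp_exp2r // expr2 dvdp_mul.
have /Bezout_eq1_coprimepP[[u1 u2] /= E] := cop.
have [[v w] /= /eqpf_eq[e e0 E']] := Bezoutp (B 0) (C 0).
exists u1, (u2 * e^-1%:P * v), (u2 * e^-1%:P * w).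
rewrite -E -addrA; congr (_ + _).
transitivity (u2 * e^-1%:P * (v * B 0 + w * C 0)); first by ring.
have eV : e^-1%:P * e%:P = 1 :> {poly R} by rewrite -polyCM mulVf.
by rewrite E' -/g -mul_polyC mulrA -(mulrA u2) eV mulr1.
Qed.

Local Notation c k := (motion_poly (len p) (kick b p) (1, 0) k).
Local Notation y k := (motion_poly (len p) (kick b p) (0, 1) k).

Lemma forms_motion k :
  [/\ A k = (c k).1 ^+ 2 * A 0 + 2%:R * (c k).1 * (y k).1 * B 0 + (y k).1 ^+ 2 * C 0,
      B k = (c k).1 * (c k).2 * A 0 + ((c k).1 * (y k).2 + (y k).1 * (c k).2) * B 0
            + (y k).1 * (y k).2 * C 0 &
      C k = (c k).2 ^+ 2 * A 0 + 2%:R * (c k).2 * (y k).2 * B 0 + (y k).2 ^+ 2 * C 0].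
Proof.
elim: k => [|k [EA EB EC]].
  by rewrite /motion_poly /=; split; ring.
rewrite (dir_form_next b_gt0 traj) (mixed_form_next b_gt0 traj) (point_form_next traj).
rewrite !motion_polyS EA EB EC /=.
move: (c k) (y k) => [c1 c2] [y1 y2] /=.
by split; ring.
Qed.

(** The transfer matrix over a period preserves the quadratic form with entries
    [A 0], [B 0], [C 0].  A unimodular matrix that does so is half its trace
    times the identity plus [Q] times a matrix with entries [A 0], [B 0], [C 0]
    up to sign, and Pell's equation says that its determinant is 1. *)
Theorem billiard_pell : exists Q : {poly R},
  (y n.+1).1 = A 0 * Q /\
  (2^-1 *: ((c n.+1).1 + (y n.+1).2)) ^+ 2 - discriminant * Q ^+ 2 = 1.
Proof.
have [u [v [w bez]]] := forms_coprime.
have dirE : dir p n.+1 = dir p 0 := dir_periodic 0.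
have pE : p n.+1 = p 0%N := periodic 0.
have [] := forms_motion n.+1.
have -> : A n.+1 = A 0 by rewrite /point_form pE.
have -> : B n.+1 = B 0 by rewrite /mixed_form pE dirE.
have -> : C n.+1 = C 0 by rewrite /dir_form dirE.
have := motion_poly_det (len p) (kick b p) n.+1.
rewrite /discriminant; move: (A 0) (B 0) (C 0) bez.
move: (c n.+1) (y n.+1) => [m11 m21] [m12 m22] /= fA fB fC bez det EA EB EC.
have h1 : (m22 - m11) * fA = 2%:R * m12 * fB.
  have : m22 * fA - m12 * fB = (m11 * fA + m12 * fB) * (m11 * m22 - m12 * m21).
    by rewrite {1}EB {1}EA; ring.
  by rewrite det mulr1 => /eqP; rewrite subr_eq => /eqP E; rewrite mulrBl E; ring.
have h2 : m12 * fC = - (m21 * fA).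
  have : m11 * fB - m21 * fA = (m11 * fB + m12 * fC) * (m11 * m22 - m12 * m21).
    by rewrite {1}EA {1}EB; ring.
  by rewrite det mulr1 => /addrI.
have h3 : (m22 - m11) * fC = - (2%:R * m21 * fB).
  have : m11 * fC - m21 * fB = (m21 * fB + m22 * fC) * (m11 * m22 - m12 * m21).
    by rewrite {1}EB {1}EC; ring.
  rewrite det mulr1 => /eqP; rewrite subr_eq => /eqP E; rewrite mulrBl E; ring.
pose h := 2^-1 *: (m22 - m11).
have two (x : {poly R}) : 2^-1 *: (2%:R * x) = x.
  by rewrite -polyC_natr -mul_polyC mulrA -polyCM mulVf ?mul1r // pnatr_eq0.
have hA : h * fA = m12 * fB by rewrite /h -scalerAl h1 -mulrA two.
have hC : h * fC = - (m21 * fB) by rewrite /h -scalerAl h3 scalerN -mulrA two.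
(* [m12], [h] and [- m21] are proportional to the forms; the Bezout coefficients
   of the latter give the factor *)
pose q := u * m12 + v * h - w * m21.
have qA : fA * q = m12.
  have -> : fA * q = u * fA * m12 + v * (h * fA) - w * (m21 * fA) by rewrite /q; ring.
  by rewrite hA -[m21 * fA]opprK -h2 -[RHS]mulr1 -bez; ring.
have qB : fB * q = h.
  have -> : fB * q = u * (m12 * fB) + v * h * fB - w * (m21 * fB) by rewrite /q; ring.
  by rewrite -hA -[m21 * fB]opprK -hC -[RHS]mulr1 -bez; ring.
have qC : fC * q = - m21.
  have -> : fC * q = u * (m12 * fC) + v * (h * fC) - w * m21 * fC by rewrite /q; ring.
  by rewrite h2 hC -[RHS]mulr1 -bez; ring.
exists q; split; first by rewrite qA.
have -> : (2^-1 *: (m11 + m22)) ^+ 2 - (fB ^+ 2 - fA * fC) * q ^+ 2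
    = (2^-1 *: (m11 + m22)) ^+ 2 - (fB * q) ^+ 2 + (fA * q) * (fC * q) by ring.
rewrite qA qB qC mulrN -det /h; congr (_ - _).
rewrite subr_sqr -scalerBr -scalerDr.
have -> : m11 + m22 - (m22 - m11) = 2%:R * m11 by ring.
have -> : m11 + m22 + (m22 - m11) = 2%:R * m22 by ring.
by rewrite !two.
Qed.

End PeriodicTrajectory.

(** * Zeros of a solution over a period *)

Section ZeroCount.
Variable R : realType.
Implicit Types (f : nat -> R) (t s : R) (rs : seq R).

(** The shape of the string, with every piece run in unit time. *)
Definition piecewise f t : R :=
  let k := Num.truncn t in f k + (t - k%:R) * (f k.+1 - f k).

Lemma truncnD_nat t k : 0 <= t -> Num.truncn (t + k%:R) = (Num.truncn t + k)%N.
Proof.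
move=> t0; apply/truncn_def; have /andP[h1 h2] := truncn_itv t0.
by rewrite -addSn !natrD lerD2r h1 ltrD2r h2.
Qed.

(** Turns are counted over a period that starts at a visit of the lower end,
    zeros over the first period; this serves to compare the two. *)
Lemma window_shift n t s : 0 <= t -> 0 <= s -> exists t0 i j,
  [/\ 0 <= t0, t = t0 + (i * n.+1)%:R &
      s <= t0 + (j * n.+1)%:R < s + n.+1%:R].
Proof.
move=> t_ge0 s_ge0; pose i := (Num.truncn t %/ n.+1)%N.
have /andP[h1 h2] := truncn_itv t_ge0.
have it : (i * n.+1)%:R <= t by apply: le_trans h1; rewrite ler_nat leq_trunc_div.
have ti : t < (i * n.+1)%:R + n.+1%:R.
  by apply: lt_le_trans h2 _; rewrite -natrD ler_nat -mulSnr ltn_ceil.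
pose t0 := t - (i * n.+1)%:R; have t0_ge0 : 0 <= t0 by rewrite subr_ge0.
have t0n : t0 < n.+1%:R by rewrite ltrBlDl.
have ex_j : exists j, s <= t0 + (j * n.+1)%:R.
  exists (Num.truncn s).+1; apply: le_trans (_ : (Num.truncn s).+1%:R <= _).
    by have /andP[_ /ltW] := truncn_itv s_ge0.
  by apply: ler_wpDl => //; rewrite ler_nat leq_pmulr.
case: (ex_minnP ex_j) => j sj minj.
exists t0, i, j; split => //; first by rewrite subrK.
rewrite sj /=; case: j sj minj => [|j] sj minj.
  by rewrite mul0n addr0 ltr_wpDl.
rewrite mulSnr natrD addrA ltrD2r ltNge; apply/negP => /minj.
by rewrite ltnn.
Qed.

Variables (f : nat -> R) (n : nat).
Hypothesis f_neq0 : forall k, f k != 0 \/ f k.+1 != 0.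
(* The two conditions say that a period multiplies [f] by 1 or by -1. *)
Hypothesis f_sqr : forall k, f (k + n.+1)%N ^+ 2 = f k ^+ 2.
Hypothesis f_mul : forall k,
  f (k + n.+1)%N * f (k + n.+1).+1 = f k * f k.+1.

Let zero_at k : bool := (f k == 0) || (f k * f k.+1 < 0).

(** By periodicity it does not matter whether a piece owns the zero at its end,
    as in [crossings], or the one at its beginning, as in [zero_at]. *)
Lemma crossings_zero_at : crossings f n.+1 = count zero_at (iota 0 n.+1).
Proof.
have -> : iota 0 n.+1 = index_iota 0 n.+1 by rewrite /index_iota subn0.
rewrite -sum1_count big_mkcond big_mkord.
have -> : (\sum_(k < n.+1) (if zero_at k then 1 else 0)
    = \sum_(k < n.+1) (f k == 0%R) + \sum_(k < n.+1) (f k * f k.+1 < 0%R)%R)%N.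
  rewrite -big_split; apply: eq_bigr => k _ /=.
  by rewrite /zero_at; case: eqVneq => [->|_] /=; rewrite ?mul0r ?ltxx //; case: ifP.
rewrite /crossings.
have -> : (\sum_(k < n.+1) crossing (f k) (f k.+1)
    = \sum_(k < n.+1) (f k.+1 == 0%R) + \sum_(k < n.+1) (f k * f k.+1 < 0%R)%R)%N.
  rewrite -big_split; apply: eq_bigr => k _ /=.
  by rewrite /crossing; case: eqVneq => [->|_] /=; rewrite ?mulr0 ?ltxx.
congr (_ + _)%N; rewrite big_ord_recr big_ord_recl /= addnC; congr (_ + _)%N.
by have := f_sqr 0; rewrite add0n => E; rewrite -(sqrf_eq0 (f n.+1)) E sqrf_eq0.
Qed.

Lemma piecewise_sqrE t : let k := Num.truncn t in let th := t - k%:R in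
  piecewise f t ^+ 2 = (1 - th) ^+ 2 * f k ^+ 2
    + 2 * (1 - th) * th * (f k * f k.+1) + th ^+ 2 * f k.+1 ^+ 2.
Proof. by rewrite /piecewise /=; ring. Qed.

Lemma piecewise_periodic t j : 0 <= t ->
  (piecewise f (t + (j * n.+1)%:R) == 0) = (piecewise f t == 0).
Proof.
move=> t0; elim: j => [|j ih]; first by rewrite addr0.
rewrite -{}ih mulSnr natrD addrA.
have : 0 <= t + (j * n.+1)%:R by rewrite addr_ge0.
move: (t + _) => {t0}t t0; rewrite -[LHS]sqrf_eq0 -[RHS]sqrf_eq0 !piecewise_sqrE.
rewrite truncnD_nat // natrD -addSn !f_sqr addSn f_mul.
by have -> : t + n.+1%:R - ((Num.truncn t)%:R + n.+1%:R) = t - (Num.truncn t)%:R by ring.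
Qed.

Lemma zero_at_truncn t : 0 <= t -> piecewise f t = 0 -> zero_at (Num.truncn t).
Proof.
move=> /truncn_itv/andP[]; rewrite /piecewise /zero_at; move: (Num.truncn t) => k h1 h2 E.
case: eqVneq => //= fk.
rewrite -natr1 in h2; have th0 : t - k%:R != 0.
  by apply: contraNneq fk => th; rewrite -E th mul0r addr0.
have {}th0 : 0 < t - k%:R by rewrite lt_neqAle eq_sym th0 subr_ge0.
have th1 : t - k%:R < 1 by lra.
move: (t - _) th0 th1 E => th th0 th1 E.
have E' : th * f k.+1 = - (1 - th) * f k by apply/eqP; rewrite -subr_eq0 -E; apply/eqP; ring.
rewrite -(pmulr_rlt0 _ th0).
have -> : th * (f k * f k.+1) = f k * (th * f k.+1) by ring.
rewrite E'; have -> : f k * (- (1 - th) * f k) = - ((1 - th) * f k ^+ 2) by ring.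
by rewrite oppr_lt0 mulr_gt0 ?subr_gt0 // exprn_even_gt0.
Qed.

Lemma zero_at_exists k : zero_at k ->
  exists t, [/\ 0 <= t, Num.truncn t = k & piecewise f t = 0].
Proof.
case/orP => [/eqP fk|fk].
  by exists k%:R; rewrite natrK /piecewise natrK fk subrr mul0r addr0.
pose th := f k / (f k - f k.+1).
have d0 : f k - f k.+1 != 0.
  by rewrite subr_eq0; apply: contraTneq fk => <-; rewrite -leNgt -expr2 sqr_ge0.
have [th0 th1] : 0 < th /\ th < 1.
  have thE : th = f k ^+ 2 / (f k ^+ 2 - f k * f k.+1).
    rewrite /th; field; rewrite d0 /=.
    have -> : f k ^+ 2 - f k * f k.+1 = f k * (f k - f k.+1) by ring.
    by rewrite mulf_neq0 ?d0 // ?andbT; apply: contraTneq fk => ->; rewrite mul0r ltxx.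
  have fk2 : 0 < f k ^+ 2.
    by rewrite exprn_even_gt0 //=; apply: contraTneq fk => ->; rewrite mul0r ltxx.
  have den : 0 < f k ^+ 2 - f k * f k.+1 by lra.
  by rewrite thE divr_gt0 // ltr_pdivrMr // mul1r; split => //; lra.
have tk : Num.truncn (k%:R + th) = k.
  by apply/truncn_def; rewrite -natr1 lerDl ltrD2l ltW.
exists (k%:R + th); split => //; first by rewrite addr_ge0 // ltW.
rewrite /piecewise tk addrAC subrr add0r /th.
by field.
Qed.

Lemma zero_unique t s : Num.truncn t = Num.truncn s ->
  piecewise f t = 0 -> piecewise f s = 0 -> t = s.
Proof.
rewrite /piecewise => ->; move: (Num.truncn s) => k E1 E2.
have : (t - s) * (f k.+1 - f k) = 0 by rewrite -[RHS](subrr 0) -{1}E1 -E2; ring.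
move/eqP; rewrite mulf_eq0 subr_eq0 => /orP[/eqP//|/eqP d].
move: E1; rewrite d mulr0 addr0 => fk; move: d; rewrite fk subr0 => fk1.
by case: (f_neq0 k); rewrite ?fk ?fk1 eqxx.
Qed.

Let reduce t := t - (Num.truncn t %/ n.+1 * n.+1)%:R.

Let reduceP t : 0 <= t -> piecewise f t = 0 ->
  [/\ 0 <= reduce t, Num.truncn (reduce t) = (Num.truncn t %% n.+1)%N &
      piecewise f (reduce t) = 0].
Proof.
move=> t0 ft; have r0 : 0 <= reduce t.
  rewrite subr_ge0; have /andP[+ _] := truncn_itv t0; apply: le_trans.
  by rewrite ler_nat leq_trunc_div.
have tE : reduce t + (Num.truncn t %/ n.+1 * n.+1)%:R = t by rewrite /reduce subrK.
split => //.
  have := truncnD_nat (Num.truncn t %/ n.+1 * n.+1) r0; rewrite tE {1}(divn_eq (Num.truncn t) n.+1).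
  by rewrite addnC => /addIn <-.
by apply/eqP; rewrite -(piecewise_periodic (Num.truncn t %/ n.+1) r0) tE ft.
Qed.

Lemma crossings_ge rs s : 0 <= s -> uniq rs ->
  {in rs, forall t, s <= t < s + n.+1%:R /\ piecewise f t = 0} ->
  (size rs <= crossings f n.+1)%N.
Proof.
move=> s0 urs rsP; rewrite crossings_zero_at -size_filter.
rewrite -(size_map (fun t => Num.truncn t %% n.+1)%N rs); apply: uniq_leq_size.
  rewrite map_inj_in_uniq // => t u /rsP[/andP[t1 t2] ft] /rsP[/andP[u1 u2] fu] E.
  have t0 := le_trans s0 t1; have u0 := le_trans s0 u1.
  have [rt0 rtE rt] := reduceP t0 ft; have [ru0 ruE ru] := reduceP u0 fu.
  have := zero_unique _ rt ru; rewrite rtE ruE E => /(_ erefl).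
  rewrite /reduce; set i := (_ %/ _)%N; set j := (_ %/ _)%N => Eij.
  suff ij : i = j by move: Eij; rewrite ij => /addIr.
  have Eij' : t - u = (i * n.+1)%:R - (j * n.+1)%:R.
    have -> : t = u - (j * n.+1)%:R + (i * n.+1)%:R by rewrite -Eij subrK.
    by ring.
  have [ij|ij|//] := ssrnat.ltngtP i j.
    have : ((i * n.+1)%:R + n.+1%:R <= (j * n.+1)%:R :> R).
      by rewrite -natrD ler_nat -mulSnr leq_mul2r ij orbT.
    by move=> ?; exfalso; lra.
  have : ((j * n.+1)%:R + n.+1%:R <= (i * n.+1)%:R :> R).
    by rewrite -natrD ler_nat -mulSnr leq_mul2r ij orbT.
  by move=> ?; exfalso; lra.
move=> k /mapP[t /rsP[/andP[t1 t2] ft] ->].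
have t0 := le_trans s0 t1; have [rt0 rtE rt] := reduceP t0 ft.
rewrite mem_filter mem_iota add0n ltn_mod /= andbT.
by rewrite -rtE; apply: zero_at_truncn.
Qed.

Lemma crossings_le rs s : 0 <= s ->
  (forall t, s <= t < s + n.+1%:R -> piecewise f t = 0 -> t \in rs) ->
  (crossings f n.+1 <= size rs)%N.
Proof.
move=> s0 rsP; rewrite crossings_zero_at -size_filter.
rewrite -(size_map (fun t => Num.truncn t %% n.+1)%N rs); apply: uniq_leq_size.
  by rewrite filter_uniq ?iota_uniq.
move=> k; rewrite mem_filter mem_iota add0n => /andP[/zero_at_exists[t [t0 tk ft]] /= kn].
have [u [i [j [u0 tE win]]]] := window_shift n t0 s0.
have fu : piecewise f u = 0.
  by apply/eqP; rewrite -(piecewise_periodic i u0) -tE ft.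
apply/mapP; exists (u + (j * n.+1)%:R); last first.
  rewrite truncnD_nat // addnC modnMDl -[LHS](modn_small kn) -tk tE truncnD_nat //.
  by rewrite addnC modnMDl.
by apply: rsP => //; apply/eqP; rewrite piecewise_periodic ?fu.
Qed.

Lemma piecewise_neq0 s t : 0 <= s -> s < t ->
  (forall u, s <= u <= t -> piecewise f u = 0) -> False.
Proof.
move=> s0 st zst; have /andP[h1 h2] := truncn_itv s0.
pose u := Num.min t ((s + (Num.truncn s).+1%:R) / 2).
have su : s < u by rewrite lt_min st /=; lra.
have ut : u <= t by rewrite ge_min lexx.
have uk : u < (Num.truncn s).+1%:R.
  by rewrite gt_min; apply/orP; right; lra.
have tu : Num.truncn u = Num.truncn s.
  by apply/truncn_def; rewrite uk andbT (le_trans h1) // ltW.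
have E : s = u.
  apply: zero_unique => //; first by rewrite zst // lexx ltW.
  by rewrite zst // ut ltW.
by move: su; rewrite -E ltxx.
Qed.

End ZeroCount.

(** * Solutions at the branch points *)

(** For the form of the first chord at a branch point, [g] is the initial state
    of the solution whose square is, up to sign, the form. *)
Lemma rank_one_form (R : rcfType) (x y z : R) : y ^+ 2 = x * z ->
  (x, z) != (0, 0) -> exists e (g : R * R), [/\ e ^+ 2 = 1, g != (0, 0),
    x = e * g.1 ^+ 2, y = e * (g.1 * g.2) & z = e * g.2 ^+ 2].
Proof.
move=> yxz xz0; have [x0|x0] := eqVneq x 0.
  have z0 : z != 0 by apply: contraNneq xz0 => ->; rewrite x0.
  have y0 : y = 0 by move/eqP: yxz; rewrite x0 mul0r sqrf_eq0 => /eqP.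
  exists (Num.sg z), (0, Num.sqrt `|z|); split => /=.
  - by rewrite sqr_sg z0.
  - by rewrite xpair_eqE eqxx /= sqrtr_eq0 -ltNge normr_gt0.
  - by rewrite expr0n mulr0.
  - by rewrite mul0r mulr0.
  - by rewrite sqr_sqrtr // -numEsg.
have s0 : 0 < Num.sqrt `|x| by rewrite sqrtr_gt0 normr_gt0.
have sE : Num.sqrt `|x| ^+ 2 = `|x| by rewrite sqr_sqrtr.
have sg2 : Num.sg x ^+ 2 = 1 by rewrite sqr_sg x0.
exists (Num.sg x), (Num.sqrt `|x|, Num.sg x * y / Num.sqrt `|x|); split => //=.
- by rewrite xpair_eqE gt_eqF.
- by rewrite sE -numEsg.
- have -> : Num.sg x * (Num.sqrt `|x| * (Num.sg x * y / Num.sqrt `|x|))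
    = Num.sg x ^+ 2 * y by field; rewrite gt_eqF.
  by rewrite sg2 mul1r.
rewrite exprMn exprMn sg2 mul1r exprVn sE mulrA yxz.
have -> : x * z = Num.sg x * `|x| * z by rewrite -numEsg.
have -> : Num.sg x * (Num.sg x * `|x| * z) = Num.sg x ^+ 2 * z * `|x| by ring.
by rewrite sg2 mul1r mulfK // normr_eq0.
Qed.

Section EdgeSolution.
Variables (R : realType) (N : nat) (b : 'I_N.+1 -> R) (a : 'I_N -> R).
Hypothesis gen : generic_parameters b a.
Variable p : nat -> 'rV[R]_N.+1.
Hypothesis traj : billiard_trajectory b p.
Hypothesis caust : forall j, caustic b (a j) p.
Variable n : nat.
Hypothesis periodic : forall k, p (k + n.+1)%N = p k.

Let b_gt0 i : 0 < b i. Proof. by case: gen. Qed.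

(** At a branch point the quadratic form of the chords degenerates, and its
    square root solves the string equation.  The value of the form at a point
    of the trajectory vanishes when a Jacobi coordinate of the point is [1/z]. *)
Theorem edge_solution z : z \in edges b a -> z != 0 -> exists g f,
  f = (fun k => (motion (len p) (kick b p) z g k).1) /\
  [/\ g != (0, 0),
      forall k, f k != 0 \/ f k.+1 != 0,
      forall k, f (k + n.+1)%N ^+ 2 = f k ^+ 2,
      forall k, f (k + n.+1)%N * f (k + n.+1).+1 = f k * f k.+1 &
      forall t, root (confocal_poly b (trajectory_point p t)) z^-1
                = (piecewise f t == 0)].
Proof.
move=> zE z0.
have /rootP disc0 := discriminant_root gen traj caust zE.
have [u [v [w /(congr1 (horner^~ z))]]] := forms_coprime gen traj caust.
rewrite /discriminant in disc0; move: disc0.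
move E1 : (point_form b p 0) => fA; move E2 : (mixed_form b p 0) => fB.
move E3 : (dir_form b p 0) => fC; rewrite !hornerE /= => disc0 bez.
have sqrE : fB.[z] ^+ 2 = fA.[z] * fC.[z].
  by apply/eqP; rewrite -subr_eq0 -disc0 expr2.
have [|e [g [e2 g0 EA EB EC]]] := rank_one_form sqrE.
  apply/eqP => -[xz1 xz2].
  have fB0 : fB.[z] = 0.
    by apply/eqP; rewrite -sqrf_eq0 sqrE xz1 mul0r.
  by move/eqP: bez; rewrite xz1 xz2 fB0 !mulr0 !addr0 eq_sym oner_eq0.
pose f k := (motion (len p) (kick b p) z g k).1.
exists g, f; split => //.
pose s k := motion (len p) (kick b p) z g k.
have forms k : [/\ (point_form b p k).[z] = e * (s k).1 ^+ 2,
    (mixed_form b p k).[z] = e * ((s k).1 * (s k).2) &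
    (dir_form b p k).[z] = e * (s k).2 ^+ 2].
  elim: k => [|k [IA IB IC]]; first by rewrite E1 E2 E3.
  rewrite (dir_form_next b_gt0 traj) (mixed_form_next b_gt0 traj) (point_form_next traj).
  move: IA IB IC; rewrite /s motionS -/(s k) /=.
  move: (point_form b p k) (mixed_form b p k) (dir_form b p k) => qA qB qC IA IB IC.
  move: (kick b p k.+1) (len p k) => K l.
  by rewrite !hornerE /= IA IB IC; split; ring.
have e0 : e != 0 by apply: contra_eqN e2 => /eqP ->; rewrite expr0n /= eq_sym oner_eq0.
have s_neq0 k : s k != (0, 0) by apply: motion_neq0.
have fS k : f k.+1 = (s k).1 + len p k * (s k).2 by [].
have per k : (s (k + n.+1)%N).1 ^+ 2 = (s k).1 ^+ 2 /\
    (s (k + n.+1)%N).1 * (s (k + n.+1)%N).2 = (s k).1 * (s k).2.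
  have [A1 B1 _] := forms k; have [A2 B2 _] := forms (k + n.+1)%N.
  split; apply: (mulfI e0).
    by rewrite -A1 -A2 /point_form periodic.
  by rewrite -B1 -B2 /mixed_form periodic (dir_periodic periodic).
split => //.
- move=> k; rewrite fS /f -/(s k); have := s_neq0 k; case: (s k) => y0 w0 /= yw.
  have [y00|] := eqVneq y0 0; last by left.
  right; rewrite y00 add0r; apply: mulf_neq0; first exact: lt0r_neq0 (len_gt0 traj k).
  by move: yw; rewrite y00 xpair_eqE eqxx.
- by move=> k; have [] := per k.
- move=> k; rewrite !fS (len_periodic periodic) /f -!/(s _) !mulrDr -!expr2.
  have [-> E] := per k; congr (_ + _).
  by rewrite mulrCA E mulrCA.
move=> t; rewrite /trajectory_point /piecewise; set k := Num.truncn t.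
set th := t - k%:R; rewrite -/(chord p k) (chordE traj) scalerA.
set x := p k + _.
have xE : (form_poly b x x - pole_poly b).[z] = e * (f k + th * (f k.+1 - f k)) ^+ 2.
  have [IA IB IC] := forms k.
  have -> : form_poly b x x - pole_poly b = point_form b p k
      + 2%:R * (th * len p k)%:P * mixed_form b p k
      + (th * len p k)%:P ^+ 2 * dir_form b p k.
    rewrite /x /point_form /mixed_form /dir_form; move: (dir p k) (p k) => d q.
    rewrite !(form_polyDl, form_polyDr, form_polyZl, form_polyZr).
    by rewrite (form_polyC _ d q); ring.
  move: IA IB IC; rewrite fS /f -/(s k).
  move: (point_form b p k) (mixed_form b p k) (dir_form b p k) => qA qB qC IA IB IC.
  by rewrite !hornerE /= IA IB IC; ring.
have := confocal_poly_horner b x z0; rewrite xE => E.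
rewrite -[RHS]sqrf_eq0 -[RHS](mulrI_eq0 _ (mulfI e0)) E mulNr oppr_eq0.
by rewrite (mulrI_eq0 _ (mulfI (expf_neq0 _ z0))) rootE.
Qed.

End EdgeSolution.

(** * Interlacing of the Jacobi coordinates *)

Section Interlacing.
Variables (R : realType) (N : nat) (b : 'I_N.+1 -> R).
Hypothesis lt_b : forall i j : 'I_N.+1, (i < j)%N -> b i < b j.
Variables (x : 'rV[R]_N.+1) (l : 'I_N.+1 -> R).
Hypothesis jac : jacobi_coordinates b x l.

Let lt_l (i j : 'I_N.+1) : (i < j)%N -> l i < l j.
Proof. by case: jac => + _; apply. Qed.

Lemma prod_subX (I : finType) (P : pred I) (c : I -> R) :
  \prod_(i | P i) ((c i)%:P - 'X)
  = (-1) ^+ #|P| *: \prod_(i | P i) ('X - (c i)%:P) :> {poly R}.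
Proof.
rewrite -[RHS]mul_polyC rmorphXn rmorphN1 -prodrN.
by apply: eq_bigr => i _; rewrite opprB.
Qed.

Lemma size_prod_subX (I : finType) (P : pred I) (c : I -> R) :
  size (\prod_(i | P i) ((c i)%:P - 'X)) = #|P|.+1.
Proof.
rewrite prod_subX size_scale ?signr_eq0 // -big_filter size_prod_XsubC.
by rewrite -cardE.
Qed.

Lemma confocal_poly_prod : confocal_poly b x = \prod_i ((l i)%:P - 'X).
Proof.
have sz : size (\prod_i ((b i)%:P - 'X)) = N.+2 by rewrite size_prod_subX card_ord.
set rest := \sum_i (x 0 i ^+ 2) *: \prod_(j | j != i) ((b j)%:P - 'X).
have szr : (size rest < N.+2)%N.
  rewrite ltnS; apply: leq_trans (size_sum _ _ _) _; apply/bigmax_leqP => i _.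
  apply: leq_trans (size_scale_leq _ _) _; rewrite size_prod_subX.
  by rewrite cardC1 card_ord.
have szq : size (confocal_poly b x) = N.+2.
  by rewrite /confocal_poly -/rest size_polyDl ?size_polyN sz.
have lead : lead_coef (confocal_poly b x) = (-1) ^+ N.+1.
  rewrite /confocal_poly -/rest lead_coefDl ?size_polyN ?sz // prod_subX lead_coefZ.
  by rewrite (monicP (monic_prod_XsubC _ _ _)) mulr1 card_ord.
rewrite (@all_roots_prod_XsubC _ (confocal_poly b x) [seq l i | i : 'I_N.+1]).
- by rewrite lead prod_subX card_ord big_image.
- by rewrite szq size_image card_ord.
- by apply/allP => _ /mapP[i _ ->]; case: jac => _; apply.
- rewrite uniq_rootsE map_inj_uniq ?enum_uniq // => i j E; apply/val_inj.
  by have [/lt_l|/lt_l|//] := ssrnat.ltngtP i j; rewrite E ltxx.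
Qed.

(** All terms but one vanish at [b k], and the remaining product has [k] negative
    factors. *)
Lemma confocal_poly_sign (k : 'I_N.+1) : 0 <= (-1) ^+ k.+1 * (confocal_poly b x).[b k].
Proof.
have -> : (confocal_poly b x).[b k]
    = - (x 0 k ^+ 2 * \prod_(j | j != k) (b j - b k)).
  have subE (c d : R) : (c%:P - 'X).[d] = c - d by rewrite !hornerE.
  rewrite /confocal_poly hornerD hornerN horner_prod (bigD1 k) //= subE subrr mul0r add0r.
  congr (- _); rewrite horner_sum (bigD1 k) //= [X in _ + X]big1 ?addr0 => [|i ik].
    by rewrite hornerZ horner_prod; congr (_ * _); apply: eq_bigr => j _; rewrite subE.
  by rewrite hornerZ horner_prod (bigD1 k) 1?eq_sym //= subE subrr mul0r mulr0.
rewrite exprS mulN1r mulrNN mulrCA; apply: mulr_ge0; first exact: sqr_ge0.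
have -> : (-1) ^+ k = \prod_(j | j != k) (if (j < k)%N then -1 else 1) :> R.
  rewrite -big_mkcondr /= (eq_bigl (fun j : 'I_N.+1 => (j < k)%N)) => [|j]; last first.
    by rewrite andb_idl // => jk; apply: contraTneq jk => ->; rewrite ltnn.
  by rewrite -(big_ord_widen N.+1 (fun=> -1) (ltnW (ltn_ord k))) prodr_const card_ord.
rewrite -big_split /=; apply: prodr_ge0 => j jk.
have [h|h|h] := ssrnat.ltngtP j k.
- by rewrite mulN1r opprB subr_ge0 ltW // lt_b.
- by rewrite mul1r subr_ge0 ltW // lt_b.
- by move: jk; rewrite (val_inj h) eqxx.
Qed.

Let bs k m := [seq b (inord i) | i <- iota k m].

Let sorted_bs k m : (k + m <= N.+1)%N -> sorted <%R (bs k m).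
Proof.
move=> km; apply: (homo_sorted_in (P := [pred i | (i < N.+1)%N]) (e := ltn)).
- by move=> i j iN jN ij; apply: lt_b; rewrite !inordK.
- by apply/allP => i; rewrite mem_iota => /andP[_ h]; apply: leq_trans km.
- exact: iota_ltn_sorted.
Qed.

Let alternates_bs k m : (k + m <= N.+1)%N ->
  alternates (confocal_poly b x) (odd k.+1) (bs k m).
Proof.
elim: m k => [//|m ih] k; rewrite addnS => km.
have kN : (k < N.+1)%N by apply: leq_trans km; rewrite ltnS leq_addr.
apply/andP; split; last exact: (ih k.+1).
by have := confocal_poly_sign (inord k); rewrite inordK // -signr_odd.
Qed.

Let card_lt k : (k <= N.+1)%N -> #|[pred i : 'I_N.+1 | (i < k)%N]| = k.
Proof.
move=> kN; rewrite -sum1_card -(big_ord_widen N.+1 (fun=> 1%N) kN).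
by rewrite sum1_card card_ord.
Qed.

Let card_ge k : (k <= N.+1)%N -> #|[pred i : 'I_N.+1 | (k <= i)%N]| = (N.+1 - k)%N.
Proof.
move=> kN; have := cardC [pred i : 'I_N.+1 | (i < k)%N].
rewrite card_lt // card_ord => E.
rewrite (@eq_card _ _ (predC [pred i : 'I_N.+1 | (i < k)%N])); last first.
  by move=> i; rewrite !inE -leqNgt.
by apply: (@addnI k); rewrite E subnKC.
Qed.

(** Otherwise the polynomial of degree [k] with roots [l i], [i < k], would
    weakly alternate at [b 0], ..., [b k] and a point to the left of everything.
    The weak form is needed since [confocal_poly] vanishes at [b i] when the
    point lies on a coordinate hyperplane. *)
Lemma jacobi_le (k : 'I_N.+1) : l k <= b k.
Proof.
rewrite leNgt; apply/negP => blk.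
pose g : {poly R} := \prod_(i : 'I_N.+1 | (i < k)%N) ((l i)%:P - 'X).
pose h : {poly R} := \prod_(i : 'I_N.+1 | ~~ (i < k)%N) ((l i)%:P - 'X).
have qE : confocal_poly b x = g * h.
  by rewrite confocal_poly_prod (bigID (fun i : 'I_N.+1 => (i < k)%N)).
have szg : size g = k.+1 by rewrite size_prod_subX card_lt // ltnW.
pose y := Num.min (l ord0) (b ord0) - 1.
have yl i : y < l i.
  rewrite /y ltrBlDr gt_min; apply/orP; left.
  case: (posnP i) => [i0|i0]; first by rewrite (_ : i = ord0) ?ltrDl //; apply: val_inj.
  by rewrite (lt_trans (@lt_l ord0 i i0)) ?ltrDl.
have yb i : y < b i.
  rewrite /y ltrBlDr gt_min; apply/orP; right.
  case: (posnP i) => [i0|i0]; first by rewrite (_ : i = ord0) ?ltrDl //; apply: val_inj.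
  by rewrite (lt_trans (@lt_b ord0 i i0)) ?ltrDl.
suff g0 : g = 0 by move: szg; rewrite g0 size_poly0.
apply: (@alternates_eq0 _ g false (y :: bs 0 k.+1)).
- have ally : all (<%R y) (bs 0 k.+1) by apply/allP => _ /mapP[i _ ->]; apply: yb.
  by rewrite [sorted _ _](path_min_sorted ally); exact: (@sorted_bs 0%N k.+1 (ltn_ord k)).
- by rewrite szg /= size_map size_iota.
rewrite -(@alternates_mulr _ g h) -?qE.
  apply/andP; split; last exact: (@alternates_bs 0%N k.+1 (ltn_ord k)).
  rewrite mul1r confocal_poly_prod horner_prod prodr_ge0 // => i _.
  by rewrite !hornerE subr_ge0 ltW.
move=> z zin; have zbk : z <= b k.
  move: zin; rewrite inE => /orP[/eqP->|]; first exact: ltW.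
  case/mapP => i; rewrite mem_iota add0n ltnS /= => ik ->.
  have iN : (i < N.+1)%N by apply: leq_ltn_trans ik _.
  move: ik; rewrite leq_eqVlt => /orP[/eqP->|ik]; first by rewrite inord_val.
  by apply/ltW/lt_b; rewrite inordK.
rewrite horner_prod; apply: prodr_gt0 => i; rewrite -leqNgt !hornerE subr_gt0 => ki.
apply: (le_lt_trans zbk); apply: (lt_le_trans blk).
by move: ki; rewrite leq_eqVlt => /orP[/eqP/val_inj->//|/lt_l/ltW].
Qed.

(** As for [jacobi_le], with the roots [l i], [k' < i], and the points [b k],
    ..., [b ord_max]. *)
Lemma jacobi_ge (k k' : 'I_N.+1) : k.+1 = k' :> nat -> b k <= l k'.
Proof.
move=> kk'; rewrite leNgt; apply/negP => lbk.
pose g : {poly R} := \prod_(i : 'I_N.+1 | (k' < i)%N) ((l i)%:P - 'X).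
pose h : {poly R} := \prod_(i : 'I_N.+1 | ~~ (k' < i)%N) ('X - (l i)%:P).
pose e := #|[pred i : 'I_N.+1 | ~~ (k' < i)%N]|.
have qE : confocal_poly b x = ((-1) ^+ e *: g) * h.
  rewrite confocal_poly_prod (bigID (fun i : 'I_N.+1 => (k' < i)%N)) /=.
  by rewrite [X in _ * X]prod_subX -scalerAr scalerAl.
have szg : size g = (N.+1 - k')%N.
  by rewrite size_prod_subX (card_ge (ltn_ord k')) subnS prednK // subn_gt0.
suff : (-1) ^+ e *: g = 0.
  move/eqP; rewrite scaler_eq0 signr_eq0 /= => /eqP g0.
  by move: szg; rewrite g0 size_poly0 => /esym/eqP; rewrite subn_eq0 leqNgt ltn_ord.
apply: (@alternates_eq0 _ _ (odd k.+1) (bs k (N.+1 - k))).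
- by apply: sorted_bs; rewrite subnKC // ltnW.
- rewrite size_scale ?signr_eq0 // szg size_map size_iota.
  by apply: ltn_sub2l => //; rewrite -kk'.
rewrite -(@alternates_mulr _ _ h) -?qE; first by rewrite alternates_bs // subnKC // ltnW.
move=> z /mapP[i]; rewrite mem_iota subnKC ?(ltnW (ltn_ord k)) // => /andP[ki iN] zE.
have zbk : b k <= z.
  rewrite zE; move: ki; rewrite leq_eqVlt => /orP[/eqP<-|ki]; first by rewrite inord_val.
  by apply/ltW/lt_b; rewrite inordK.
rewrite horner_prod; apply: prodr_gt0 => j; rewrite -leqNgt !hornerE subr_gt0 => jk'.
apply: (lt_le_trans _ zbk); apply: (le_lt_trans _ lbk).
by move: jk'; rewrite leq_eqVlt => /orP[/eqP/val_inj->//|/lt_l/ltW].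
Qed.

End Interlacing.

(** * The order of the ends of the segments *)

Section CountOrd.
Variables (R : realType) (m : nat) (f : 'I_m -> R) (P : pred R).

Lemma count_image_lt k : (forall i, P (f i) -> (i < k)%N) ->
  (count P [seq f i | i : 'I_m] <= k)%N.
Proof.
move=> h; rewrite count_map -size_filter -(size_map (@nat_of_ord m)) -[leqRHS](size_iota 0).
apply: uniq_leq_size; first by rewrite map_inj_uniq ?filter_uniq // -?enumT ?enum_uniq //; apply: ord_inj.
by move=> _ /mapP[i + ->]; rewrite mem_filter mem_iota add0n => /andP[/h].
Qed.

Lemma count_image_ge k : (forall i, P (f i) -> (k <= i)%N) ->
  (count P [seq f i | i : 'I_m] <= m - k)%N.
Proof.
move=> h; rewrite count_map -size_filter -(size_map (@nat_of_ord m)) -[leqRHS](size_iota k).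
apply: uniq_leq_size; first by rewrite map_inj_uniq ?filter_uniq // -?enumT ?enum_uniq //; apply: ord_inj.
move=> _ /mapP[i + ->]; rewrite mem_filter mem_iota => /andP[/h ki _]; rewrite ki /=.
by have := ltn_ord i; lia.
Qed.

Lemma count_image_eq k : (k <= m)%N -> (forall i, P (f i) = (i < k)%N) ->
  count P [seq f i | i : 'I_m] = k.
Proof.
move=> km h; apply/eqP; rewrite eqn_leq count_image_lt /= => [|i]; last by rewrite h.
have := count_predC P [seq f i | i : 'I_m]; rewrite size_image card_ord => E.
have : (count (predC P) [seq f i | i : 'I_m] <= m - k)%N; last by lia.
rewrite count_map -size_filter -(size_map (@nat_of_ord m)) -[leqRHS](size_iota k).
apply: uniq_leq_size; first by rewrite map_inj_uniq ?filter_uniq // -?enumT ?enum_uniq //; apply: ord_inj.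
move=> _ /mapP[i + ->]; rewrite mem_filter mem_iota /= h -leqNgt => /andP[ki _]; rewrite ki /=.
by have := ltn_ord i; lia.
Qed.

End CountOrd.

Section Ends.
Variables (R : realType) (N : nat) (b : 'I_N.+1 -> R) (a : 'I_N -> R).
Hypothesis gen : generic_parameters b a.

Let b_gt0 i : 0 < b i. Proof. by case: gen. Qed.
Let lt_b (i j : 'I_N.+1) : (i < j)%N -> b i < b j. Proof. by case: gen => _ + _ _; apply. Qed.
Let lt_a (i j : 'I_N) : (i < j)%N -> a i < a j. Proof. by case: gen => _ _ + _; apply. Qed.
Let b_neq_a i j : b i != a j. Proof. by case: gen. Qed.
Let le_b (i j : 'I_N.+1) : (i <= j)%N -> b i <= b j.
Proof. by rewrite leq_eqVlt => /orP[/eqP/val_inj->//|/lt_b/ltW]. Qed.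
Let le_a (i j : 'I_N) : (i <= j)%N -> a i <= a j.
Proof. by rewrite leq_eqVlt => /orP[/eqP/val_inj->//|/lt_a/ltW]. Qed.
Let lt_b_index (i j : 'I_N.+1) : b i < b j -> (i < j)%N.
Proof. by move=> h; rewrite ltnNge; apply: contraL h => /le_b; rewrite leNgt. Qed.
Let lt_a_index (i j : 'I_N) : a i < a j -> (i < j)%N.
Proof. by move=> h; rewrite ltnNge; apply: contraL h => /le_a; rewrite leNgt. Qed.

Definition ends : seq R := sort <=%O ([seq b i | i : 'I_N.+1] ++ [seq a j | j : 'I_N]).

Lemma size_ends : size ends = N.*2.+1.
Proof. by rewrite size_sort size_cat !size_image !card_ord -addnn addSn. Qed.

Lemma count_ends P : count P ends
  = (count P [seq b i | i : 'I_N.+1] + count P [seq a j | j : 'I_N])%N.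
Proof. by rewrite /ends (permP (permEl (perm_sort _ _))) count_cat. Qed.

Lemma ends_lt_sorted : sorted <%O ends.
Proof.
have b_inj : injective b.
  move=> i j E; apply/val_inj.
  by have [/lt_b|/lt_b|//] := ssrnat.ltngtP i j; rewrite E ltxx.
have a_inj : injective a.
  move=> i j E; apply/val_inj.
  by have [/lt_a|/lt_a|//] := ssrnat.ltngtP i j; rewrite E ltxx.
rewrite /ends sort_lt_sorted cat_uniq; apply/and3P; split.
- by rewrite map_inj_uniq ?enum_uniq.
- apply/hasPn => x /mapP[j _ ->]; apply/mapP => -[i _ E].
  by have := b_neq_a i j; rewrite E eqxx.
- by rewrite map_inj_uniq ?enum_uniq.
Qed.

Lemma nth_ends v k : v \in ends -> count (< v) ends = k -> nth 0 ends k = v.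
Proof.
move=> vin <-; rewrite -{2}(nth_index 0 vin) -{1}(nth_index 0 vin).
by rewrite count_lt_nth ?ends_lt_sorted ?index_mem.
Qed.

Lemma b_in_ends i : b i \in ends.
Proof. by rewrite mem_sort mem_cat; apply/orP; left; apply/mapP; exists i; rewrite ?mem_enum. Qed.

Lemma a_in_ends j : a j \in ends.
Proof. by rewrite mem_sort mem_cat; apply/orP; right; apply/mapP; exists j; rewrite ?mem_enum. Qed.

Lemma a_gt0 j : 0 <= nth 0 ends 0 -> a j != 0 -> 0 < a j.
Proof.
move=> end_ge0 a_neq0; rewrite lt_neqAle eq_sym a_neq0 /=.
have /(nthP 0)[k ks <-] := a_in_ends j.
apply: le_trans end_ge0 _; case: k ks => [//|k] ks; apply: ltW.
by rewrite (lt_sorted_ltn_nth 0 ends_lt_sorted) ?inE // size_ends.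
Qed.

(* A coordinate takes the values at both ends of its segment, and it stays
   between two neighbouring [b i]; whence the following two bounds. *)
Hypothesis end_le_b : forall i : 'I_N.+1, nth 0 ends i.*2 <= b i.
Hypothesis b_le_end : forall i : 'I_N.+1, (i < N)%N -> b i <= nth 0 ends i.*2.+1.

(** At least [2 i + 1] ends are at most [b i]; if [a j] were greater, at most
    [i + 1] of the [b k] and [j] of the [a k] could be among them. *)
Lemma a_lt_b (j : 'I_N) (i : 'I_N.+1) : (j < i)%N -> a j < b i.
Proof.
move=> ji; rewrite lt_neqAle eq_sym b_neq_a leNgt; apply/negP => bi_aj.
have h1 : (i.*2 < count (<= b i)%O ends)%N.
  rewrite -(@count_le_nth _ _ 0 ends i.*2 ends_lt_sorted); last first.
    by rewrite size_ends ltnS leq_double -ltnS.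
  by apply: sub_count => x /= /le_trans; apply.
have h2 : (count (<= b i)%O [seq b k | k : 'I_N.+1] <= i.+1)%N.
  by apply: count_image_lt => k /=; rewrite leNgt => h; rewrite ltnS leqNgt; apply: contra h => /lt_b.
have h3 : (count (<= b i)%O [seq a k | k : 'I_N] <= j)%N.
  by apply: count_image_lt => k /= h; apply: lt_a_index; apply: le_lt_trans h _.
move: h1 h2 h3; rewrite count_ends -addnn; move: (count _ _) (count _ _) => u v.
move: ji; move: (nat_of_ord i) (nat_of_ord j) => p q; lia.
Qed.

(** At most [2 i + 1] ends are less than [b i]; if [a j] were among them, so
    would be [i] of the [b k] and more than [i + 1] of the [a k]. *)
Lemma b_lt_a (i : 'I_N.+1) (j : 'I_N) : (i < j)%N -> b i < a j.
Proof.
move=> ij; rewrite lt_neqAle b_neq_a leNgt; apply/negP => aj_bi.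
have iN : (i < N)%N by apply: ltn_trans ij _.
have i2 : (i.*2.+1 < size ends)%N by rewrite size_ends ltnS ltn_double.
have h1 : (count (< b i)%O ends <= i.*2.+1)%N.
  rewrite -[leqRHS](@count_lt_nth _ _ 0 ends i.*2.+1 ends_lt_sorted) //.
  apply: sub_count => x /= /lt_le_trans; apply; exact: b_le_end.
have h2 : count (< b i)%O [seq b k | k : 'I_N.+1] = i.
  apply: count_image_eq; first exact: ltnW.
  by move=> k /=; apply/idP/idP => [/lt_b_index|/lt_b].
have h3 : (i.+2 <= count (< b i)%O [seq a k | k : 'I_N])%N.
  have := count_predC (< b i)%O [seq a k | k : 'I_N].
  rewrite size_image card_ord => E.
  have : (count (predC (< b i)%O) [seq a k | k : 'I_N] <= N - j.+1)%N.
    apply: count_image_ge => k /=; rewrite -leNgt => h.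
    by apply: lt_a_index; apply: lt_le_trans h.
  by have := ltn_ord j; lia.
move: h1 h3; rewrite count_ends h2 -addnn; move: (count _ _) => v.
by move: (nat_of_ord i) => q; lia.
Qed.

Lemma nth_ends_min (j : 'I_N) : nth 0 ends j.*2 = Num.min (b (lift ord_max j)) (a j).
Proof.
have jE : (lift ord_max j : 'I_N.+1) = j :> nat by rewrite /= /bump leqNgt ltn_ord.
apply: nth_ends; first by rewrite minEle; case: ifP => _; rewrite ?b_in_ends ?a_in_ends.
rewrite count_ends -addnn; congr (_ + _)%N; apply: count_image_eq; try exact: ltnW.
- by rewrite -jE; apply: ltnW.
- move=> i /=; rewrite lt_min; apply/andP/idP => [[/lt_b_index + _]|ij]; first by rewrite jE.
  by split; [apply: lt_b; rewrite jE|apply: b_lt_a].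
- move=> i /=; rewrite lt_min; apply/andP/idP => [[_ /lt_a_index]//|ij].
  by split; [apply: a_lt_b; rewrite jE|apply: lt_a].
Qed.

Lemma nth_ends_max (j : 'I_N) : nth 0 ends j.*2.+1 = Num.max (b (lift ord_max j)) (a j).
Proof.
have jE : (lift ord_max j : 'I_N.+1) = j :> nat by rewrite /= /bump leqNgt ltn_ord.
have jN := ltn_ord j.
apply: nth_ends; first by rewrite maxEle; case: ifP => _; rewrite ?b_in_ends ?a_in_ends.
set v := Num.max _ _.
have -> : j.*2.+1 = (j + (b (lift ord_max j) < a j)%R + (j + (a j < b (lift ord_max j))%R))%N.
  have := b_neq_a (lift ord_max j) j; rewrite neq_lt.
  by rewrite -addnn; case: ltgtP => //; lia.
rewrite count_ends; congr (_ + _)%N; apply: count_image_eq.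
- by move: jN; case: (_ < _); lia.
- move=> i /=; rewrite lt_max; have [ij|ij|ij] := ssrnat.ltngtP i j.
  + by rewrite lt_b ?jE //; lia.
  + have -> : b i < b (lift ord_max j) = false.
      by apply/negbTE; rewrite -leNgt le_b // jE ltnW.
    have -> : b i < a j = false by apply/negbTE; rewrite -leNgt ltW // a_lt_b.
    by case: (_ < _); lia.
  + have -> : i = lift ord_max j by apply: ord_inj; rewrite jE.
    by rewrite ltxx jE; case: (_ < _); lia.
- by move: jN; case: (_ < _); lia.
- move=> i /=; rewrite lt_max; have [ij|ij|ij] := ssrnat.ltngtP i j.
  + by rewrite (lt_a ij) orbT; lia.
  + have -> : a i < a j = false by apply/negbTE; rewrite -leNgt le_a // ltnW.
    have -> : a i < b (lift ord_max j) = false.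
      by apply/negbTE; rewrite -leNgt ltW // b_lt_a // jE.
    by case: (_ < _); lia.
  + by rewrite (val_inj ij) ltxx orbF; case: (_ < _); lia.
Qed.

Lemma nth_ends_last : nth 0 ends N.*2 = b ord_max.
Proof.
apply: nth_ends; first exact: b_in_ends.
rewrite count_ends -addnn; congr (_ + _)%N; apply: count_image_eq => //.
- by move=> i; apply/idP/idP => [/lt_b_index|/(@lt_b i ord_max)].
- by move=> i /=; rewrite ltn_ord a_lt_b.
Qed.

End Ends.

(** * Turns of a Jacobi coordinate *)

Section Turns.
Variables (R : realType) (f : R -> R) (lo hi : R) (n m : nat) (s : nat -> R).
Hypothesis s_lt : forall i, (i < m.*2)%N -> s i < s i.+1.
Hypothesis s_end : s m.*2 = s 0%N + n%:R.
Hypothesis f_start : f (s 0%N) = lo.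
Hypothesis f_turn : forall i, (i < m)%N ->
  [/\ f (s i.*2.+1) = hi, f (s i.*2.+2) = lo,
      {in `[s i.*2, s i.*2.+1] &, {homo f : u v / u <= v}} &
      {in `[s i.*2.+1, s i.*2.+2] &, {homo f : u v /~ u <= v}}].

Lemma turns_lt i j : (i < j)%N -> (j <= m.*2)%N -> s i < s j.
Proof.
elim: j => [//|j ih]; rewrite ltnS leq_eqVlt => /orP[/eqP->|ij] jm; first exact: s_lt.
by apply: lt_trans (ih ij (ltnW jm)) (s_lt jm).
Qed.

Lemma turns_le i j : (i <= j)%N -> (j <= m.*2)%N -> s i <= s j.
Proof. by rewrite leq_eqVlt => /orP[/eqP->//|ij] jm; apply/ltW/turns_lt. Qed.

Lemma turns_lo i : (i <= m)%N -> f (s i.*2) = lo.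
Proof. by case: i => [//|i] im; have [_ + _ _] := f_turn im; rewrite doubleS. Qed.

Lemma turns_locate t : s 0%N <= t < s 0%N + n%:R -> exists2 i, (i < m)%N &
  s i.*2 <= t <= s i.*2.+1 \/ s i.*2.+1 < t < s i.*2.+2.
Proof.
rewrite -s_end => /andP[t0].
have loc k : t < s k.*2 -> exists2 i, (i < k)%N &
    s i.*2 <= t <= s i.*2.+1 \/ s i.*2.+1 < t < s i.*2.+2.
  elim: k => [|k ih] tk; first by move: t0; rewrite leNgt tk.
  rewrite doubleS in tk; have [/ih[i ik h]|t2k] := ltP t (s k.*2).
    by exists i => //; apply: leqW.
  exists k => //; have [t1|t1] := leP t (s k.*2.+1); first by left; rewrite t2k.
  by right; apply/andP; split.
exact: loc.
Qed.

Lemma turns_range t : s 0%N <= t < s 0%N + n%:R -> lo <= f t <= hi.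
Proof.
move=> /turns_locate[i im]; have [f1 f2 up down] := f_turn im.
have f0 := turns_lo (ltnW im).
have lt1 : s i.*2 < s i.*2.+1 by apply: s_lt; rewrite ltn_double.
have lt2 : s i.*2.+1 < s i.*2.+2 by apply: s_lt; rewrite ltn_Sdouble.
case=> /andP[h1 h2].
  by rewrite -{1}f0 -f1; apply/andP; split; apply: up => //; rewrite in_itv /= ?lexx ?h1 ?h2 ?(ltW lt1).
by rewrite -{1}f2 -f1; apply/andP; split; apply: down; rewrite ?in_itv /= ?lexx ?(ltW h1) ?(ltW h2) ?(ltW lt2).
Qed.

(** By monotony, a visit of [lo] at another time than those listed would
    last for an interval of time. *)
Lemma turns_visit t : s 0%N <= t < s 0%N + n%:R -> f t = lo ->
  t \in [seq s i.*2 | i <- iota 0 m] \/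
  exists u v, [/\ s 0%N <= u, u < v & forall w, u <= w <= v -> f w = lo].
Proof.
move=> /turns_locate[i im]; have [f1 f2 up down] := f_turn im.
have f0 := turns_lo (ltnW im).
have lt1 : s i.*2 < s i.*2.+1 by apply: s_lt; rewrite ltn_double.
have lt2 : s i.*2.+1 < s i.*2.+2 by apply: s_lt; rewrite ltn_Sdouble.
have le0 : s 0%N <= s i.*2 by apply: turns_le; rewrite // leq_double ltnW.
move=> tin ft; case: tin => /andP[h1 h2].
  move: h1; rewrite le_eqVlt => /orP[/eqP<-|h1].
    by left; apply/mapP; exists i; rewrite // mem_iota add0n.
  right; exists (s i.*2), t; split => // w /andP[w1 w2].
  apply: le_anti; apply/andP; split.
    by rewrite -ft; apply: up => //; rewrite in_itv /= ?w1 ?(ltW h1) ?h2 ?(le_trans w2).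
  by rewrite -f0; apply: up => //; rewrite in_itv /= ?lexx ?w1 ?(ltW lt1) ?(le_trans w2).
right; exists t, (s i.*2.+2); split => //.
  by rewrite (le_trans le0) // ltW // (lt_trans lt1).
move=> w /andP[w1 w2]; apply: le_anti; apply/andP; split.
  by rewrite -ft; apply: down => //; rewrite in_itv /= ?w2 ?(ltW h1) ?(ltW h2) ?(le_trans (ltW h1)).
by rewrite -f2; apply: down => //; rewrite in_itv /= ?lexx ?w2 ?(ltW lt2) ?(le_trans (ltW h1)).
Qed.

End Turns.

(** * The signature of a periodic trajectory *)

Lemma jacobi_unique (R : realType) (N : nat) (b : 'I_N.+1 -> R) x
  (l l' : 'I_N.+1 -> R) : jacobi_coordinates b x l -> jacobi_coordinates b x l' ->
  forall i, l i = l' i.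
Proof.
move=> jac jac'; pose L k := [seq (k (inord i : 'I_N.+1) : R) | i <- iota 0 N.+1].
have sorted_L k : jacobi_coordinates b x k -> sorted <%R (L k).
  move=> [lt_k _]; apply: (homo_sorted_in (P := [pred i | (i < N.+1)%N]) (e := ltn)).
  - by move=> i j iN jN ij; apply: lt_k; rewrite !inordK.
  - by apply/allP => i; rewrite mem_iota.
  - exact: iota_ltn_sorted.
have mem_L k z : jacobi_coordinates b x k -> (z \in L k) = root (confocal_poly b x) z.
  move=> jk; rewrite (confocal_poly_prod jk); apply/mapP/rootP => [[i _ ->]|].
    by rewrite horner_prod (bigD1 (inord i)) //= !hornerE subrr mul0r.
  rewrite horner_prod => /eqP/prodf_eq0[i _]; rewrite !hornerE subr_eq0 => /eqP <-.
  by exists (val i); rewrite ?inord_val // mem_iota ltn_ord.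
have LE : L l = L l'.
  apply: lt_sorted_eq; rewrite ?sorted_L // => z.
  by rewrite !mem_L.
move=> i; have := congr1 (nth 0 ^~ i) LE.
by rewrite /L !(nth_map 0%N) ?size_iota ?nth_iota // add0n inord_val.
Qed.

Section Intervals.
Variables (R : realType) (N : nat).
Implicit Types (b : 'I_N.+1 -> R) (a : 'I_N -> R) (m : 'I_N.+1 -> nat).

Definition low_end b a : 'I_N.+1 -> R :=
  fill ord_max 0 (fun j => Num.min (b (lift ord_max j))^-1 (a j)^-1).

Definition high_end b a : 'I_N.+1 -> R :=
  fill ord_max (b ord_max)^-1 (fun j => Num.max (b (lift ord_max j))^-1 (a j)^-1).

Definition next_winding m (i : 'I_N.+1) : nat :=
  if (i < N)%N then m (inord i.+1) else 0%N.

(** The zeros gained from the lower to the upper end of an interval, less the one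
    that may be due to the choice of the solutions. *)
Definition signature m (i : 'I_N.+1) : nat := (m i - next_winding m i - 1)%N.

Lemma fill_max (A : Type) (f : A) (g : 'I_N -> A) : fill ord_max f g ord_max = f.
Proof. by rewrite /fill unlift_none. Qed.

Lemma fill_lift (A : Type) (f : A) (g : 'I_N -> A) j :
  fill ord_max f g (lift ord_max j) = g j.
Proof. by rewrite /fill liftK. Qed.

Lemma Delta_edges b a :
  Delta (low_end b a) (high_end b a) = \prod_(z <- edges b a) ('X - z%:P).
Proof.
rewrite /Delta (bigD1_ord ord_max) //= /low_end /high_end !fill_max.
rewrite /edges big_cons big_cat !big_image /= -mulrA; congr (_ * _).
rewrite [in RHS](bigD1_ord ord_max) //= -mulrA; congr (_ * _).
rewrite -big_split; apply: eq_bigr => j _ /=; rewrite !fill_lift.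
by case: leP => _; rewrite // mulrC.
Qed.

(** The numbers of zeros gained telescope. *)
Lemma sum_next_winding m : (\sum_i m i = m ord0 + \sum_i next_winding m i)%N.
Proof.
rewrite big_ord_recl; congr (_ + _)%N.
rewrite [RHS]big_ord_recr /= {2}/next_winding ltnn addn0.
apply: eq_bigr => i _; rewrite /next_winding /= ltn_ord; congr m.
by apply: val_inj; rewrite /= inordK // ltnS.
Qed.

End Intervals.

Section SingleTrajectory.
Variables (R : realType) (N : nat) (b : 'I_N.+1 -> R) (a : 'I_N -> R).
Hypothesis gen : generic_parameters b a.
Variables (p : nat -> 'rV[R]_N.+1) (n : nat) (m : 'I_N.+1 -> nat).
Hypothesis traj : billiard_trajectory b p.
Hypothesis caust : forall j, caustic b (a j) p.
Hypothesis periodic : forall k, p (k + n.+1)%N = p k.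
Hypothesis wind : winding_numbers b a p n.+1 m.
Hypothesis m0 : m ord0 = n.+1.

Let b_gt0 i : 0 < b i. Proof. by case: gen. Qed.
Let lt_b (i j : 'I_N.+1) : (i < j)%N -> b i < b j. Proof. by case: gen => _ + _ _; apply. Qed.
Let a_neq0 j : a j != 0. Proof. exact: (caustic_neq0 gen traj caust). Qed.

Local Notation S := (ends b a).

Let segE k : nth 0 (segment_ends b a) k.+1 = nth 0 S k. Proof. by []. Qed.

Let seg_lo i := nth 0 (segment_ends b a) i.*2.
Let seg_hi i := nth 0 (segment_ends b a) i.*2.+1.

(** No winding number vanishes, as time passes before the coordinate is back at
    the lower end of its segment. *)
Let windP : exists (l : 'I_N.+1 -> R -> R) (s : 'I_N.+1 -> nat -> R),
  (forall t, 0 <= t -> jacobi_coordinates b (trajectory_point p t) (l^~ t)) /\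
  forall i, [/\ (0 < m i)%N, 0 <= s i 0%N,
    forall k, (k < (m i).*2)%N -> s i k < s i k.+1,
    s i (m i).*2 = s i 0%N + n.+1%:R &
    l i (s i 0%N) = seg_lo i /\ forall k, (k < m i)%N ->
        [/\ l i (s i k.*2.+1) = seg_hi i, l i (s i k.*2.+2) = seg_lo i,
            {in `[s i k.*2, s i k.*2.+1] &, {homo l i : u v / u <= v}} &
            {in `[s i k.*2.+1, s i k.*2.+2] &, {homo l i : u v /~ u <= v}}]].
Proof.
have [l [jac turns]] := wind; have [s sP] := choice turns.
exists l, s; split => // i; have [s0 s_lt s_end [st tu]] := sP i.
split => //; rewrite lt0n; apply/eqP => mi0.
move: s_end; rewrite mi0 => /eqP; rewrite -subr_eq0 opprD addrA subrr add0r oppr_eq0.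
by rewrite pnatr_eq0.
Qed.

Let end_ge0 : 0 <= nth 0 S 0.
Proof.
have [l [s [jac /(_ ord0)[mi s0 s_lt s_end [st /(_ 0%N mi)[hi _ up _]]]]]] := windP.
have lt01 : s ord0 0%N < s ord0 1%N by apply: s_lt; rewrite double_gt0.
have -> : nth 0 S 0 = l ord0 (s ord0 1%N) by rewrite hi.
have -> : 0 = l ord0 (s ord0 0%N) by rewrite st.
by apply: up; rewrite ?in_itv /= ?lexx ltW.
Qed.

Let end_le_b (i : 'I_N.+1) : nth 0 S i.*2 <= b i.
Proof.
have [l [s [jac /(_ i)[mi s0 s_lt s_end [st /(_ 0%N mi)[hi _ _ _]]]]]] := windP.
have lt01 : s i 0%N < s i 1%N by apply: s_lt; rewrite double_gt0.
have -> : nth 0 S i.*2 = l i (s i 1%N) by rewrite hi.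
apply: (jacobi_le lt_b (jac _ _)).
by apply: le_trans s0 (ltW _).
Qed.

Let b_le_end (i : 'I_N.+1) : (i < N)%N -> b i <= nth 0 S i.*2.+1.
Proof.
move=> iN; pose i' : 'I_N.+1 := inord i.+1.
have i'E : i' = i.+1 :> nat by rewrite inordK.
have [l [s [jac /(_ i')[mi s0 s_lt s_end [st _]]]]] := windP.
have -> : nth 0 S i.*2.+1 = l i' (s i' 0%N) by rewrite st /seg_lo i'E doubleS.
exact: (jacobi_ge lt_b (jac _ s0)).
Qed.

Let ends_sorted := ends_lt_sorted gen.

Let ends_gt0 k : (k < N.*2.+1)%N -> 0 < nth 0 S k.
Proof.
move=> kN; have : nth 0 S k \in S by rewrite mem_nth // size_ends.
rewrite mem_sort mem_cat => /orP[/mapP[i _ ->]//|/mapP[j _ ->]].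
exact: (a_gt0 gen end_ge0 (a_neq0 j)).
Qed.

Let ends_lt k k' : (k < k')%N -> (k' < N.*2.+1)%N -> nth 0 S k < nth 0 S k'.
Proof.
move=> kk' k'N; rewrite (lt_sorted_ltn_nth 0 ends_sorted) ?inE ?size_ends //.
exact: ltn_trans kk' k'N.
Qed.

Let seg_lt k k' : (k < k')%N -> (k' < N.*2.+2)%N ->
  nth 0 (segment_ends b a) k < nth 0 (segment_ends b a) k'.
Proof.
case: k' => [//|k']; rewrite !ltnS => kk' k'N; rewrite segE.
case: k kk' => [|k] kk'; first exact: ends_gt0.
by rewrite segE; apply: ends_lt.
Qed.

(** The winding numbers describe a coordinate over one period only; by
    periodicity it is confined to its segment at all times. *)
Let range (l : 'I_N.+1 -> R -> R) (s : 'I_N.+1 -> nat -> R) :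
  (forall t, 0 <= t -> jacobi_coordinates b (trajectory_point p t) (l^~ t)) ->
  (forall (i : 'I_N.+1) (t : R), s i 0%N <= t < s i 0%N + n.+1%:R -> seg_lo i <= l i t <= seg_hi i) ->
  (forall i, 0 <= s i 0%N) ->
  forall (i : 'I_N.+1) (t : R), 0 <= t -> seg_lo i <= l i t <= seg_hi i.
Proof.
move=> jac rng s0 i t t0.
have [u [j [k [u0 tE win]]]] := window_shift n t0 (s0 i).
have shift q : trajectory_point p (u + (q * n.+1)%:R) = trajectory_point p u.
  elim: q => [|q ih]; first by rewrite addr0.
  rewrite -{}ih mulSnr natrD addrA.
  have : 0 <= u + (q * n.+1)%:R by rewrite addr_ge0.
  move: (u + _) => v v0; rewrite /trajectory_point truncnD_nat // -addSn !periodic.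
  by congr (_ + _ *: _); rewrite natrD; ring.
rewrite tE; have uj : 0 <= u + (j * n.+1)%:R by rewrite addr_ge0.
have uk : 0 <= u + (k * n.+1)%:R by rewrite addr_ge0.
have jac1 := jac _ uj; have jac2 := jac _ uk; rewrite !shift in jac1 jac2.
by rewrite (jacobi_unique jac1 jac2 i); apply: rng.
Qed.

Let edge_of_end k : (k < N.*2.+1)%N -> (nth 0 S k)^-1 \in edges b a /\ (nth 0 S k)^-1 != 0.
Proof.
move=> kN; split; last by rewrite invr_eq0 gt_eqF ?ends_gt0.
have : nth 0 S k \in S by rewrite mem_nth // size_ends.
rewrite mem_sort inE mem_cat => /[!mem_cat]/orP[/mapP[i _ ->]|/mapP[j _ ->]].
  by apply/or3P/Or32; apply/mapP; exists i; rewrite ?mem_enum.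
by apply/or3P/Or33; apply/mapP; exists j; rewrite ?mem_enum.
Qed.

Local Notation solution z v := (fun k => (motion (len p) (kick b p) z v k).1).

(** A solution at the top end of a segment vanishes at each visit of that end. *)
Let top_solution i : exists2 v, v != (0, 0) &
  (m i <= crossings (solution (seg_hi i)^-1 v) n.+1)%N.
Proof.
have iN : (i.*2 < N.*2.+1)%N by rewrite ltnS leq_double -ltnS.
have [zE z0] := edge_of_end iN.
have [v [f [-> [v0 f_neq0 f_sqr f_mul rootE]]]] := edge_solution gen traj caust periodic zE z0.
exists v => //; rewrite -/(seg_hi i).
have [l [s [jac /(_ i)[mi s0 s_lt s_end [st tu]]]]] := windP.
rewrite -[leqLHS](size_iota 0) -(size_map (fun k => s i k.*2.+1)).
apply: (crossings_ge f_neq0 f_sqr f_mul s0).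
  rewrite map_inj_in_uniq ?iota_uniq // => j k.
  rewrite !mem_iota !add0n => /andP[_ jm] /andP[_ km] E; apply/eqP; rewrite eqn_leq.
  have lt_s := turns_lt s_lt.
  apply/andP; split; rewrite leqNgt; apply/negP => h.
    have := lt_s k.*2.+1 j.*2.+1; rewrite E ltxx ltnS ltn_double => /(_ h).
    by rewrite ltn_double jm => /(_ isT).
  have := lt_s j.*2.+1 k.*2.+1; rewrite E ltxx ltnS ltn_double => /(_ h).
  by rewrite ltn_double km => /(_ isT).
move=> _ /mapP[k + ->]; rewrite mem_iota add0n => /andP[_ km].
have k2 : (k.*2.+1 < (m i).*2)%N by rewrite ltn_Sdouble.
have t0 : s i 0%N <= s i k.*2.+1 by apply: (turns_le s_lt) => //; apply: ltnW.
rewrite t0 -s_end (turns_lt s_lt k2) //; split => //.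
apply/eqP; rewrite -rootE invrK.
have [hi _ _ _] := tu _ km; have ge0 := le_trans s0 t0.
by have [_ /(_ i)] := jac _ ge0; rewrite /= hi.
Qed.

(** A solution at the bottom end of a segment vanishes only at the visits of
    that end, since the other coordinates never leave their own segments. *)
Let bottom_solution (i : 'I_N.+1) : (0 < i)%N -> exists2 v, v != (0, 0) &
  (crossings (solution (seg_lo i)^-1 v) n.+1 <= m i)%N.
Proof.
move=> i_gt0; have iN : (i.*2.-1 < N.*2.+1)%N.
  by have := ltn_ord i; move: i_gt0; move: (nat_of_ord i) => k; lia.
have [zE z0] := edge_of_end iN.
have [v [f [-> [v0 f_neq0 f_sqr f_mul rootE]]]] := edge_solution gen traj caust periodic zE z0.
have loE : seg_lo i = nth 0 S i.*2.-1.
  by rewrite /seg_lo -[i.*2 in LHS]prednK ?double_gt0.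
exists v => //; rewrite loE.
have [l [s [jac sP]]] := windP.
have ranges : forall (k : 'I_N.+1) (t : R), 0 <= t -> seg_lo k <= l k t <= seg_hi k.
  apply: (range jac (s := s)) => [k t|k]; last by have [] := sP k.
  have [mk _ s_lt s_end [st tu]] := sP k.
  exact: (turns_range s_lt s_end st tu).
have [mi s0 s_lt s_end [st tu]] := sP i.
rewrite -[leqRHS](size_iota 0) -(size_map (fun k => s i k.*2)).
have at_lo t : 0 <= t -> piecewise (solution (nth 0 S i.*2.-1)^-1 v) t = 0 <-> l i t = seg_lo i.
  move=> t0; split => [/eqP|E].
    rewrite -rootE invrK (confocal_poly_prod (jac _ t0)) /root horner_prod.
    move=> /prodf_eq0[k _]; rewrite !hornerE subr_eq0 -loE => /eqP E.
    suff ki : k = i by rewrite -E ki.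
    have /andP[h1 h2] := ranges k t t0; rewrite E in h1 h2.
    have [ki|ik|/val_inj//] := ssrnat.ltngtP k i.
      move: h2; rewrite leNgt /seg_hi /seg_lo seg_lt //.
        by rewrite ltn_Sdouble.
      by rewrite ltnS ltnW // ltnS leq_double -ltnS.
    move: h1; rewrite leNgt /seg_lo seg_lt //; first by rewrite ltn_double.
    by rewrite ltnS ltnW // ltnS leq_double -ltnS.
  apply/eqP; rewrite -rootE invrK -loE -E.
  by have [_ /(_ i)] := jac _ t0.
apply: (crossings_le f_sqr f_mul s0) => t win ft.
have t0 : 0 <= t by case/andP: win => h _; apply: le_trans h.
have lt := (at_lo t t0).1 ft.
have [//|[u [w [su uw const]]]] := turns_visit s_lt s_end st tu win lt.
case: (piecewise_neq0 f_neq0 (le_trans s0 su) uw) => z /andP[uz zw].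
have z_ge0 : 0 <= z by apply: le_trans uz; apply: le_trans s0 su.
by apply/(at_lo z z_ge0)/const; rewrite uz zw.
Qed.

Let nat_lift j : (lift ord_max j : 'I_N.+1) = j :> nat.
Proof. by rewrite /= /bump leqNgt ltn_ord. Qed.

Let high_endE i : high_end b a i = (seg_hi i)^-1.
Proof.
rewrite /high_end /seg_hi segE; case: (unliftP ord_max i) => [j ->|->].
  rewrite fill_lift nat_lift (nth_ends_min gen end_le_b b_le_end) //.
  have := b_gt0 (lift ord_max j); have := a_gt0 gen end_ge0 (a_neq0 j).
  move: (b _) (a j) => x y y0 x0; rewrite /Num.max /Num.min ltf_pV2 //.
  by case: ltgtP => // ->.
by rewrite fill_max (nth_ends_last gen end_le_b).
Qed.

Let low_end_lt (i i' : 'I_N.+1) : i.+1 = i' :> nat -> low_end b a i = (seg_lo i')^-1.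
Proof.
move=> ii'; rewrite /low_end /seg_lo -ii' doubleS segE.
case: (unliftP ord_max i) ii' => [j ->|->] ii'; last first.
  by have := ltn_ord i'; rewrite -ii' ltnn.
rewrite fill_lift nat_lift (nth_ends_max gen end_le_b b_le_end) //.
have := b_gt0 (lift ord_max j); have := a_gt0 gen end_ge0 (a_neq0 j).
move: (b _) (a j) => x y y0 x0; rewrite /Num.max /Num.min ltf_pV2 //.
by case: ltgtP => // ->.
Qed.

Let seg_gt0 k : (0 < k)%N -> (k < N.*2.+2)%N -> 0 < nth 0 (segment_ends b a) k.
Proof. by case: k => [//|k] _ kN; rewrite segE ends_gt0. Qed.

Let low_high i : low_end b a i < high_end b a i.
Proof.
have i2 : (i.*2.+1 < N.*2.+2)%N by rewrite !ltnS leq_double -ltnS.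
rewrite high_endE; have [iN|Ni] := ltnP i N.
  have i'E : (inord i.+1 : 'I_N.+1) = i.+1 :> nat by rewrite inordK.
  rewrite (@low_end_lt i (inord i.+1)) // /seg_lo /seg_hi i'E.
  have i3 : (i.+1.*2 < N.*2.+2)%N by rewrite -doubleS ltn_double ltnS.
  rewrite ltf_pV2 ?posrE ?seg_gt0 //.
  by apply: seg_lt; rewrite // doubleS.
have -> : i = ord_max by apply: val_inj; apply/eqP; rewrite eqn_leq Ni -ltnS ltn_ord.
by rewrite /low_end fill_max invr_gt0 seg_gt0.
Qed.

Let intervals : interval_system (low_end b a) (high_end b a).
Proof.
split=> [|i j ij]; first exact: low_high.
have iN : (i < N)%N by apply: leq_trans ij _; rewrite -ltnS.
have i'E : (inord i.+1 : 'I_N.+1) = i.+1 :> nat by rewrite inordK.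
rewrite high_endE (@low_end_lt i (inord i.+1)) // /seg_lo /seg_hi i'E.
have jN : (j.*2.+1 < N.*2.+2)%N by rewrite !ltnS leq_double -ltnS.
have i3 : (i.+1.*2 < j.*2.+1)%N by rewrite ltnS leq_double.
rewrite ltf_pV2 ?posrE ?seg_gt0 ?double_gt0 //; last exact: ltn_trans jN.
exact: seg_lt.
Qed.

Lemma caustic_gt0 j : 0 < a j.
Proof. exact: (a_gt0 gen end_ge0 (a_neq0 j)). Qed.

(** Each interval contains enough roots of [Q], since solutions of the string
    equation at its two ends have different numbers of zeros; the degree of [Q]
    leaves room for no more.  The factor [Num.sqrt c] normalizes the
    discriminant to [Delta]. *)
Theorem trajectory_pell : exists P Q,
  pell_solution (low_end b a) (high_end b a) n.+1 (signature m) P Q.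
Proof.
have [Q0 [dirQ pell0]] := billiard_pell gen traj caust periodic.
have [c c0 discE] := discriminant_prod gen traj caust.
set P := _ *: _ in pell0.
pose Q := Num.sqrt c *: Q0.
have szP : size P = n.+2.
  apply: size_half_trace => k; first exact: (lt0r_neq0 (len_gt0 traj k)).
  exact: (kick_neq0 gen traj k).
clearbody P; have pell : P ^+ 2 - Delta (low_end b a) (high_end b a) * Q ^+ 2 = 1.
  rewrite Delta_edges -[RHS]pell0 discE /Q exprZn sqr_sqrtr ?ltW //.
  by rewrite -scalerAl -scalerAr.
have P0 : P != 0 by rewrite -size_poly_gt0 szP.
have Q_neq0 : Q != 0.
  apply/eqP => Q0'; move: pell; rewrite Q0' expr0n mulr0 subr0 => /(congr1 (fun q : {poly R} => size q)).
  by rewrite my_size_exp // szP size_poly1.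
have szQ : (size Q + N = n.+1)%N.
  have szD : size (Delta (low_end b a) (high_end b a)) = N.*2.+3.
    by rewrite Delta_edges size_prod_XsubC size_edges.
  have D0 : Delta (low_end b a) (high_end b a) != 0 by rewrite -size_poly_gt0 szD.
  have Q2 : Q ^+ 2 != 0 by rewrite expf_neq0.
  have : size (P ^+ 2) = size (1 + Delta (low_end b a) (high_end b a) * Q ^+ 2).
    by rewrite -pell subrK.
  rewrite my_size_exp // szP addrC size_polyDl; last first.
    by rewrite size_poly1 size_mul // szD my_size_exp.
  rewrite size_mul // szD my_size_exp //; move: Q_neq0; rewrite -size_poly_gt0.
  by move: (size Q) => q; rewrite -!muln2; lia.
have roots_ge i :
    (m i <= next_winding m i + (size (roots Q (low_end b a i) (high_end b a i))).+1)%N.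
  have [v2 v20 top] := top_solution i.
  have [v1 v10 bot] : exists2 v, v != (0, 0) &
      (crossings (solution (low_end b a i) v) n.+1 <= next_winding m i)%N.
    rewrite /next_winding; have [iN|Ni] := ltnP i N.
      have i'E : (inord i.+1 : 'I_N.+1) = i.+1 :> nat by rewrite inordK.
      rewrite (@low_end_lt i (inord i.+1)) //.
      by apply: bottom_solution; rewrite i'E.
    have -> : i = ord_max by apply: val_inj; apply/eqP; rewrite eqn_leq Ni -ltnS ltn_ord.
    (* the last interval starts at [s = 0], where the beads have no effect and
       the constant solution has no zeros *)
    exists (1, 0); first by rewrite xpair_eqE oner_eq0.
    have const k : motion (len p) (kick b p) 0 (1, 0) k = (1, 0).
      by elim: k => [//|k ih]; rewrite motionS ih /= !mulr0 mul0r addr0 subr0.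
    rewrite /low_end fill_max /crossings big1 // => k _.
    by rewrite !const /crossing /= oner_eq0 mul1r ltr10.
  have le_roots : (size (roots (motion_poly (len p) (kick b p) (0%R, 1%R) n.+1).1
        (low_end b a i) (high_end b a i))
      <= size (roots Q (low_end b a i) (high_end b a i)))%N.
    apply: uniq_leq_size; first exact: uniq_roots.
    move=> z zr; have zi := roots_in zr; apply: root_in_roots => //.
    have /rootP := root_roots zr; rewrite dirQ hornerM => /eqP; rewrite mulf_eq0.
    case/orP => [/eqP Az|Qz]; last by rewrite /Q rootZ // gt_eqF // sqrtr_gt0.
    (* where [A 0] vanishes the discriminant is a square, but it is negative
       inside the intervals *)
    have : (discriminant b p).[z] < 0.
      rewrite discE hornerZ -Delta_edges pmulr_rlt0 //.
      by apply: (Delta_lt0 (j := i) intervals); move: zi; rewrite in_itv.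
    rewrite ltNge => /negP[]; rewrite /discriminant; move: Az.
    move: (point_form b p 0) (mixed_form b p 0) (dir_form b p 0) => qA qB qC Az.
    by rewrite hornerD hornerN [(qA * _).[z]]hornerM Az mul0r subr0 horner_exp sqr_ge0.
  have := @dirichlet_roots_ge _ (len p) (kick b p) (len_gt0 traj) _ _ _ _ n (low_high i) v10 v20.
  rewrite high_endE => main.
  have := leq_trans top main; move: bot le_roots; rewrite high_endE.
  by move: (crossings _ _) (size _) (size _) => x y z; lia.
have sum_le : (\sum_i (size (roots Q (low_end b a i) (high_end b a i))).+1 <= n.+1)%N.
  have : (size (interval_roots (low_end b a) (high_end b a) Q) < size Q)%N.
    apply: max_poly_roots => //; last exact: uniq_interval_roots intervals.
    by apply/allP => z /allpairsPdep[j [y [_ hy ->]]]; apply: root_roots hy.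
  rewrite size_interval_roots.
  have -> : (\sum_i (size (roots Q (low_end b a i) (high_end b a i))).+1
      = \sum_i size (roots Q (low_end b a i) (high_end b a i)) + N.+1)%N.
    by under eq_bigr do rewrite -addn1; rewrite big_split /= sum1_card card_ord.
  by move: szQ; move: (size Q) (\sum_i _)%N => q r; lia.
(* the lower bounds on the numbers of roots add up to the upper bound on their
   sum, so they are all attained *)
have sum_m := sum_next_winding m; rewrite m0 in sum_m.
pose r i := size (roots Q (low_end b a i) (high_end b a i)).
have rE i : m i = (next_winding m i + (r i).+1)%N.
  apply/eqP; rewrite eqn_leq roots_ge /= leqNgt; apply/negP => lt_i.
  have : (\sum_i m i < \sum_i (next_winding m i + (r i).+1))%N.
    rewrite (bigD1 i) // [ltnRHS](bigD1 i) //= -addSn leq_add //.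
    by apply: leq_sum => k _; apply: roots_ge.
  by rewrite sum_m big_split /= addnC ltn_add2l ltnNge sum_le.
exists P, Q; split => //.
- split => //; move: szQ Q_neq0; rewrite -size_poly_gt0.
  by move: (size Q) => q; lia.
- by move=> j; rewrite /signature rE -/(r j) addKn subn1.
- have -> : (\sum_j (signature m j).+1 = \sum_j (r j).+1)%N.
    by apply: eq_bigr => j _; rewrite /signature rE addKn subn1.
  apply/eqP; rewrite eqn_leq sum_le /=.
  have : (\sum_i m i = \sum_i (next_winding m i + (r i).+1))%N.
    by apply: eq_bigr => i _; rewrite -rE.
  rewrite sum_m big_split /= addnC => /addnI <-.
  exact: leqnn.
Qed.

End SingleTrajectory.

(** * Chebyshev dynamics of the caustics *)

Lemma connected_sign (R : realType) (T : topologicalType) (g : T -> R) :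
  connected [set: T] -> continuous g -> (forall t, g t != 0) ->
  forall t t', (g t < 0) = (g t' < 0).
Proof.
move=> hT cg g0.
have itv : is_interval (g @` [set: T])%classic.
  apply/connected_intervalP; apply: connected_continuous_connected => //.
  exact: continuous_subspaceT.
have pos t t' : g t < 0 -> g t' < 0.
  move=> gt; rewrite ltNge; apply/negP => gt'.
  have [u _ /eqP] : (g @` [set: T])%classic 0.
    by apply: (itv (g t) (g t')); [exists t|exists t'|rewrite (ltW gt)].
  by rewrite (negPf (g0 u)).
by move=> t t'; apply/idP/idP; apply: pos.
Qed.

Lemma min_or_max_eq (R : realDomainType) (x u u' : R) : (x < u) = (x < u') ->
  Num.min x u = Num.min x u' \/ Num.max x u = Num.max x u'.
Proof.
by case: (ltP x u) => xu; case: (ltP x u') => xu' // _; [left|right].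
Qed.

Lemma min_max_inj (R : realDomainType) (x u u' : R) :
  Num.min x u = Num.min x u' -> Num.max x u = Num.max x u' -> u = u'.
Proof. by case: (leP x u) => ?; case: (leP x u') => ?; lra. Qed.

Theorem theorem4 (R : realType) (N : nat) (hd : (3 <= N.+1)%N)
  (n : nat) (m : 'I_N.+1 -> nat) (hm : m ord0 = n)
  (T : topologicalType) (hT : connected [set: T])
  (b : T -> 'I_N.+1 -> R) (a : T -> 'I_N -> R)
  (hb : forall i, continuous (fun t => b t i))
  (ha : forall j, continuous (fun t => a t j))
  (bd : R) (hbd : forall t, b t ord_max = bd)
  (hgen : forall t, generic_parameters (b t) (a t))
  (hper : forall t, exists p : nat -> 'rV[R]_N.+1,
     periodic_trajectory (b t) (a t) p n m) :
  exists tau : 'I_N.+1 -> nat,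
    chebyshev_dynamics n tau ord_max 0 (bd^-1)
      (fun t j => (b t (lift ord_max j))^-1)
      (fun t j => (a t j)^-1).
Proof.
have pell t : (forall j, 0 < a t j) /\ exists P Q,
    pell_solution (low_end (b t) (a t)) (high_end (b t) (a t)) n (signature m) P Q.
  have [p [traj caust [n0 periodic] wind]] := hper t.
  have nE := esym (prednK n0); rewrite nE in periodic wind *.
  have m0 : m ord0 = n.-1.+1 by rewrite -nE.
  split; first by move=> j; apply: (caustic_gt0 (hgen t) traj caust wind).
  exact: (trajectory_pell (hgen t) traj caust periodic wind m0).
have a_gt0 t j : 0 < a t j by have [+ _] := pell t.
have b_gt0 t i : 0 < b t i by have [+ _ _ _] := hgen t.
have side j t t' : (a t j < b t (lift ord_max j)) = (a t' j < b t' (lift ord_max j)).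
  rewrite -subr_lt0 -[RHS]subr_lt0.
  apply: (@connected_sign _ _ (fun t => a t j - b t (lift ord_max j)) hT).
    by move=> s; apply: cvgB; [apply: ha|apply: hb].
  by move=> s; rewrite subr_eq0 eq_sym; have [_ _ _] := hgen s.
have unique t t' : (fun j => (b t (lift ord_max j))^-1) = (fun j => (b t' (lift ord_max j))^-1) ->
    forall j, (a t j)^-1 = (a t' j)^-1.
  move=> xE j; have [_ [P [Q pellt]]] := pell t; have [_ [P' [Q' pellt']]] := pell t'.
  have bE i : (b t' (lift ord_max i))^-1 = (b t (lift ord_max i))^-1.
    by have := congr1 (fun f => f i) xE.
  have inv_lt s i : ((b s (lift ord_max i))^-1 < (a s i)^-1) = (a s i < b s (lift ord_max i)).
    by rewrite ltf_pV2 ?posrE.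
  have [||i|lo_eq hi_eq] := pell_endpoints_unique pellt pellt' _ _ _ (lift ord_max j).
  - by rewrite /low_end !fill_max.
  - by rewrite /high_end !fill_max !hbd.
  - case: (unliftP ord_max i) => [k ->|->]; last by left; rewrite /low_end !fill_max.
    rewrite /low_end /high_end !fill_lift bE; apply: min_or_max_eq.
    by rewrite -{1}bE !inv_lt.
  - move: lo_eq hi_eq; rewrite /low_end /high_end !fill_lift bE => lo_eq hi_eq.
    by rewrite (min_max_inj lo_eq hi_eq).
have cont_inv (f : T -> R) : continuous f -> (forall t, 0 < f t) -> continuous (fun t => (f t)^-1).
  by move=> cf f0 t; apply: cvgV; [apply: lt0r_neq0|apply: cf].
exists (signature m); split.
- by move=> j; apply: cont_inv.
- by move=> j; apply: cont_inv.
- pose x t j := (b t (lift ord_max j))^-1.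
  (* off the range of [x] the value is arbitrary *)
  exists (fun X j => if pselect (exists t, x t = X) is left e then (a (projT1 (cid e)) j)^-1 else 0).
  move=> t j; case: pselect => [e|[]]; last by exists t.
  by apply: unique; exact: (esym (projT2 (cid e))).
move=> t; have [_ [P [Q [ivs [szP szQ] eq tauE sum_tau]]]] := pell t.
have -> : fill ord_max bd^-1 (fun j => Num.max (b t (lift ord_max j))^-1 (a t j)^-1)
    = high_end (b t) (a t) by rewrite /high_end hbd.
split => //; last by exists P, Q.
by rewrite -sum_tau -[leqLHS]card_ord -sum1_card leq_sum.
Qed.
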